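(* Let $\tau$ be a positive normalised trace on $\mathcal L_{1,\infty}$ and let $B=\tau\circ{\rm diag}\circ D$ be the corresponding Banach limit. Then $\tau$ is a Connes–Dixmier trace if and only if $B=\theta\circ C^2$ for some extended limit $\theta$ on $l_\infty$.
   Context: $\mu(n,A)$ denotes singular values, $\mu(t,A)=\mu(n,A)$ for $t\in[n,n+1)$; $\mathcal L_{1,\infty}=\{A\text{ compact}:\sup_n(n+1)\mu(n,A)<\infty\}$. Traces are unitarily invariant linear functionals on $\mathcal L_{1,\infty}$; positive: nonnegative on positive operators; normalised: value $1$ on $A\ge0$ with $\mu(n,A)=1/(n+1)$. $l_\infty$: bounded real sequences; $(Cx)_n=\frac1{n+1}\sum_{k=0}^nx_k$ (Cesàro operator). Extended limit on $l_\infty$ (resp. $L_\infty(0,\infty)$): positive linear functional agreeing with the ordinary limit (resp. limit at $+\infty$) on convergent sequences (resp. functions). $D:l_\infty\to l_{1,\infty}$ is $(Dx)_k=\log2\cdot x_n/2^n$ for $2^n-1\le k\le2^{n+1}-2$; ${\rm diag}(x)$ is the diagonal operator in a fixed orthonormal basis; for $\tau$ positive normalised, $B=\tau\circ{\rm diag}\circ D$ is a Banach limit and $\tau(A)=B\big(\frac1{\log2}\{\sum_{k=2^n-1}^{2^{n+1}-2}\mu(k,A)\}_n\big)$ for $A\ge0$. The logarithmic Hardy operator on $L_\infty(0,\infty)$ is $(Mx)(t)=\frac1{\log t}\int_1^tx(s)\frac{ds}{s}$ for $t>1$ (values for $t\le1$ are irrelevant, extended limits being insensitive to them). A trace $\tau$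 is a Connes–Dixmier trace if there is an extended limit $\gamma$ on $L_\infty(0,\infty)$ with $\tau(A)=(\gamma\circ M)\big(t\mapsto\frac1{\log(1+t)}\int_0^t\mu(s,A)ds\big)$ for all $0\le A\in\mathcal L_{1,\infty}$. *)

(* Defs.v *)
From Stdlib Require Import Reals.
From Coquelicot Require Import Coquelicot.
From mathcomp Require Import reals classical_sets boolp measure lebesgue_measure Rstruct.

Open Scope R_scope.

Definition vec := nat -> C.

Definition l2 (x : vec) : Prop := ex_series (fun n => (Cmod (x n)) ^ 2).

Definition norm2 (x : vec) : R := sqrt (Series (fun n => (Cmod (x n)) ^ 2)).

Definition innerRe (x y : vec) : R := Series (fun n => Re (Cmult (x n) (Cconj (y n)))).
Definition innerIm (x y : vec) : R := Series (fun n => Im (Cmult (x n) (Cconj (y n)))).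

(* An operator is represented by a function on sequences; only its values on
   l2 matter (all notions below only look at l2 inputs). *)
Definition op := vec -> vec.

Definition bounded_op (A : op) : Prop :=
  (forall (x y : vec) (a b : C), l2 x -> l2 y ->
     A (fun k => Cplus (Cmult a (x k)) (Cmult b (y k)))
     = (fun k => Cplus (Cmult a (A x k)) (Cmult b (A y k)))) /\
  (forall x, l2 x -> l2 (A x)) /\
  (exists c : R, forall x, l2 x -> norm2 (A x) <= c * norm2 x).

Definition opnorm (A : op) : R :=
  real (Lub_Rbar (fun r => exists x, l2 x /\ norm2 x <= 1 /\ r = norm2 (A x))).

Definition opadd (A B : op) : op := fun x k => Cplus (A x k) (B x k).
Definition opsub (A B : op) : op := fun x k => Cminus (A x k) (B x k).
Definition opscale (c : C) (A : op) : op := fun x k => Cmult c (A x k).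

Fixpoint csum (n : nat) (f : nat -> C) : C :=
  match n with
  | O => RtoC 0
  | S m => Cplus (csum m f) (f m)
  end.

Definition rank_le (F : op) (n : nat) : Prop :=
  exists v : nat -> vec, (forall i, (i < n)%nat -> l2 (v i)) /\
    forall x, l2 x -> exists c : nat -> C,
      F x = (fun k => csum n (fun i => Cmult (c i) (v i k))).

Definition mu (n : nat) (A : op) : R :=
  real (Glb_Rbar (fun r => exists F, bounded_op F /\ rank_le F n /\ r = opnorm (opsub A F))).

Definition muR (t : R) (A : op) : R := mu (Z.to_nat (Int_part t)) A.

Definition compact_op (A : op) : Prop :=
  bounded_op A /\ is_lim_seq (fun n => mu n A) 0.

Definition L1inf (A : op) : Prop :=
  compact_op A /\ exists c : R, forall n, INR (S n) * mu n A <= c.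

Definition positive_op (A : op) : Prop :=
  bounded_op A /\ forall x, l2 x -> innerIm (A x) x = 0 /\ 0 <= innerRe (A x) x.

Definition unitary (U : op) : Prop :=
  bounded_op U /\ (forall x, l2 x -> norm2 (U x) = norm2 x) /\
  (forall y, l2 y -> exists x, l2 x /\ U x = y).

(* B = U A U^{-1} is expressed as  B o U = U o A  on H *)
Definition is_trace (tau : op -> C) : Prop :=
  (forall A B, L1inf A -> L1inf B -> tau (opadd A B) = Cplus (tau A) (tau B)) /\
  (forall (c : C) A, L1inf A -> tau (opscale c A) = Cmult c (tau A)) /\
  (forall A B U, L1inf A -> unitary U ->
     (forall x, l2 x -> B (U x) = U (A x)) -> tau B = tau A).

Definition trace_positive (tau : op -> C) : Prop :=
  forall A, L1inf A -> positive_op A -> Im (tau A) = 0 /\ 0 <= Re (tau A).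

Definition trace_normalised (tau : op -> C) : Prop :=
  forall A, L1inf A -> positive_op A -> (forall n, mu n A = / INR (S n)) ->
    tau A = RtoC 1.

Definition bounded_seq (x : nat -> R) : Prop := exists M, forall n, Rabs (x n) <= M.

Definition ext_limit_seq (theta : (nat -> R) -> R) : Prop :=
  (forall x y, bounded_seq x -> bounded_seq y ->
     theta (fun n => x n + y n) = theta x + theta y) /\
  (forall (c : R) x, bounded_seq x -> theta (fun n => c * x n) = c * theta x) /\
  (forall x, bounded_seq x -> (forall n, 0 <= x n) -> 0 <= theta x) /\
  (forall x (l : R), is_lim_seq x l -> theta x = l).

Definition Ces (x : nat -> R) : nat -> R := fun n => sum_n x n / INR (S n).

(* (Dx)_k = log 2 * x_n / 2^n  for 2^n - 1 <= k <= 2^(n+1) - 2, i.e. n = log2 (k+1) *)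
Definition Dseq (x : nat -> R) : nat -> R :=
  fun k => ln 2 * x (Nat.log2 (S k)) / 2 ^ (Nat.log2 (S k)).

Definition diag (y : nat -> R) : op := fun x k => Cmult (RtoC (y k)) (x k).

Definition posR : set (measurableTypeR R) := [set t | 0 < t]%classic.

Definition lnull (N : set (measurableTypeR R)) : Prop :=
  negligible (@lebesgue_measure R) N.

(* (a representative of) an element of L_oo(0,oo) *)
Definition Linf (f : R -> R) : Prop :=
  @measurable_fun _ _ (measurableTypeR R) (measurableTypeR R) posR f /\
  exists M : R, lnull [set t | 0 < t /\ M < Rabs (f t)]%classic.

Definition ext_limit_fun (gamma : (R -> R) -> R) : Prop :=
  (forall f g, Linf f -> Linf g -> gamma (fun t => f t + g t) = gamma f + gamma g) /\
  (forall (c : R) f, Linf f -> gamma (fun t => c * f t) = c * gamma f) /\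
  (forall f, Linf f -> lnull [set t | 0 < t /\ f t < 0]%classic -> 0 <= gamma f) /\
  (forall f (l : R), Linf f -> is_lim f p_infty l -> gamma f = l).

Definition Mop (x : R -> R) : R -> R :=
  fun t => if Rlt_dec 1 t then / ln t * RInt (fun s => x s / s) 1 t else 0.

Definition avg_mu (A : op) : R -> R :=
  fun t => / ln (1 + t) * RInt (fun s => muR s A) 0 t.

Definition connes_dixmier (tau : op -> C) : Prop :=
  exists gamma, ext_limit_fun gamma /\
    forall A, L1inf A -> positive_op A -> tau A = RtoC (gamma (Mop (avg_mu A))).

(* Main.v *)
Require Import Defs.
From Stdlib Require Import Reals ZArith Arith Lra Lia List Classical ClassicalEpsilon.
From Stdlib Require Import FunctionalExtensionality PropExtensionality.
From mathcomp Require filter measurable_realfun.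
From Coquelicot Require Import Coquelicot.

(** Write [x_n = (1 / ln 2) sum_(2^n - 1 <= k <= 2^(n+1) - 2) mu(k, A)].  Since [mu(k, A) = O(1/k)],
    the mean [avg_mu A] differs from [(C x)_n] by [O(1/n)] on [[2^n, 2^(n+1)]], and integrating
    against [ds/s] shows that [M (avg_mu A)] differs there from [(C^2 x)_n] by [o(1)].

    If [tau] comes from [gamma], let [theta y] be the value of [gamma] at [t |-> y_(log2 t)].
    Conversely, given [theta], let [gamma f] be the value of [theta] at the sequence of limits of [f]
    along ultrafilters on [[2^n, 2^(n+1)]] that contain every conull set.  It remains to see that
    [tau A = theta (C^2 x)] for [A >= 0].  The spectral theorem for a compact positive injective
    operator, with eigenvectors found by weak limits and deflation, gives
    [tau A = tau (diag (mu A))]; averaging over cyclic shifts inside dyadic blocks, which are unitary,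
    replaces [mu A] by its block means [D x].  An arbitrary [A] is made injective by adding a small
    multiple of [diag (1/(k+1))], and the inequality [mu(n+m, A+B) <= mu(n, A) + mu(m, B)] bounds the
    resulting change of [C x]. *)

Open Scope R_scope.

(** No continuity of the trace is assumed. Its substitute is positivity, which makes [dtrace]
    monotone: an error is negligible once it is dominated entrywise by small multiples of a fixed
    sequence of order [1/k], apart from finitely many blocks. Hence only [2 ^ m] rotations are
    averaged, with [m] fixed in advance: the trace is finitely additive, and the error left over is
    [O(2^-m)].

    Diagonalisation needs a complete orthonormal sequence of eigenvectors. Deflation of an operator
    with a kernel may miss part of the space, whence the detour through injective operators. The
    perturbation has a trace that normalisation gives exactly, while the singular values are
    compared at shifted indices only; the shift costs a small proportion of a logarithmic sum.

    On the function side, an element of [L_oo] is known up to null sets: sampling at points would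
    lose positivity, and suprema over blocks would lose additivity. Ultrafilter limits keep both. *)

Ltac abs_lra := cbv beta in *;
  repeat match goal with
  | H : Rabs _ <= _ |- _ => apply Rabs_le_between in H
  | H : Rabs _ < _ |- _ => apply Rabs_lt_between in H
  | |- Rabs _ <= _ => apply Rabs_le_between
  | |- Rabs _ < _ => apply Rabs_def1
  end; lra.

Lemma decr_le (y : nat -> R) : (forall k, y (S k) <= y k) -> forall j i, (i <= j)%nat -> y j <= y i.
Proof. intros Hd j i Hij. induction Hij as [|m _ IH]; [lra|]. specialize (Hd m). lra. Qed.

Lemma Rabs_inv_mult_le a x m : 0 < a -> Rabs x <= a * m -> Rabs (/ a * x) <= m.
Proof.
  intros Ha H. rewrite Rabs_mult, Rabs_pos_eq by (left; apply Rinv_pos, Ha).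
  apply Rmult_le_reg_l with a; [exact Ha|]. rewrite <- Rmult_assoc, Rinv_r, Rmult_1_l by lra.
  exact H.
Qed.

(** * Finite sums and series of real numbers *)

Fixpoint rsum (n : nat) (f : nat -> R) : R :=
  match n with O => 0 | S m => rsum m f + f m end.

Lemma rsum_ext n f g : (forall k, (k < n)%nat -> f k = g k) -> rsum n f = rsum n g.
Proof.
  induction n as [|n IH]; intros H; simpl; [reflexivity|].
  rewrite (H n) by lia. rewrite IH; [reflexivity|]. intros; apply H; lia.
Qed.

Lemma rsum_plus n f g : rsum n (fun k => f k + g k) = rsum n f + rsum n g.
Proof. induction n; simpl; [ring|rewrite IHn; ring]. Qed.

Lemma rsum_scal n c f : rsum n (fun k => c * f k) = c * rsum n f.
Proof. induction n; simpl; [ring|rewrite IHn; ring]. Qed.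

Lemma rsum_const n c : rsum n (fun _ => c) = INR n * c.
Proof. induction n; [simpl; ring|]. rewrite S_INR. simpl rsum. rewrite IHn. ring. Qed.

Lemma rsum_le n f g : (forall k, (k < n)%nat -> f k <= g k) -> rsum n f <= rsum n g.
Proof.
  induction n as [|n IH]; intros H; simpl; [lra|].
  specialize (IH (fun k Hk => H k (Nat.lt_lt_succ_r _ _ Hk))).
  specialize (H n ltac:(lia)). lra.
Qed.

Lemma rsum_nonneg n f : (forall k, (k < n)%nat -> 0 <= f k) -> 0 <= rsum n f.
Proof.
  intros H. replace 0 with (rsum n (fun _ => 0)); [apply rsum_le, H|].
  rewrite rsum_const; ring.
Qed.

Lemma rsum_abs n f : Rabs (rsum n f) <= rsum n (fun k => Rabs (f k)).
Proof.
  induction n; simpl; [rewrite Rabs_R0; lra|].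
  eapply Rle_trans; [apply Rabs_triang|lra].
Qed.

Lemma rsum_add n m f : rsum (n + m) f = rsum n f + rsum m (fun k => f (n + k)%nat).
Proof.
  induction m; [rewrite Nat.add_0_r; simpl; ring|].
  rewrite Nat.add_succ_r. simpl. rewrite IHm. ring.
Qed.

Lemma rsum_mono n m f : (forall k, 0 <= f k) -> (n <= m)%nat -> rsum n f <= rsum m f.
Proof.
  intros H Hn. replace m with (n + (m - n))%nat by lia. rewrite rsum_add.
  pose proof (rsum_nonneg (m - n) (fun k => f (n + k)%nat) (fun k _ => H _)). lra.
Qed.

Lemma rsum_single n j (v : R) :
  rsum n (fun k => if Nat.eq_dec k j then v else 0) = if lt_dec j n then v else 0.
Proof.
  induction n; [destruct (lt_dec j 0); [lia|reflexivity]|].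
  simpl rsum. rewrite IHn. destruct (Nat.eq_dec n j), (lt_dec j n), (lt_dec j (S n)); try lia; ring.
Qed.

Lemma sum_n_rsum f n : sum_n f n = rsum (S n) f.
Proof.
  induction n; [rewrite sum_O; simpl; symmetry; apply Rplus_0_l|].
  rewrite sum_Sn, IHn. reflexivity.
Qed.

Lemma nonneg_series_bound f M : (forall k, 0 <= f k) -> (forall n, rsum n f <= M) ->
  ex_series f /\ Series f <= M.
Proof.
  intros H HM.
  assert (E : ex_finite_lim_seq (sum_n f)).
  { apply (ex_finite_lim_seq_incr _ M).
    - intros n. rewrite sum_Sn. unfold plus; simpl. specialize (H (S n)). lra.
    - intros n. rewrite sum_n_rsum. apply HM. }
  destruct E as [l Hl].
  assert (S0 : is_series f l) by exact Hl.
  split; [exists l; exact S0|].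
  rewrite (is_series_unique _ _ S0).
  apply (is_lim_seq_le (sum_n f) (fun _ => M) l M); [|exact Hl|apply is_lim_seq_const].
  intros n. rewrite sum_n_rsum. apply HM.
Qed.

Lemma rsum_le_series f n : (forall k, 0 <= f k) -> ex_series f -> rsum n f <= Series f.
Proof.
  intros H E. apply Rle_trans with (rsum (S n) f); [simpl; specialize (H n); lra|].
  rewrite <- sum_n_rsum.
  apply (is_lim_seq_incr_compare (sum_n f)); [exact (Series_correct f E)|].
  intros k. rewrite sum_Sn. unfold plus; simpl. specialize (H (S k)). lra.
Qed.

Lemma series_nonneg f : (forall k, 0 <= f k) -> ex_series f -> 0 <= Series f.
Proof. intros H E. exact (rsum_le_series f 0 H E). Qed.

Lemma series_finite f n : (forall k, (n <= k)%nat -> f k = 0) -> is_series f (rsum n f).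
Proof.
  intros H. change (is_lim_seq (sum_n f) (rsum n f)).
  apply is_lim_seq_ext_loc with (fun _ => rsum n f); [|apply is_lim_seq_const].
  exists n. intros m Hm. rewrite sum_n_rsum.
  replace (S m) with (n + (S m - n))%nat by lia. rewrite rsum_add.
  rewrite (rsum_ext (S m - n) _ (fun _ => 0)); [rewrite rsum_const; ring|].
  intros; apply H; lia.
Qed.

Lemma eq_of_close x y (u : nat -> R) :
  (forall n, Rabs (x - y) <= u n) -> is_lim_seq u 0 -> x = y.
Proof.
  intros H L. assert (Z : Rabs (x - y) <= 0)
    by (apply (is_lim_seq_le (fun _ => Rabs (x - y)) u (Finite _) 0 H (is_lim_seq_const _) L)).
  abs_lra.
Qed.

(** * Ultrafilters *)

(** Properness is stated as [ultra_ex]: finitely many member sets have a common point, and limits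
    are compared at such a point. [ultra_em] is maximality. *)
Record ultra {T : Type} (U : (T -> Prop) -> Prop) : Prop := {
  ultra_and : forall P Q, U P -> U Q -> U (fun x => P x /\ Q x);
  ultra_imp : forall P Q : T -> Prop, (forall x, P x -> Q x) -> U P -> U Q;
  ultra_em : forall P, U P \/ U (fun x => ~ P x);
  ultra_ex : forall P, U P -> exists x, P x }.

Arguments ultra_and {T U}.
Arguments ultra_imp {T U}.
Arguments ultra_em {T U}.
Arguments ultra_ex {T U}.

(** The limit is the supremum of the levels [r] with [r <= u n] on a member set; [ultra_em] decides
    on which side of a level the sequence lies. *)
Lemma ultra_limit {T : Type} U (u : T -> R) M : ultra U -> U (fun n => Rabs (u n) <= M) ->
  exists l : R, forall eps, 0 < eps -> U (fun n => Rabs (u n - l) < eps).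
Proof.
  intros HU HM.
  destruct (completeness (fun r => U (fun n => r <= u n))) as [l [Hub Hlub]].
  - exists M. intros r Hr.
    destruct (ultra_ex HU _ (ultra_and HU _ _ HM Hr)) as [n [H1 H2]].
    abs_lra.
  - exists (- M). refine (ultra_imp HU _ _ _ HM). intros n Hn.
    abs_lra.
  - exists l. intros eps He.
    assert (A1 : U (fun n => l - eps < u n)).
    { apply NNPP. intros Hn. assert (l <= l - eps); [|lra].
      apply Hlub. intros r Hr. apply Rnot_lt_le. intros Hlt. apply Hn.
      refine (ultra_imp HU _ _ _ Hr). simpl; intros; lra. }
    assert (A2 : U (fun n => u n < l + eps)).
    { destruct (ultra_em HU (fun n => u n < l + eps)) as [H|H]; [exact H|].
      assert (l + eps <= l); [|lra]. apply Hub.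
      refine (ultra_imp HU _ _ _ H). simpl; intros; lra. }
    refine (ultra_imp HU _ _ _ (ultra_and HU _ _ A1 A2)).
    simpl; intros n [H1 H2]. abs_lra.
Qed.

Definition is_ulim {T : Type} (U : (T -> Prop) -> Prop) (u : T -> R) (l : R) :=
  forall eps, 0 < eps -> U (fun n => Rabs (u n - l) < eps).

Lemma is_ulim_le {T : Type} U (u v : T -> R) l l' : ultra U -> is_ulim U u l -> is_ulim U v l' ->
  U (fun n => u n <= v n) -> l <= l'.
Proof.
  intros HU H1 H2 H. apply le_epsilon. intros eps He.
  assert (He2 : 0 < eps / 2) by lra.
  destruct (ultra_ex HU _ (ultra_and HU _ _ H
    (ultra_and HU _ _ (H1 _ He2) (H2 _ He2)))) as [n [A [B D]]].
  abs_lra.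
Qed.

Lemma is_ulim_unique {T : Type} U (u : T -> R) l l' : ultra U -> is_ulim U u l -> is_ulim U u l' ->
  l = l'.
Proof.
  intros HU H1 H2.
  assert (E : U (fun n => u n <= u n)).
  { refine (ultra_imp HU _ _ _ (H1 1 Rlt_0_1)). intros; lra. }
  apply Rle_antisym; eapply is_ulim_le; eauto.
Qed.

Lemma is_ulim_const {T : Type} (U : (T -> Prop) -> Prop) c : ultra U -> is_ulim U (fun _ => c) c.
Proof.
  intros HU eps He. destruct (ultra_em HU (fun _ => Rabs (c - c) < eps)) as [H|H]; [exact H|].
  destruct (ultra_ex HU _ H) as [x Hx]. exfalso. apply Hx.
  rewrite Rminus_diag, Rabs_R0. exact He.
Qed.

Lemma is_ulim_close {T : Type} U (u : T -> R) l a e : ultra U -> is_ulim U u l ->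
  U (fun n => Rabs (u n - a) <= e) -> Rabs (l - a) <= e.
Proof.
  intros HU Hl H. apply le_epsilon. intros eps He.
  destruct (ultra_ex HU _ (ultra_and HU _ _ H (Hl eps He))) as [n [H1 H2]]. abs_lra.
Qed.

Lemma is_ulim_plus {T : Type} U (u v : T -> R) l l' : ultra U -> is_ulim U u l -> is_ulim U v l' ->
  is_ulim U (fun n => u n + v n) (l + l').
Proof.
  intros HU H1 H2 eps He. assert (He2 : 0 < eps / 2) by lra.
  refine (ultra_imp HU _ _ _ (ultra_and HU _ _ (H1 _ He2) (H2 _ He2))).
  simpl; intros n [B D]. abs_lra.
Qed.

Lemma is_ulim_mult {T : Type} U (u v : T -> R) l l' : ultra U -> is_ulim U u l -> is_ulim U v l' ->
  is_ulim U (fun n => u n * v n) (l * l').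
Proof.
  intros HU H1 H2 eps He.
  (* With both deviations below [d <= 1], the three terms into which the difference of products is
     split add up to at most [d * K]. *)
  set (K := Rabs l + Rabs l' + 1).
  assert (HK : 1 <= K) by (unfold K; pose proof (Rabs_pos l); pose proof (Rabs_pos l'); lra).
  set (d := Rmin 1 (eps / (2 * K))).
  assert (Hd : 0 < d).
  { apply Rmin_glb_lt; [lra|]. apply Rdiv_lt_0_compat; lra. }
  refine (ultra_imp HU _ _ _ (ultra_and HU _ _ (H1 _ Hd) (H2 _ Hd))).
  simpl; intros n [B D].
  replace (u n * v n - l * l') with ((u n - l) * (v n - l') + (u n - l) * l' + l * (v n - l')) by ring.
  assert (d <= 1) by apply Rmin_l.
  assert (d * K <= eps / 2).
  { apply Rle_trans with (eps / (2 * K) * K).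
    - apply Rmult_le_compat_r; [lra|apply Rmin_r].
    - right; field; lra. }
  eapply Rle_lt_trans; [apply Rabs_triang|].
  eapply Rle_lt_trans; [apply Rplus_le_compat_r, Rabs_triang|].
  rewrite !Rabs_mult.
  pose proof (Rabs_pos l); pose proof (Rabs_pos l').
  pose proof (Rabs_pos (u n - l)); pose proof (Rabs_pos (v n - l')).
  unfold K in *. nra.
Qed.

Lemma is_ulim_rsum {T : Type} U N (u : nat -> T -> R) l : ultra U ->
  (forall k, is_ulim U (u k) (l k)) ->
  is_ulim U (fun n => rsum N (fun k => u k n)) (rsum N l).
Proof.
  intros HU H. induction N; simpl; [apply is_ulim_const, HU|].
  apply is_ulim_plus; auto.
Qed.

(** * The Hilbert space l2 *)

Definition vlin (a : C) (x : vec) (b : C) (y : vec) : vec :=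
  fun k => Cplus (Cmult a (x k)) (Cmult b (y k)).
Definition vzero : vec := fun _ => RtoC 0.
Definition nsq (x : vec) : R := Series (fun n => (Cmod (x n)) ^ 2).
Definition ip (x y : vec) : C := (innerRe x y, innerIm x y).

Lemma Csq_nonneg z : 0 <= Cmod z ^ 2.
Proof. apply pow2_ge_0. Qed.
#[local] Hint Resolve Csq_nonneg : core.

Lemma l2_bound x M : (forall n, rsum n (fun k => Cmod (x k) ^ 2) <= M) -> l2 x /\ nsq x <= M.
Proof. intros H. apply nonneg_series_bound; auto. Qed.

Lemma l2_partial x n : l2 x -> rsum n (fun k => Cmod (x k) ^ 2) <= nsq x.
Proof. intros H. apply rsum_le_series; auto. Qed.

Lemma nsq_nonneg x : l2 x -> 0 <= nsq x.
Proof. intros H. exact (l2_partial x 0 H). Qed.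

Lemma norm2_nonneg x : 0 <= norm2 x.
Proof. apply sqrt_pos. Qed.

Lemma norm2_sq x : l2 x -> norm2 x ^ 2 = nsq x.
Proof. intros H. unfold norm2. rewrite pow2_sqrt; [reflexivity|]. apply nsq_nonneg, H. Qed.

Lemma Cmod_sq_lin a z b w :
  Cmod (a * z + b * w)%C ^ 2 <= 2 * Cmod a ^ 2 * Cmod z ^ 2 + 2 * Cmod b ^ 2 * Cmod w ^ 2.
Proof.
  pose proof (Cmod_triangle (a * z) (b * w)) as H. rewrite !Cmod_mult in H.
  pose proof (Cmod_ge_0 (a * z + b * w)).
  pose proof (Cmod_ge_0 a); pose proof (Cmod_ge_0 b); pose proof (Cmod_ge_0 z);
  pose proof (Cmod_ge_0 w).
  set (p := Cmod a * Cmod z) in *. set (q := Cmod b * Cmod w) in *.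
  replace (2 * Cmod a ^ 2 * Cmod z ^ 2 + 2 * Cmod b ^ 2 * Cmod w ^ 2)
    with (2 * p ^ 2 + 2 * q ^ 2) by (unfold p, q; ring).
  assert (0 <= p) by (unfold p; nra). assert (0 <= q) by (unfold q; nra).
  pose proof (pow2_ge_0 (p - q)). nra.
Qed.

Lemma l2_lin a x b y : l2 x -> l2 y -> l2 (vlin a x b y).
Proof.
  intros Hx Hy.
  apply (l2_bound _ (2 * Cmod a ^ 2 * nsq x + 2 * Cmod b ^ 2 * nsq y)). intros n.
  eapply Rle_trans; [apply rsum_le; intros; apply Cmod_sq_lin|].
  rewrite rsum_plus, !rsum_scal.
  pose proof (l2_partial x n Hx); pose proof (l2_partial y n Hy).
  pose proof (Csq_nonneg a); pose proof (Csq_nonneg b). nra.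
Qed.

Lemma l2_zero : l2 vzero.
Proof.
  apply (l2_bound _ 0). intros n. rewrite (rsum_ext n _ (fun _ => 0)).
  - rewrite rsum_const; lra.
  - intros. unfold vzero. rewrite Cmod_0. ring.
Qed.
#[local] Hint Resolve l2_lin l2_zero : core.

Lemma im_le_Cmod z : Rabs (Im z) <= Cmod z.
Proof. eapply Rle_trans; [apply Rmax_r|apply Rmax_Cmod]. Qed.

(** [p] stands for [Re] or [Im], so that one comparison with [|x_n|^2 + |y_n|^2] serves both parts
    of the inner product. *)
Lemma ip_ex (p : C -> R) x y : (forall z, Rabs (p z) <= Cmod z) -> l2 x -> l2 y ->
  ex_series (fun n => p (x n * Cconj (y n))%C).
Proof.
  intros Hp Hx Hy. apply (@ex_series_le R_AbsRing R_CompleteNormedModule)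
    with (fun n => Cmod (x n) ^ 2 + Cmod (y n) ^ 2).
  - intros n. eapply Rle_trans; [apply Hp|]. rewrite Cmod_mult, Cmod_conj.
    pose proof (Cmod_ge_0 (x n)); pose proof (Cmod_ge_0 (y n)). nra.
  - apply (@ex_series_plus R_AbsRing R_NormedModule); assumption.
Qed.

Lemma Series_lin2 a b f g : ex_series f -> ex_series g ->
  Series (fun n => a * f n + b * g n) = a * Series f + b * Series g.
Proof.
  intros Hf Hg. rewrite Series_plus, !Series_scal_l; [reflexivity| |];
  apply (@ex_series_scal_l R_AbsRing R_NormedModule); assumption.
Qed.

Lemma ex_series_lin2 a b (f g : nat -> R) : ex_series f -> ex_series g ->
  ex_series (fun n => a * f n + b * g n).
Proof.
  intros Hf Hg. apply (@ex_series_plus R_AbsRing R_NormedModule);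
  apply (@ex_series_scal_l R_AbsRing R_NormedModule); assumption.
Qed.

Lemma ip_lin_l a x b y z : l2 x -> l2 y -> l2 z ->
  ip (vlin a x b y) z = (a * ip x z + b * ip y z)%C.
Proof.
  intros Hx Hy Hz. destruct a as [a1 a2], b as [b1 b2].
  pose proof (ip_ex Re x z re_le_Cmod Hx Hz); pose proof (ip_ex Im x z im_le_Cmod Hx Hz).
  pose proof (ip_ex Re y z re_le_Cmod Hy Hz); pose proof (ip_ex Im y z im_le_Cmod Hy Hz).
  unfold ip, innerRe, innerIm, Cplus, Cmult; simpl. f_equal.
  - transitivity (Series (fun n =>
      1 * (a1 * Re (x n * Cconj (z n))%C + (- a2) * Im (x n * Cconj (z n))%C)
      + 1 * (b1 * Re (y n * Cconj (z n))%C + (- b2) * Im (y n * Cconj (z n))%C))).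
    { apply Series_ext. intros n. unfold vlin, Re, Im, Cconj; simpl. ring. }
    rewrite !Series_lin2; auto using ex_series_lin2.
    unfold Re, Im, Cconj; simpl. ring.
  - transitivity (Series (fun n =>
      1 * (a2 * Re (x n * Cconj (z n))%C + a1 * Im (x n * Cconj (z n))%C)
      + 1 * (b2 * Re (y n * Cconj (z n))%C + b1 * Im (y n * Cconj (z n))%C))).
    { apply Series_ext. intros n. unfold vlin, Re, Im, Cconj; simpl. ring. }
    rewrite !Series_lin2; auto using ex_series_lin2.
    unfold Re, Im, Cconj; simpl. ring.
Qed.

Lemma ip_conj x y : ip y x = Cconj (ip x y).
Proof.
  unfold ip, innerRe, innerIm, Cconj; simpl. f_equal.
  - apply Series_ext. intros n. unfold Re; simpl. ring.
  - rewrite <- Series_opp. apply Series_ext. intros n. unfold Im; simpl. ring.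
Qed.

Lemma ip_self x : ip x x = RtoC (nsq x).
Proof.
  unfold ip, innerRe, innerIm, nsq, RtoC. f_equal.
  - apply Series_ext. intros n. rewrite Cmod2_alt. unfold Re, Im; simpl. ring.
  - rewrite (Series_ext _ (fun n => 0 * 0)).
    + rewrite Series_scal_l. ring.
    + intros n. unfold Im; simpl. ring.
Qed.

Lemma ip_lin_r a x b y z : l2 x -> l2 y -> l2 z ->
  ip z (vlin a x b y) = (Cconj a * ip z x + Cconj b * ip z y)%C.
Proof.
  intros Hx Hy Hz. rewrite ip_conj, ip_lin_l by assumption.
  rewrite Cplus_conj, !Cmult_conj, <- !ip_conj. reflexivity.
Qed.

Lemma nsq_zero x : l2 x -> nsq x = 0 -> x = vzero.
Proof.
  intros Hx H. extensionality k.
  pose proof (l2_partial x (S k) Hx) as P. simpl in P.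
  pose proof (rsum_nonneg k (fun k => Cmod (x k) ^ 2) (fun k _ => Csq_nonneg _)) as Q.
  simpl in Q. unfold vzero. apply Cmod_eq_0.
  pose proof (Cmod_ge_0 (x k)). nra.
Qed.

Lemma nsq_lin a x b y : l2 x -> l2 y ->
  nsq (vlin a x b y) =
  Cmod a ^ 2 * nsq x + 2 * Re (a * Cconj b * ip x y)%C + Cmod b ^ 2 * nsq y.
Proof.
  intros Hx Hy. apply RtoC_inj. rewrite <- ip_self.
  rewrite ip_lin_l by auto. rewrite !ip_lin_r by assumption.
  rewrite !ip_self, (ip_conj x y).
  destruct a as [a1 a2], b as [b1 b2], (ip x y) as [p q].
  rewrite !Cmod2_alt. unfold RtoC, Cplus, Cmult, Cconj, Re, Im; simpl.
  f_equal; ring.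
Qed.

Lemma ip_zero_l x : ip vzero x = RtoC 0.
Proof.
  unfold ip, innerRe, innerIm, RtoC. f_equal;
  (rewrite (Series_ext _ (fun n => 0 * 0)); [rewrite Series_scal_l; ring|]);
  intros n; unfold vzero, Re, Im; simpl; ring.
Qed.

Lemma ip_zero_r x : ip x vzero = RtoC 0.
Proof. rewrite ip_conj, ip_zero_l. unfold Cconj, RtoC; simpl. f_equal; ring. Qed.

(** * Bounded operators and positive forms *)

Lemma bounded_id : bounded_op (fun x => x).
Proof.
  split; [reflexivity|]. split; [auto|]. exists 1. intros. lra.
Qed.

Lemma op_lin A a x b y : bounded_op A -> l2 x -> l2 y ->
  A (vlin a x b y) = vlin a (A x) b (A y).
Proof. intros [H _] Hx Hy. apply H; assumption. Qed.

Lemma op_l2 A x : bounded_op A -> l2 x -> l2 (A x).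
Proof. intros [_ [H _]]. apply H. Qed.
#[local] Hint Resolve op_l2 : core.

Lemma ip_positive A x : positive_op A -> l2 x -> ip (A x) x = RtoC (innerRe (A x) x).
Proof. intros [_ H] Hx. unfold ip, RtoC. f_equal. apply H, Hx. Qed.

Lemma innerRe_ip x y : innerRe x y = Re (ip x y).
Proof. reflexivity. Qed.

(** Polarisation: the form at [x + c y] is real for every [c]; the choices [c = 1] and [c = i] give
    the imaginary and the real part of the identity. *)
Lemma positive_symmetric A x y : positive_op A -> l2 x -> l2 y -> ip (A x) y = ip x (A y).
Proof.
  intros HP Hx Hy. pose proof HP as [HA _].
  assert (K : forall c, Im (Cconj c * ip (A x) y + c * ip (A y) x)%C = 0).
  { intros c. pose proof (l2_lin 1 x c y Hx Hy) as Hz.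
    pose proof (ip_positive A _ HP Hz) as E.
    rewrite op_lin in E by assumption.
    rewrite ip_lin_l in E by auto. rewrite !ip_lin_r in E by auto.
    rewrite (ip_positive A x HP Hx), (ip_positive A y HP Hy) in E.
    apply (f_equal Im) in E.
    destruct c as [c1 c2], (ip (A x) y) as [p q], (ip (A y) x) as [p' q'].
    unfold Im, RtoC, Cconj, Cplus, Cmult in *; simpl in *. lra. }
  rewrite (ip_conj (A y) x).
  pose proof (K (RtoC 1)) as K1. pose proof (K Ci) as K2.
  destruct (ip (A x) y) as [p q], (ip (A y) x) as [p' q'].
  unfold Im, RtoC, Ci, Cconj, Cplus, Cmult in *; simpl in *. f_equal; lra.
Qed.

Lemma form_lin A x c y : positive_op A -> l2 x -> l2 y ->
  innerRe (A (vlin 1 x c y)) (vlin 1 x c y) =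
  innerRe (A x) x + 2 * Re (Cconj c * ip (A x) y)%C + Cmod c ^ 2 * innerRe (A y) y.
Proof.
  intros HP Hx Hy. pose proof HP as [HA _].
  apply RtoC_inj. rewrite <- ip_positive by auto.
  rewrite op_lin by assumption.
  rewrite ip_lin_l by auto. rewrite !ip_lin_r by auto.
  rewrite (positive_symmetric A y x) by assumption. rewrite (ip_conj (A x) y).
  rewrite (ip_positive A x HP Hx), (ip_positive A y HP Hy), Cmod2_alt.
  destruct c as [c1 c2], (ip (A x) y) as [p q].
  unfold Re, Im, RtoC, Cconj, Cplus, Cmult; simpl. f_equal; ring.
Qed.

(** The form is nonnegative along [x - r <A x, y> y] for real [r]. It may be degenerate, so [Q = 0]
    is a case of its own. The identity operator yields the usual inequality, and [y = A x] the bound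
    [positive_norm_bound]. *)
Lemma form_cauchy_schwarz A x y : positive_op A -> l2 x -> l2 y ->
  Cmod (ip (A x) y) ^ 2 <= innerRe (A x) x * innerRe (A y) y.
Proof.
  intros HP Hx Hy. set (S0 := Cmod (ip (A x) y) ^ 2).
  set (Q := innerRe (A y) y). set (P := innerRe (A x) x).
  assert (HQ : 0 <= Q) by (apply HP, Hy). assert (HP0 : 0 <= P) by (apply HP, Hx).
  assert (HS : 0 <= S0) by (unfold S0; auto).
  assert (K : forall r : R, 0 <= P - 2 * r * S0 + r ^ 2 * S0 * Q).
  { intros r. set (c := (RtoC (- r) * ip (A x) y)%C).
    assert (E := form_lin A x c y HP Hx Hy). fold P Q in E.
    pose proof (proj2 (proj2 HP _ (l2_lin 1 x c y Hx Hy))) as F. rewrite E in F.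
    replace (Re (Cconj c * ip (A x) y)%C) with (- r * S0) in F.
    2:{ unfold S0, c. rewrite Cmod2_alt. destruct (ip (A x) y) as [p q].
        unfold Re, Im, RtoC, Cconj, Cmult; simpl. ring. }
    replace (Cmod c ^ 2) with (r ^ 2 * S0) in F; [lra|].
    unfold c, S0. rewrite Cmod_mult, Cmod_R, Rabs_Ropp, Rpow_mult_distr, pow2_abs. reflexivity. }
  destruct (Req_dec S0 0) as [E|E]; [rewrite E; nra|].
  destruct (Req_dec Q 0) as [EQ|EQ].
  (* When [Q = 0] the value is affine in [r], and this [r] would make it [-1]. *)
  - specialize (K ((P + 1) / (2 * S0))). rewrite EQ in K.
    replace (2 * ((P + 1) / (2 * S0)) * S0) with (P + 1) in K by (field; exact E). lra.
  (* The minimum of the quadratic polynomial in [r]. *)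
  - specialize (K (/ Q)). replace (P - 2 * / Q * S0 + (/ Q) ^ 2 * S0 * Q) with (P - S0 / Q) in K
      by (field; exact EQ).
    assert (0 <= (P - S0 / Q) * Q) by nra.
    replace ((P - S0 / Q) * Q) with (P * Q - S0) in H by (field; exact EQ). lra.
Qed.

Lemma cauchy_schwarz_sq x y : l2 x -> l2 y -> Cmod (ip x y) ^ 2 <= nsq x * nsq y.
Proof.
  intros Hx Hy. assert (E : forall z, innerRe z z = nsq z) by (intros; rewrite innerRe_ip, ip_self; reflexivity).
  rewrite <- (E x), <- (E y). apply (form_cauchy_schwarz (fun z => z)); [|assumption..].
  split; [apply bounded_id|]. intros z Hz. rewrite E. split; [|apply nsq_nonneg, Hz].
  change (Im (ip z z) = 0). rewrite ip_self. reflexivity.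
Qed.

Lemma sq_le_sq a b : 0 <= b -> a ^ 2 <= b ^ 2 -> a <= b.
Proof. intros Hb H. apply Rnot_lt_le. intros Hl. nra. Qed.

Lemma cauchy_schwarz x y : l2 x -> l2 y -> Cmod (ip x y) <= norm2 x * norm2 y.
Proof.
  intros Hx Hy. pose proof (norm2_nonneg x); pose proof (norm2_nonneg y).
  apply sq_le_sq; [nra|]. rewrite Rpow_mult_distr, !norm2_sq by assumption.
  apply cauchy_schwarz_sq; assumption.
Qed.

Lemma norm2_lin a x b y : l2 x -> l2 y ->
  norm2 (vlin a x b y) <= Cmod a * norm2 x + Cmod b * norm2 y.
Proof.
  intros Hx Hy. pose proof (norm2_nonneg x); pose proof (norm2_nonneg y).
  pose proof (Cmod_ge_0 a); pose proof (Cmod_ge_0 b).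
  apply sq_le_sq; [nra|]. rewrite norm2_sq by auto. rewrite nsq_lin by assumption.
  rewrite <- !norm2_sq by assumption.
  assert (Re (a * Cconj b * ip x y)%C <= Cmod a * Cmod b * (norm2 x * norm2 y)).
  { eapply Rle_trans; [apply Rle_abs|]. eapply Rle_trans; [apply re_le_Cmod|].
    rewrite !Cmod_mult, Cmod_conj. apply Rmult_le_compat_l; [nra|].
    apply cauchy_schwarz; assumption. }
  nra.
Qed.

Lemma norm2_scal a x : norm2 (fun k => a * x k)%C = Cmod a * norm2 x.
Proof.
  unfold norm2. rewrite <- (sqrt_pow2 (Cmod a)) by apply Cmod_ge_0.
  rewrite (Series_ext _ (fun n => Cmod a ^ 2 * Cmod (x n) ^ 2)).
  - rewrite Series_scal_l. rewrite sqrt_mult_alt by auto. reflexivity.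
  - intros n. rewrite Cmod_mult. ring.
Qed.

Lemma norm2_zero : norm2 vzero = 0.
Proof.
  replace vzero with (fun k => 0 * vzero k)%C
    by (extensionality k'; unfold vzero; ring).
  rewrite norm2_scal, Cmod_0. ring.
Qed.

Lemma norm2_eq0 x : l2 x -> norm2 x = 0 -> x = vzero.
Proof. intros Hx H. apply nsq_zero; [assumption|]. rewrite <- norm2_sq, H by assumption. ring. Qed.

Lemma l2_scal a x : l2 x -> l2 (fun k => a * x k)%C.
Proof.
  intros Hx. replace (fun k => a * x k)%C with (vlin a x 0 x)
    by (extensionality k'; unfold vlin; ring).
  apply l2_lin; assumption.
Qed.

Definition delta (j : nat) : vec := fun k => if Nat.eq_dec k j then RtoC 1 else RtoC 0.

Lemma l2_delta j : l2 (delta j).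
Proof.
  eexists. apply (series_finite _ (S j)). intros k Hk. unfold delta.
  destruct Nat.eq_dec; [lia|]. rewrite Cmod_0. ring.
Qed.
#[local] Hint Resolve l2_scal l2_delta : core.

Lemma ip_delta x j : ip x (delta j) = x j.
Proof.
  assert (D : forall c (f : nat -> R), (forall k, f k = if Nat.eq_dec k j then c else 0) ->
    Series f = c).
  { intros c f Hf. transitivity (rsum (S j) f).
    - apply is_series_unique, series_finite. intros k Hk. rewrite Hf.
      destruct Nat.eq_dec; [lia|reflexivity].
    - rewrite (rsum_ext _ _ _ (fun k _ => Hf k)), rsum_single.
      destruct lt_dec; [reflexivity|lia]. }
  unfold ip, innerRe, innerIm. rewrite (surjective_pairing (x j)). f_equal.
  - apply D. intros k. unfold delta. destruct Nat.eq_dec; [subst|]; unfold Re; simpl; ring.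
  - apply D. intros k. unfold delta. destruct Nat.eq_dec; [subst|]; unfold Im; simpl; ring.
Qed.

(** * Existence of ultrafilters *)

Lemma ultra_exists (T : Type) (F : (T -> Prop) -> Prop) :
  F (fun _ => True) ->
  (forall P Q, F P -> F Q -> F (fun x => P x /\ Q x)) ->
  (forall P Q : T -> Prop, (forall x, P x -> Q x) -> F P -> F Q) ->
  (forall P, F P -> exists x, P x) ->
  exists U, ultra U /\ forall P, F P -> U P.
Proof.
  intros FT FI FS FE.
  assert (PF : filter.ProperFilter F).
  { constructor.
    - intros H. destruct (FE _ H) as [x Hx]. exact Hx.
    - constructor; [exact FT|exact FI|exact FS]. }
  destruct (@filter.ultraFilterLemma T F PF) as [G [GU GF]].
  destruct GU as [GP GM]. destruct GP as [G0 [GT GI GS]].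
  exists G. split; [|exact GF]. split.
  - exact GI.
  - exact GS.
  - intros P. destruct (classic (G P)) as [H|H]; [left; exact H|right].
    apply NNPP. intros HN. apply H.
    (* [K] is the filter generated by [G] and [P]. It is proper because [G] lacks the complement of
       [P], so maximality gives [K = G], and [P] belongs to [K]. *)
    set (K := fun Q : T -> Prop => G (fun x => P x -> Q x)).
    assert (KP : filter.ProperFilter K).
    { constructor.
      - intros E. apply HN. exact E.
      - constructor.
        + refine (GS _ _ _ GT). intros x _ _. exact I.
        + intros A B HA HB. refine (GS _ _ _ (GI _ _ HA HB)).
          intros x [H1 H2] Hx. split; [apply H1, Hx|apply H2, Hx].
        + intros A B AB HA. refine (GS _ _ _ HA). intros x H1 Hx. apply AB, H1, Hx. }
    assert (E : K = G).
    { apply GM; [exact KP|]. intros A HA. refine (GS _ _ _ HA). intros x Hx _. exact Hx. }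
    rewrite <- E. unfold K. refine (GS _ _ _ GT). intros x _ Hx. exact Hx.
  - intros P HP. apply NNPP. intros HN. apply G0. refine (GS _ _ _ HP).
    intros x Hx. apply HN. exists x. exact Hx.
Qed.

(** * Finite linear algebra *)

Lemma csum_ext n f g : (forall k, (k < n)%nat -> f k = g k) -> csum n f = csum n g.
Proof.
  induction n as [|n IH]; intros H; simpl; [reflexivity|].
  rewrite (H n) by lia. rewrite IH; [reflexivity|]. intros; apply H; lia.
Qed.

Lemma csum_plus n f g : csum n (fun k => f k + g k)%C = (csum n f + csum n g)%C.
Proof. induction n; simpl; [ring|rewrite IHn; ring]. Qed.

Lemma csum_scal n c f : csum n (fun k => c * f k)%C = (c * csum n f)%C.
Proof. induction n; simpl; [ring|rewrite IHn; ring]. Qed.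

Lemma csum_zero n f : (forall k, (k < n)%nat -> f k = RtoC 0) -> csum n f = RtoC 0.
Proof.
  induction n as [|n IH]; intros H; simpl; [reflexivity|].
  rewrite (H n) by lia. rewrite IH; [ring|]. intros; apply H; lia.
Qed.

Lemma csum_add n m f : csum (n + m) f = (csum n f + csum m (fun k => f (n + k)%nat))%C.
Proof.
  induction m; [rewrite Nat.add_0_r; simpl; ring|].
  rewrite Nat.add_succ_r. simpl. rewrite IHm. ring.
Qed.

Lemma csum_single n j (f : nat -> C) : (j < n)%nat ->
  csum n (fun k => if Nat.eq_dec k j then f k else RtoC 0) = f j.
Proof.
  intros Hj. induction n; [lia|]. simpl. destruct (Nat.eq_dec n j) as [E|E].
  - subst. rewrite csum_zero; [ring|]. intros k Hk. destruct Nat.eq_dec; [lia|reflexivity].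
  - rewrite IHn by lia. ring.
Qed.

Lemma csum_exchange n m (f : nat -> nat -> C) :
  csum n (fun i => csum m (fun j => f i j)) = csum m (fun j => csum n (fun i => f i j)).
Proof.
  induction n; simpl.
  - symmetry. apply csum_zero. reflexivity.
  - rewrite IHn, <- csum_plus. reflexivity.
Qed.

(** The increasing enumeration of the indices other than [j0]; it deletes the pivot column in the
    elimination below. *)
Definition skip (j0 j : nat) : nat := if lt_dec j j0 then j else S j.

Lemma csum_skip n j0 f : (j0 <= n)%nat ->
  csum (S n) f = (csum n (fun j => f (skip j0 j)) + f j0)%C.
Proof.
  induction n; intros H.
  - replace j0 with 0%nat by lia. reflexivity.
  - destruct (Nat.eq_dec j0 (S n)) as [E|E].
    + subst. simpl csum at 1. f_equal. apply (csum_ext (S n)).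
      intros k Hk. unfold skip. destruct lt_dec; [reflexivity|lia].
    + change (csum (S (S n)) f) with (csum (S n) f + f (S n))%C.
      rewrite IHn by lia. simpl. unfold skip at 3.
      destruct lt_dec; [lia|]. ring.
Qed.

(** Gaussian elimination for [n] equations in [n + 1] unknowns. A nonzero entry of the last row
    serves as pivot for the other rows; if that row vanishes, the last unknown is set to 0. *)
Lemma homogeneous_system n (a : nat -> nat -> C) :
  exists c : nat -> C, (exists j, (j <= n)%nat /\ c j <> RtoC 0) /\
    forall i, (i < n)%nat -> csum (S n) (fun j => a i j * c j)%C = RtoC 0.
Proof.
  revert a. induction n as [|n IH]; intros a.
  - exists (fun _ => RtoC 1). split; [|intros; lia].
    exists 0%nat. split; [lia|]. apply C1_nz.
  - destruct (classic (exists j, (j <= S n)%nat /\ a n j <> RtoC 0)) as [[j0 [Hj0 Hp]]|Hz].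
    + set (p := a n j0) in *.
      destruct (IH (fun i j => a i (skip j0 j) - a i j0 * a n (skip j0 j) / p)%C)
        as [c' [[j [Hj Hc]] Hs]].
      (* [s] is the contribution of the other unknowns to the pivot row, so [- s / p] solves that
         row for the unknown [j0]. *)
      set (s := csum (S n) (fun j => a n (skip j0 j) * c' j)%C).
      set (c := fun j => if lt_dec j j0 then c' j else
        if Nat.eq_dec j j0 then (- s / p)%C else c' (Nat.pred j)).
      assert (Ec : forall j, c (skip j0 j) = c' j).
      { intros k. unfold c, skip. destruct (lt_dec k j0).
        - destruct lt_dec; [reflexivity|lia].
        - destruct lt_dec; [lia|]. destruct Nat.eq_dec; [lia|]. reflexivity. }
      assert (E0 : c j0 = (- s / p)%C).
      { unfold c. destruct lt_dec; [lia|]. destruct Nat.eq_dec; [reflexivity|lia]. }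
      exists c. split.
      * exists (skip j0 j). split; [unfold skip; destruct lt_dec; lia|]. rewrite Ec. exact Hc.
      * intros i Hi. rewrite (csum_skip _ j0) by lia. rewrite E0.
        rewrite (csum_ext _ _ (fun j => a i (skip j0 j) * c' j)%C)
          by (intros; rewrite Ec; reflexivity).
        destruct (Nat.eq_dec i n) as [->|Hin].
        -- fold s. fold p. field. exact Hp.
        -- specialize (Hs i ltac:(lia)).
           rewrite (csum_ext _ _ (fun j => a i (skip j0 j) * c' j +
              (- a i j0 / p) * (a n (skip j0 j) * c' j))%C) in Hs
             by (intros; field; exact Hp).
           rewrite csum_plus, csum_scal in Hs. fold s in Hs.
           rewrite <- Hs. field. exact Hp.
    + destruct (IH a) as [c' [[j [Hj Hc]] Hs]].
      exists (fun j => if Nat.eq_dec j (S n) then RtoC 0 else c' j). split.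
      * exists j. split; [lia|]. destruct Nat.eq_dec; [lia|exact Hc].
      * intros i Hi.
        change (csum (S (S n)) ?f) with (csum (S n) f + f (S n))%C. cbv beta.
        destruct (Nat.eq_dec (S n) (S n)); [|lia].
        rewrite (csum_ext _ _ (fun j => a i j * c' j)%C).
        2:{ intros k Hk. destruct Nat.eq_dec; [lia|reflexivity]. }
        destruct (Nat.eq_dec i n) as [->|Hin].
        -- rewrite csum_zero; [ring|]. intros k Hk.
           destruct (classic (a n k = RtoC 0)) as [E|E]; [rewrite E; ring|].
           exfalso. apply Hz. exists k. split; [lia|exact E].
        -- rewrite Hs by lia. ring.
Qed.

Definition vsum (n : nat) (c : nat -> C) (v : nat -> vec) : vec :=
  fun k => csum n (fun i => c i * v i k)%C.

Lemma vsum_S n c v : vsum (S n) c v = vlin 1 (vsum n c v) (c n) (v n).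
Proof. extensionality k. unfold vsum, vlin; simpl. ring. Qed.

Lemma vsum_0 c v : vsum 0 c v = vzero.
Proof. reflexivity. Qed.

Lemma l2_vsum n c v : (forall i, (i < n)%nat -> l2 (v i)) -> l2 (vsum n c v).
Proof.
  induction n; intros H; [apply l2_zero|]. rewrite vsum_S. apply l2_lin; auto.
Qed.
#[local] Hint Resolve l2_vsum : core.

Lemma ip_vsum_l n c v x : (forall i, (i < n)%nat -> l2 (v i)) -> l2 x ->
  ip (vsum n c v) x = csum n (fun i => c i * ip (v i) x)%C.
Proof.
  intros H Hx. induction n; [apply ip_zero_l|]. rewrite vsum_S.
  rewrite ip_lin_l by auto. rewrite IHn by auto. simpl. ring.
Qed.

Definition orthonormal (e : nat -> vec) : Prop :=
  (forall i, l2 (e i)) /\ forall i j, ip (e i) (e j) = if Nat.eq_dec i j then RtoC 1 else RtoC 0.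

Lemma orthonormal_coef e n c j : orthonormal e -> (j < n)%nat ->
  ip (vsum n c e) (e j) = c j.
Proof.
  intros [Hl Ho] Hj. rewrite ip_vsum_l by auto.
  rewrite <- (csum_single n j c Hj). apply csum_ext. intros k Hk. rewrite Ho.
  destruct Nat.eq_dec; ring.
Qed.

Lemma orthonormal_coef_out e n c j : orthonormal e -> (n <= j)%nat ->
  ip (vsum n c e) (e j) = RtoC 0.
Proof.
  intros [Hl Ho] Hj. rewrite ip_vsum_l by auto. apply csum_zero. intros k Hk. rewrite Ho.
  destruct Nat.eq_dec; [lia|ring].
Qed.

Lemma nsq_vsum e n c : orthonormal e -> nsq (vsum n c e) = rsum n (fun i => Cmod (c i) ^ 2).
Proof.
  intros He. induction n.
  - rewrite vsum_0. simpl. rewrite <- norm2_sq by apply l2_zero. rewrite norm2_zero. ring.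
  - rewrite vsum_S. destruct He as [Hl Ho].
    rewrite nsq_lin by auto. rewrite IHn.
    rewrite (orthonormal_coef_out e n c n) by (auto; split; auto).
    replace (nsq (e n)) with 1.
    2:{ apply RtoC_inj. rewrite <- ip_self, Ho. destruct Nat.eq_dec; [reflexivity|lia]. }
    rewrite Cmod_1. replace (1 * Cconj (c n) * 0)%C with (RtoC 0) by ring. simpl. ring.
Qed.

Lemma orthonormal_delta : orthonormal delta.
Proof.
  split; [apply l2_delta|]. intros i j. rewrite ip_delta. unfold delta.
  destruct (Nat.eq_dec j i), (Nat.eq_dec i j); congruence.
Qed.

(** * Operator norms and singular values *)

(** [real] sends the infinite values of [Lub_Rbar] to 0; a nonempty set with a real upper bound
    excludes them. *)
Lemma real_lub (E : R -> Prop) M : (exists r, E r) -> (forall r, E r -> r <= M) ->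
  (forall r, E r -> r <= real (Lub_Rbar E)) /\
  (forall N, (forall r, E r -> r <= N) -> real (Lub_Rbar E) <= N).
Proof.
  intros [r0 H0] HM. destruct (Lub_Rbar_correct E) as [H1 H2].
  assert (B : Rbar_le (Lub_Rbar E) M) by (apply H2; intros r Hr; apply HM, Hr).
  pose proof (H1 _ H0) as L0.
  destruct (Lub_Rbar E) as [l| |]; simpl in *; try easy.
  split; [exact H1|]. intros N HN. apply (H2 (Finite N)). intros r Hr. apply HN, Hr.
Qed.

Lemma real_glb (E : R -> Prop) M : (exists r, E r) -> (forall r, E r -> M <= r) ->
  (forall r, E r -> real (Glb_Rbar E) <= r) /\
  (forall N, (forall r, E r -> N <= r) -> N <= real (Glb_Rbar E)).
Proof.
  intros [r0 H0] HM. destruct (Glb_Rbar_correct E) as [H1 H2].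
  assert (B : Rbar_le M (Glb_Rbar E)) by (apply H2; intros r Hr; apply HM, Hr).
  pose proof (H1 _ H0) as L0.
  destruct (Glb_Rbar E) as [l| |]; simpl in *; try easy.
  split; [exact H1|]. intros N HN. apply (H2 (Finite N)). intros r Hr. apply HN, Hr.
Qed.

Lemma op_scal A a x : bounded_op A -> l2 x -> A (fun k => a * x k)%C = (fun k => a * A x k)%C.
Proof.
  intros HA Hx. replace (fun k => a * x k)%C with (vlin a x 0 x)
    by (extensionality k'; unfold vlin; ring).
  rewrite op_lin by assumption.
  extensionality k'; unfold vlin; ring.
Qed.

Lemma op_zero A : bounded_op A -> A vzero = vzero.
Proof.
  intros HA. replace vzero with (fun k => 0 * vzero k)%C at 1
    by (extensionality k'; unfold vzero; ring).
  rewrite op_scal by auto.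
  extensionality k'; unfold vzero; ring.
Qed.

Lemma op_vsum A n c v : bounded_op A -> (forall i, (i < n)%nat -> l2 (v i)) ->
  A (vsum n c v) = vsum n c (fun i => A (v i)).
Proof.
  intros HA H. induction n; [apply op_zero, HA|]. rewrite !vsum_S.
  rewrite op_lin by auto. rewrite IHn by auto. reflexivity.
Qed.

Lemma opnorm_le A c : (forall x, l2 x -> norm2 x <= 1 -> norm2 (A x) <= c) -> opnorm A <= c.
Proof.
  intros H. apply (real_lub _ c).
  - exists (norm2 (A vzero)), vzero. split; [apply l2_zero|]. rewrite norm2_zero.
    split; [lra|reflexivity].
  - intros r [x [Hx [H1 ->]]]. auto.
  - intros r [x [Hx [H1 ->]]]. auto.
Qed.

Lemma opnorm_unit A x : bounded_op A -> l2 x -> norm2 x <= 1 -> norm2 (A x) <= opnorm A.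
Proof.
  intros [_ [_ [c Hc]]] Hx H1. apply (real_lub _ (Rabs c)).
  - exists (norm2 (A x)), x. auto.
  - intros r [y [Hy [H2 ->]]]. eapply Rle_trans; [apply Hc, Hy|].
    pose proof (Rle_abs c). pose proof (norm2_nonneg y). pose proof (Rabs_pos c). nra.
  - exists x. auto.
Qed.

Lemma opnorm_nonneg A : bounded_op A -> 0 <= opnorm A.
Proof.
  intros HA. pose proof (opnorm_unit A vzero HA l2_zero).
  rewrite norm2_zero in H. rewrite op_zero, norm2_zero in H by assumption. lra.
Qed.

Lemma opnorm_bound A x : bounded_op A -> l2 x -> norm2 (A x) <= opnorm A * norm2 x.
Proof.
  intros HA Hx. pose proof (norm2_nonneg x) as P.
  destruct (Req_dec (norm2 x) 0) as [E|E].
  - rewrite (norm2_eq0 x Hx E), op_zero, norm2_zero by assumption. lra.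
  - set (y := fun k => (RtoC (/ norm2 x) * x k)%C).
    assert (Hi : Cmod (RtoC (/ norm2 x)) = / norm2 x).
    { rewrite Cmod_R. apply Rabs_pos_eq. left. apply Rinv_pos. lra. }
    assert (B : norm2 (A y) <= opnorm A).
    { apply opnorm_unit; [assumption|apply l2_scal, Hx|]. unfold y. rewrite norm2_scal, Hi.
      right. field. exact E. }
    unfold y in B. rewrite op_scal, norm2_scal, Hi in B by assumption.
    apply Rmult_le_compat_r with (r := norm2 x) in B; [|assumption].
    replace (/ norm2 x * norm2 (A x) * norm2 x) with (norm2 (A x)) in B by (field; exact E). lra.
Qed.

Lemma bounded_lin_op a A b B : bounded_op A -> bounded_op B ->
  bounded_op (fun x => vlin a (A x) b (B x)).
Proof.
  intros HA HB. split; [|split].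
  - intros x y c d Hx Hy. change (fun k => (c * x k + d * y k)%C) with (vlin c x d y).
    rewrite !op_lin by assumption.
    extensionality k; unfold vlin; ring.
  - intros x Hx. apply l2_lin; apply op_l2; assumption.
  - exists (Cmod a * opnorm A + Cmod b * opnorm B). intros x Hx.
    eapply Rle_trans; [apply norm2_lin; apply op_l2; assumption|].
    pose proof (opnorm_bound A x HA Hx); pose proof (opnorm_bound B x HB Hx).
    pose proof (Cmod_ge_0 a); pose proof (Cmod_ge_0 b). nra.
Qed.

Lemma opsub_lin A B : opsub A B = fun x => vlin 1 (A x) (-1) (B x).
Proof.
  extensionality x; extensionality k.
  unfold opsub, vlin. ring.
Qed.

Lemma opadd_lin A B : opadd A B = fun x => vlin 1 (A x) 1 (B x).
Proof.
  extensionality x; extensionality k.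
  unfold opadd, vlin. ring.
Qed.

Lemma opscale_lin c A : opscale c A = fun x => vlin c (A x) 0 (A x).
Proof.
  extensionality x; extensionality k.
  unfold opscale, vlin. ring.
Qed.

Lemma bounded_opsub A B : bounded_op A -> bounded_op B -> bounded_op (opsub A B).
Proof. rewrite opsub_lin. apply bounded_lin_op. Qed.

Lemma bounded_opadd A B : bounded_op A -> bounded_op B -> bounded_op (opadd A B).
Proof. rewrite opadd_lin. apply bounded_lin_op. Qed.

Lemma bounded_opscale c A : bounded_op A -> bounded_op (opscale c A).
Proof. intros H. rewrite opscale_lin. apply bounded_lin_op; assumption. Qed.
#[local] Hint Resolve bounded_opsub bounded_opadd bounded_opscale : core.

Lemma bounded_zero : bounded_op (fun _ => vzero).
Proof.
  split; [|split].
  - intros. extensionality k'. unfold vzero. ring.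
  - intros. apply l2_zero.
  - exists 0. intros. rewrite norm2_zero. lra.
Qed.

Lemma rank_zero n : rank_le (fun _ => vzero) n.
Proof.
  exists (fun _ => vzero). split; [intros; apply l2_zero|].
  intros x _. exists (fun _ => RtoC 0). extensionality k.
  rewrite csum_zero; [reflexivity|]. intros; ring.
Qed.

(** The zero operator is an admissible [F] for every [n] and norms are nonnegative, so the infimum
    behind [mu] is a real number and not a default value. *)
Lemma mu_glb n A : bounded_op A ->
  (forall F, bounded_op F -> rank_le F n -> mu n A <= opnorm (opsub A F)) /\
  (forall c, (forall F, bounded_op F -> rank_le F n -> c <= opnorm (opsub A F)) -> c <= mu n A).
Proof.
  intros HA.
  destruct (real_glb (fun r => exists F, bounded_op F /\ rank_le F n /\ r = opnorm (opsub A F)) 0)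
    as [H1 H2].
  - eexists. exists (fun _ => vzero). split; [apply bounded_zero|split; [apply rank_zero|reflexivity]].
  - intros r [F [HF [_ ->]]]. apply opnorm_nonneg, bounded_opsub; assumption.
  - split.
    + intros F HF HR. apply H1. exists F. auto.
    + intros c Hc. apply H2. intros r [F [HF [HR ->]]]. auto.
Qed.

Lemma mu_nonneg n A : bounded_op A -> 0 <= mu n A.
Proof.
  intros HA. apply (mu_glb n A HA). intros. apply opnorm_nonneg, bounded_opsub; assumption.
Qed.

Lemma mu_approx n A eps : bounded_op A -> 0 < eps ->
  exists F, bounded_op F /\ rank_le F n /\ opnorm (opsub A F) < mu n A + eps.
Proof.
  intros HA He. apply NNPP. intros H.
  assert (mu n A + eps <= mu n A); [|lra].
  apply (mu_glb n A HA). intros F HF HR. apply Rnot_lt_le. intros Hl. apply H. eauto.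
Qed.

Lemma rank_add F F' n m : rank_le F n -> rank_le F' m -> rank_le (opadd F F') (n + m).
Proof.
  intros [v [Hv H]] [v' [Hv' H']].
  exists (fun i => if lt_dec i n then v i else v' (i - n)%nat). split.
  - intros i Hi. destruct lt_dec; [auto|]. apply Hv'. lia.
  - intros x Hx. destruct (H x Hx) as [c Hc], (H' x Hx) as [c' Hc'].
    exists (fun i => if lt_dec i n then c i else c' (i - n)%nat).
    extensionality k. unfold opadd. rewrite Hc, Hc', csum_add.
    f_equal; apply csum_ext; intros i Hi.
    + destruct lt_dec; [reflexivity|lia].
    + destruct lt_dec; [lia|]. replace (n + i - n)%nat with i by lia. reflexivity.
Qed.

Lemma rank_mono F n m : (n <= m)%nat -> rank_le F n -> rank_le F m.
Proof.
  intros Hnm H. replace m with (n + (m - n))%nat by lia.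
  replace F with (opadd F (fun _ => vzero)); [apply rank_add; [exact H|apply rank_zero]|].
  extensionality x; extensionality k.
  unfold opadd, vzero. ring.
Qed.

Lemma mu_decr A n m : bounded_op A -> (n <= m)%nat -> mu m A <= mu n A.
Proof.
  intros HA H. apply (mu_glb n A HA). intros F HF HR. apply (mu_glb m A HA); [assumption|].
  eapply rank_mono; eassumption.
Qed.

(** Ky Fan's inequality: near-optimal approximants add, and so do their ranks. *)
Lemma mu_opadd n m A B : bounded_op A -> bounded_op B ->
  mu (n + m) (opadd A B) <= mu n A + mu m B.
Proof.
  intros HA HB. apply le_epsilon. intros eps He.
  destruct (mu_approx n A (eps / 2) HA ltac:(lra)) as [F [HF [RF NF]]].
  destruct (mu_approx m B (eps / 2) HB ltac:(lra)) as [F' [HF' [RF' NF']]].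
  apply Rle_trans with (opnorm (opsub (opadd A B) (opadd F F'))).
  - apply mu_glb; auto using rank_add.
  - apply Rle_trans with (opnorm (opsub A F) + opnorm (opsub B F')); [|lra].
    apply opnorm_le. intros x Hx H1.
    replace (opsub (opadd A B) (opadd F F') x) with (vlin 1 (opsub A F x) 1 (opsub B F' x)).
    2:{ extensionality k. unfold opsub, opadd, vlin. ring. }
    assert (B1 : bounded_op (opsub A F)) by auto.
    assert (B2 : bounded_op (opsub B F')) by auto.
    eapply Rle_trans; [apply norm2_lin; apply op_l2; assumption|]. rewrite Cmod_1.
    pose proof (opnorm_unit _ x B1 Hx H1); pose proof (opnorm_unit _ x B2 Hx H1). lra.
Qed.

(* A rank [n] operator [F] kills a nonzero vector of the span, on which [A - F] acts as [A]. *)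
Lemma mu_ge_of_span n A v c : bounded_op A -> (forall i, (i <= n)%nat -> l2 (v i)) ->
  (forall a, (exists j, (j <= n)%nat /\ a j <> RtoC 0) ->
     0 < norm2 (vsum (S n) a v) /\ c * norm2 (vsum (S n) a v) <= norm2 (A (vsum (S n) a v))) ->
  c <= mu n A.
Proof.
  intros HA Hv H. apply (mu_glb n A HA). intros F HF [w [Hw HR]].
  destruct (choice (fun j (b : nat -> C) => (j <= n)%nat -> F (v j) = vsum n b w)) as [b Hb].
  { intros j. destruct (le_dec j n) as [Hj|Hj].
    - destruct (HR (v j) (Hv j Hj)) as [b Hb]. exists b. intros _. exact Hb.
    - exists (fun _ => RtoC 0). intros; lia. }
  destruct (homogeneous_system n (fun i j => b j i)) as [a [Hnz Ha]].
  destruct (H a Hnz) as [P Q]. set (x := vsum (S n) a v) in *.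
  assert (Hvl : forall i, (i < S n)%nat -> l2 (v i)) by (intros; apply Hv; lia).
  assert (Hx : l2 x) by (apply l2_vsum, Hvl).
  assert (Fx : F x = vzero).
  { unfold x. rewrite op_vsum by assumption. extensionality k.
    unfold vsum. rewrite (csum_ext _ _ (fun j => csum n (fun i => w i k * (b j i * a j))%C)).
    2:{ intros j Hj. rewrite Hb by lia. unfold vsum. rewrite <- csum_scal.
        apply csum_ext. intros. ring. }
    rewrite csum_exchange. apply csum_zero. intros i Hi.
    rewrite csum_scal, Ha by assumption. ring. }
  assert (Hs : bounded_op (opsub A F)) by auto.
  pose proof (opnorm_bound _ x Hs Hx) as B.
  replace (opsub A F x) with (A x) in B.
  2:{ unfold opsub. rewrite Fx. extensionality k'. unfold vzero. ring. }
  apply Rmult_le_reg_r with (norm2 x); lra.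
Qed.

Lemma rsum_pos_of_nz n a : (exists j, (j <= n)%nat /\ a j <> RtoC 0) ->
  0 < rsum (S n) (fun i => Cmod (a i) ^ 2).
Proof.
  intros [j [Hj Ha]]. apply Cmod_gt_0 in Ha.
  apply Rlt_le_trans with (rsum (S j) (fun i => Cmod (a i) ^ 2)); [|apply rsum_mono; auto; lia].
  simpl. pose proof (rsum_nonneg j (fun i => Cmod (a i) ^ 2) (fun k _ => Csq_nonneg _)) as P.
  simpl in P. nra.
Qed.

(** On the span of the first [n + 1] eigenvectors [A] stretches every vector by at least [lam n]. *)
Lemma mu_ge_eigen n A e (lam : nat -> R) : bounded_op A -> orthonormal e ->
  (forall i, (i <= n)%nat -> A (e i) = (fun k => RtoC (lam i) * e i k)%C) ->
  0 <= lam n -> (forall i, (i <= n)%nat -> lam n <= lam i) -> lam n <= mu n A.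
Proof.
  intros HA He HE H0 Hd. assert (Hl : forall i, l2 (e i)) by apply He.
  apply mu_ge_of_span with e; [assumption|auto|]. intros a Hnz.
  assert (L : forall b, l2 (vsum (S n) b e)) by (intros; apply l2_vsum; auto).
  assert (EA : A (vsum (S n) a e) = vsum (S n) (fun i => a i * RtoC (lam i))%C e).
  { rewrite op_vsum by auto. extensionality k.
    apply csum_ext. intros i Hi. rewrite HE by lia. ring. }
  pose proof (rsum_pos_of_nz n a Hnz) as P.
  split.
  - pose proof (norm2_nonneg (vsum (S n) a e)).
    pose proof (norm2_sq _ (L a)) as Q. rewrite nsq_vsum in Q by assumption. nra.
  - apply sq_le_sq; [apply norm2_nonneg|]. rewrite EA, Rpow_mult_distr, !norm2_sq by auto.
    rewrite !nsq_vsum by assumption. rewrite <- rsum_scal. apply rsum_le. intros i Hi.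
    rewrite Cmod_mult, Cmod_R, Rpow_mult_distr, pow2_abs.
    assert (lam n ^ 2 <= lam i ^ 2) by (apply pow_incr; split; [assumption|apply Hd; lia]).
    pose proof (Csq_nonneg (a i)). nra.
Qed.

Lemma norm2_diag_le y M x : 0 <= M -> (forall k, Rabs (y k) <= M) -> l2 x ->
  l2 (diag y x) /\ norm2 (diag y x) <= M * norm2 x.
Proof.
  intros HM H Hx.
  assert (B : forall n, rsum n (fun k => Cmod (diag y x k) ^ 2) <= M ^ 2 * nsq x).
  { intros n. eapply Rle_trans.
    - apply rsum_le with (g := fun k => M ^ 2 * Cmod (x k) ^ 2). intros k _. unfold diag.
      rewrite Cmod_mult, Rpow_mult_distr. apply Rmult_le_compat_r; [auto|].
      rewrite Cmod_R. apply pow_incr. split; [apply Rabs_pos|auto].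
    - rewrite rsum_scal. apply Rmult_le_compat_l; [apply pow2_ge_0|apply l2_partial, Hx]. }
  destruct (l2_bound _ _ B) as [L N]. split; [exact L|].
  apply sq_le_sq; [pose proof (norm2_nonneg x); nra|].
  rewrite Rpow_mult_distr, !norm2_sq by assumption. exact N.
Qed.

Lemma bounded_diag y M : (forall k, Rabs (y k) <= M) -> bounded_op (diag y).
Proof.
  intros H. assert (HM : 0 <= M) by (pose proof (H 0%nat); pose proof (Rabs_pos (y 0%nat)); lra).
  split; [|split].
  - intros. extensionality k. unfold diag. ring.
  - intros x Hx. apply (norm2_diag_le y M); assumption.
  - exists M. intros x Hx. apply (norm2_diag_le y M); assumption.
Qed.

(** Keeping the first [n] entries gives an approximant of rank [n]. [M] makes both operators
    bounded, and [m] measures what is left. *)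
Lemma mu_diag_le n y M : (forall k, Rabs (y k) <= M) ->
  forall m, (forall k, (n <= k)%nat -> Rabs (y k) <= m) -> mu n (diag y) <= m.
Proof.
  intros H m Hm.
  set (z := fun k => if lt_dec k n then y k else 0).
  assert (Hz : forall k, Rabs (z k) <= M).
  { intros k. unfold z. destruct lt_dec; [auto|]. rewrite Rabs_R0.
    pose proof (H 0%nat); pose proof (Rabs_pos (y 0%nat)); lra. }
  assert (m0 : 0 <= m) by (pose proof (Hm n (le_n _)); pose proof (Rabs_pos (y n)); lra).
  pose proof (bounded_diag _ _ H) as BA. pose proof (bounded_diag _ _ Hz) as BF.
  apply Rle_trans with (opnorm (opsub (diag y) (diag z))).
  - apply (mu_glb n _ BA); [assumption|]. exists delta. split; [intros; apply l2_delta|].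
    intros x Hx. exists (fun i => RtoC (y i) * x i)%C. extensionality k.
    unfold diag, z, delta. destruct (lt_dec k n) as [Hk|Hk].
    + rewrite <- (csum_single n k (fun i => RtoC (y i) * x i)%C Hk). apply csum_ext.
      intros i Hi. destruct (Nat.eq_dec i k), (Nat.eq_dec k i); try congruence; ring.
    + rewrite csum_zero; [ring|]. intros i Hi. destruct Nat.eq_dec; [lia|ring].
  - apply opnorm_le. intros x Hx H1.
    replace (opsub (diag y) (diag z) x) with (diag (fun k => y k - z k) x).
    2:{ extensionality k. unfold opsub, diag. rewrite RtoC_minus. ring. }
    apply Rle_trans with (m * norm2 x); [|pose proof (norm2_nonneg x); nra].
    apply norm2_diag_le; try assumption. intros k. unfold z. destruct lt_dec.
    + rewrite Rminus_diag, Rabs_R0. exact m0.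
    + rewrite Rminus_0_r. apply Hm. lia.
Qed.

Lemma diag_delta y i : diag y (delta i) = (fun k => RtoC (y i) * delta i k)%C.
Proof.
  extensionality k. unfold diag, delta.
  destruct Nat.eq_dec; [subst; reflexivity|ring].
Qed.

Lemma mu_diag y n : (forall k, 0 <= y k) -> (forall k, y (S k) <= y k) -> mu n (diag y) = y n.
Proof.
  intros H0 Hd.
  pose proof (decr_le y Hd) as D.
  assert (HB : forall k, Rabs (y k) <= y 0%nat).
  { intros k. rewrite Rabs_pos_eq by auto. apply D. lia. }
  apply Rle_antisym.
  - apply mu_diag_le with (y 0%nat); [assumption|]. intros k Hk.
    rewrite Rabs_pos_eq by auto. apply D, Hk.
  - apply mu_ge_eigen with delta; auto using orthonormal_delta, diag_delta.
    eapply bounded_diag; eassumption.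
Qed.

(** * Compact positive operators *)

Definition trunc (N : nat) (x : vec) : vec := fun k => if lt_dec k N then x k else RtoC 0.
Definition tail (N : nat) (x : vec) : vec := fun k => if lt_dec k N then RtoC 0 else x k.

Lemma trunc_tail N x : x = vlin 1 (trunc N x) 1 (tail N x).
Proof.
  extensionality k. unfold vlin, trunc, tail. destruct lt_dec; ring.
Qed.

Lemma trunc_vsum N x : trunc N x = vsum N x delta.
Proof.
  extensionality k. unfold trunc, vsum, delta.
  destruct (lt_dec k N) as [H|H].
  - rewrite <- (csum_single N k x H). apply csum_ext. intros i Hi.
    destruct (Nat.eq_dec i k), (Nat.eq_dec k i); try congruence; ring.
  - rewrite csum_zero; [reflexivity|]. intros i Hi. destruct Nat.eq_dec; [lia|ring].
Qed.

Lemma l2_dominated x y : l2 y -> (forall k, Cmod (x k) <= Cmod (y k)) -> l2 x /\ norm2 x <= norm2 y.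
Proof.
  intros Hy H.
  assert (B : forall n, rsum n (fun k => Cmod (x k) ^ 2) <= nsq y).
  { intros n. eapply Rle_trans; [|apply (l2_partial y n Hy)]. apply rsum_le. intros k _.
    apply pow_incr. split; [apply Cmod_ge_0|apply H]. }
  destruct (l2_bound _ _ B) as [L N]. split; [exact L|].
  apply sq_le_sq; [apply norm2_nonneg|]. rewrite !norm2_sq by assumption. exact N.
Qed.

Lemma tail_dominated N x k : Cmod (tail N x k) <= Cmod (x k).
Proof. unfold tail. destruct lt_dec; [rewrite Cmod_0; apply Cmod_ge_0|lra]. Qed.

Lemma l2_tail N x : l2 x -> l2 (tail N x).
Proof. intros Hx. apply (l2_dominated _ x Hx), tail_dominated. Qed.

Lemma norm2_tail N x : l2 x -> norm2 (tail N x) <= norm2 x.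
Proof. intros Hx. apply (l2_dominated _ x Hx), tail_dominated. Qed.

Lemma l2_trunc N x : l2 (trunc N x).
Proof. rewrite trunc_vsum. apply l2_vsum. intros; apply l2_delta. Qed.
#[local] Hint Resolve l2_tail l2_trunc : core.

Lemma norm2_trunc N x : l2 x -> norm2 (trunc N x) <= norm2 x.
Proof.
  intros Hx. apply (l2_dominated _ x Hx). intros k. unfold trunc.
  destruct lt_dec; [lra|rewrite Cmod_0; apply Cmod_ge_0].
Qed.

Lemma tail_lin N a x b y : tail N (vlin a x b y) = vlin a (tail N x) b (tail N y).
Proof.
  extensionality k. unfold vlin, tail. destruct lt_dec; ring.
Qed.

Lemma ip_tail N x y : ip x (tail N y) = ip (tail N x) y.
Proof.
  unfold ip, innerRe, innerIm. f_equal; apply Series_ext; intros k; unfold tail;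
  destruct lt_dec; unfold Re, Im; simpl; ring.
Qed.

Lemma tail_small x eps : l2 x -> 0 < eps ->
  exists N, forall n, (N <= n)%nat -> norm2 (tail n x) <= eps.
Proof.
  intros Hx He. pose proof (Series_correct _ Hx) as H. fold (nsq x) in H.
  change (is_lim_seq (sum_n (fun n => Cmod (x n) ^ 2)) (nsq x)) in H.
  apply is_lim_seq_spec in H.
  destruct (H (mkposreal (eps ^ 2) ltac:(nra))) as [N HN]. simpl in HN.
  exists (S N). intros n Hn. destruct n as [|n]; [lia|].
  specialize (HN n ltac:(lia)). rewrite sum_n_rsum in HN.
  apply sq_le_sq; [lra|]. rewrite norm2_sq by auto.
  apply Rabs_lt_between in HN.
  apply (l2_bound (tail (S n) x)). intros m.
  destruct (le_dec m (S n)) as [Hm|Hm].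
  - rewrite (rsum_ext _ _ (fun _ => 0)); [rewrite rsum_const; nra|].
    intros k Hk. unfold tail. destruct lt_dec; [rewrite Cmod_0; ring|lia].
  - pose proof (l2_partial x m Hx) as P.
    replace m with (S n + (m - S n))%nat in P |- * by lia. rewrite rsum_add in P |- *.
    rewrite (rsum_ext (S n) (fun k => Cmod (tail (S n) x k) ^ 2) (fun _ => 0)).
    2:{ intros k Hk. unfold tail. destruct lt_dec; [rewrite Cmod_0; ring|lia]. }
    rewrite rsum_const.
    rewrite (rsum_ext (m - S n) _ (fun k => Cmod (x (S n + k)%nat) ^ 2)).
    2:{ intros k Hk. unfold tail. destruct lt_dec; [lia|reflexivity]. }
    simpl in *. lra.
Qed.

(** * Tightness as a form of compactness *)

(** A rank one operator; it is the orthogonal projection onto the line of [x] when [nsq x = 1]. *)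
Definition proj (x : vec) : op := fun y k => (ip y x * x k)%C.

Lemma bounded_proj x : l2 x -> bounded_op (proj x).
Proof.
  intros Hx. split; [|split].
  - intros y z a b Hy Hz. extensionality k. unfold proj.
    change (fun k => (a * y k + b * z k)%C) with (vlin a y b z).
    rewrite ip_lin_l by assumption. ring.
  - intros y Hy. apply l2_scal, Hx.
  - exists (norm2 x * norm2 x). intros y Hy. unfold proj. rewrite norm2_scal.
    pose proof (cauchy_schwarz y x Hy Hx). pose proof (norm2_nonneg x). nra.
Qed.

Lemma bounded_comp A B : bounded_op A -> bounded_op B -> bounded_op (fun x => A (B x)).
Proof.
  intros HA HB. split; [|split]; auto.
  - intros x y a b Hx Hy. change (A (B (vlin a x b y)) = vlin a (A (B x)) b (A (B y))).
    rewrite !op_lin by auto. reflexivity.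
  - exists (opnorm A * opnorm B). intros x Hx.
    pose proof (opnorm_bound A (B x) HA ltac:(auto)). pose proof (opnorm_bound B x HB Hx).
    pose proof (opnorm_nonneg A HA). nra.
Qed.

Lemma norm2_tail_mono N n x : (N <= n)%nat -> l2 x -> norm2 (tail n x) <= norm2 (tail N x).
Proof.
  intros Hn Hx. apply (l2_dominated _ (tail N x)); [auto|]. intros k. unfold tail.
  destruct (lt_dec k n), (lt_dec k N); try lia; try rewrite Cmod_0; try apply Cmod_ge_0; lra.
Qed.

(** For bounded [A] this says that the image of the unit ball is relatively compact in [l2]. Uniform
    tails are what lets the quadratic form pass to coordinatewise limits. *)
Definition tight (A : op) : Prop := forall eps, 0 < eps ->
  exists N, forall x, l2 x -> norm2 (tail N (A x)) <= eps * norm2 x.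

Lemma tight_lin a A b B : bounded_op A -> bounded_op B -> tight A -> tight B ->
  tight (fun x => vlin a (A x) b (B x)).
Proof.
  intros HA HB TA TB eps He. pose proof (Cmod_ge_0 a); pose proof (Cmod_ge_0 b).
  set (d := eps / (Cmod a + Cmod b + 1)).
  assert (Hd : 0 < d) by (apply Rdiv_lt_0_compat; lra).
  assert (Ed : d * (Cmod a + Cmod b + 1) = eps) by (unfold d; field; lra).
  destruct (TA d Hd) as [N HN], (TB d Hd) as [M HM].
  exists (Nat.max N M). intros x Hx. rewrite tail_lin.
  eapply Rle_trans; [apply norm2_lin; auto|].
  pose proof (norm2_tail_mono N (Nat.max N M) (A x) ltac:(lia) ltac:(auto)).
  pose proof (norm2_tail_mono M (Nat.max N M) (B x) ltac:(lia) ltac:(auto)).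
  specialize (HN x Hx). specialize (HM x Hx). pose proof (norm2_nonneg x).
  apply Rle_trans with (Cmod a * (d * norm2 x) + Cmod b * (d * norm2 x)).
  - apply Rplus_le_compat; apply Rmult_le_compat_l; lra.
  - rewrite <- Ed. nra.
Qed.

Lemma tight_proj F u : bounded_op F -> l2 u -> tight (fun x => proj u (F x)).
Proof.
  intros HF Hu eps He. pose proof (opnorm_nonneg F HF); pose proof (norm2_nonneg u).
  set (K := opnorm F * norm2 u + 1). assert (1 <= K) by (unfold K; nra).
  destruct (tail_small u (eps / K) Hu) as [N HN]; [apply Rdiv_lt_0_compat; lra|].
  exists N. intros x Hx. specialize (HN N (le_n _)).
  replace (tail N (proj u (F x))) with (fun k => ip (F x) u * tail N u k)%C.
  2:{ extensionality k. unfold tail, proj. destruct lt_dec; ring. }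
  rewrite norm2_scal. pose proof (norm2_nonneg x); pose proof (norm2_nonneg (tail N u)).
  assert (Cmod (ip (F x) u) <= K * norm2 x).
  { eapply Rle_trans; [apply cauchy_schwarz; auto|].
    pose proof (opnorm_bound F x HF Hx). unfold K. nra. }
  replace (eps * norm2 x) with (K * norm2 x * (eps / K)) by (field; lra).
  apply Rmult_le_compat; auto using Cmod_ge_0.
Qed.

(* Induction on the rank: the range of [F] is projected off its last spanning vector.  If that
   vector is zero then [/ nsq (v n)] is a junk value, but it multiplies a zero vector. *)
Lemma tight_finite_rank F n : bounded_op F -> rank_le F n -> tight F.
Proof.
  revert F. induction n as [|n IH]; intros F HF [v [Hv HR]].
  { intros eps He. exists 0%nat. intros x Hx. destruct (HR x Hx) as [c Hc]. rewrite Hc.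
    change (norm2 (tail 0 vzero) <= eps * norm2 x).
    pose proof (norm2_tail 0 vzero l2_zero) as P. rewrite norm2_zero in P.
    pose proof (norm2_nonneg x). nra. }
  set (u := v n). assert (Hu : l2 u) by (apply Hv; lia).
  set (s := RtoC (/ nsq u)).
  assert (Es : forall k, (s * ip u u * u k = u k)%C).
  { intros k. unfold s. rewrite ip_self. destruct (Req_dec (nsq u) 0) as [E|E].
    - rewrite (nsq_zero u Hu E). unfold vzero. ring.
    - rewrite <- RtoC_mult, Rinv_l by exact E. ring. }
  pose proof (bounded_comp _ _ (bounded_proj u Hu) HF) as HPF.
  set (F' := fun x => vlin 1 (F x) (- s) (proj u (F x))).
  assert (HF' : bounded_op F') by (apply (bounded_lin_op 1 F (- s)%C); assumption).
  replace F with (fun x => vlin 1 (F' x) s (proj u (F x))).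
  2:{ extensionality x. extensionality k. unfold F', vlin. ring. }
  apply tight_lin; [exact HF'|exact HPF| |apply tight_proj; assumption].
  apply IH; [exact HF'|].
  exists (fun i => vlin 1 (v i) (- s * ip (v i) u) u). split; [intros; apply l2_lin; auto|].
  intros x Hx. destruct (HR x Hx) as [c Hc]. change (F x = vsum (S n) c v) in Hc. exists c.
  extensionality k. unfold F', vlin, proj.
  assert (Ei : ip (F x) u = csum (S n) (fun i => c i * ip (v i) u)%C)
    by (rewrite Hc; apply ip_vsum_l; auto).
  rewrite Ei, Hc. unfold vsum. simpl. fold u.
  rewrite (csum_ext n (fun i => c i * (1 * v i k + - s * ip (v i) u * u k))%C
    (fun i => c i * v i k + (- s * u k) * (c i * ip (v i) u))%C) by (intros; ring).
  rewrite csum_plus, csum_scal.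
  replace (c n * u k)%C with (c n * (s * ip u u * u k))%C by (rewrite Es; reflexivity). ring.
Qed.

(** Compactness is given as [mu n A -> 0], that is, as norm approximation by finite rank operators,
    and tightness survives norm limits. *)
Lemma tight_compact A : compact_op A -> tight A.
Proof.
  intros [HA HL] eps He. apply is_lim_seq_spec in HL.
  destruct (HL (mkposreal (eps / 4) ltac:(lra))) as [n Hn]. specialize (Hn n (le_n _)). simpl in Hn.
  apply Rabs_lt_between in Hn.
  destruct (mu_approx n A (eps / 4) HA ltac:(lra)) as [F [HF [RF NF]]].
  destruct (tight_finite_rank F n HF RF (eps / 2) ltac:(lra)) as [N HN].
  exists N. intros x Hx. specialize (HN x Hx).
  pose proof (bounded_opsub _ _ HA HF) as HS.
  replace (A x) with (vlin 1 (opsub A F x) 1 (F x)).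
  2:{ extensionality k. unfold vlin, opsub. ring. }
  rewrite tail_lin.
  eapply Rle_trans; [apply norm2_lin; apply l2_tail, op_l2; assumption|]. rewrite Cmod_1.
  pose proof (norm2_tail N _ (op_l2 _ x HS Hx)).
  pose proof (opnorm_bound _ x HS Hx). pose proof (norm2_nonneg x). nra.
Qed.

(** Cauchy-Schwarz for the form at [x] and [A x] reads [|A x|^4 <= <A x, x> <A (A x), A x>], and
    both factors on the right are controlled by [m]. *)
Lemma positive_norm_bound A m : positive_op A -> 0 <= m ->
  (forall y, l2 y -> innerRe (A y) y <= m * nsq y) ->
  forall x, l2 x -> norm2 (A x) <= m * norm2 x.
Proof.
  intros HP Hm H x Hx. pose proof HP as [HA _].
  pose proof (op_l2 A x HA Hx) as HAx.
  pose proof (form_cauchy_schwarz A x (A x) HP Hx HAx) as CS.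
  rewrite ip_self, Cmod_R, pow2_abs in CS.
  pose proof (H x Hx); pose proof (H _ HAx).
  pose proof (nsq_nonneg x Hx); pose proof (nsq_nonneg _ HAx).
  pose proof (proj2 (proj2 HP x Hx)); pose proof (proj2 (proj2 HP _ HAx)).
  pose proof (norm2_nonneg x).
  apply sq_le_sq; [nra|]. rewrite Rpow_mult_distr, !norm2_sq by assumption.
  assert (nsq (A x) ^ 2 <= (m * nsq x) * (m * nsq (A x))).
  { eapply Rle_trans; [exact CS|]. apply Rmult_le_compat; assumption. }
  apply Rnot_lt_le. intros Hl.
  assert (0 <= m ^ 2 * nsq x) by (apply Rmult_le_pos; [apply pow2_ge_0|assumption]).
  assert (0 < (nsq (A x) - m ^ 2 * nsq x) * nsq (A x)) by (apply Rmult_lt_0_compat; lra).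
  nra.
Qed.

(** * Weak limits and the top eigenvector *)

(** A non-principal ultrafilter; limits along it replace the choice of convergent subsequences. *)
Lemma ultra_nat : exists U, ultra U /\ forall N, U (fun n => (N <= n)%nat).
Proof.
  destruct (ultra_exists nat (fun P => exists N, forall n, (N <= n)%nat -> P n)) as [U [HU HF]].
  - exists 0%nat. auto.
  - intros P Q [N HN] [M HM]. exists (Nat.max N M). intros n Hn. split; [apply HN|apply HM]; lia.
  - intros P Q H [N HN]. exists N. auto.
  - intros P [N HN]. exists N. auto.
  - exists U. split; [exact HU|]. intros N. apply HF. exists N. auto.
Qed.

(** Weak compactness of the ball by coordinatewise limits: every partial sum of [|y_k|^2] is a limit
    of partial sums that are at most [K^2]. *)
Lemma weak_limit U (x : nat -> vec) K : ultra U -> (forall n, l2 (x n)) ->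
  (forall n, norm2 (x n) <= K) ->
  exists y, l2 y /\ norm2 y <= K /\
    forall k, is_ulim U (fun n => Re (x n k)) (Re (y k)) /\
              is_ulim U (fun n => Im (x n k)) (Im (y k)).
Proof.
  intros HU Hx HK.
  assert (UT : forall P : nat -> Prop, (forall n, P n) -> U P).
  { intros P HP. destruct (ultra_em HU P) as [H|H]; [exact H|].
    destruct (ultra_ex HU _ H) as [n Hn]. contradiction (Hn (HP n)). }
  assert (K0 : 0 <= K) by (pose proof (norm2_nonneg (x 0%nat)); specialize (HK 0%nat); lra).
  assert (SB : forall n m, rsum m (fun k => Cmod (x n k) ^ 2) <= K ^ 2).
  { intros n m. eapply Rle_trans; [apply l2_partial, Hx|]. rewrite <- norm2_sq by apply Hx.
    apply pow_incr. split; [apply norm2_nonneg|apply HK]. }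
  assert (B : forall n k, Cmod (x n k) <= K).
  { intros n k. apply sq_le_sq; [exact K0|]. eapply Rle_trans; [|apply (SB n (S k))].
    pose proof (rsum_nonneg k (fun k => Cmod (x n k) ^ 2) (fun j _ => Csq_nonneg _)).
    change (Cmod (x n k) ^ 2 <= rsum k (fun k => Cmod (x n k) ^ 2) + Cmod (x n k) ^ 2). lra. }
  destruct (choice (fun k l => is_ulim U (fun n => Re (x n k)) l)) as [yr Hr].
  { intros k. apply (ultra_limit U _ K HU). apply UT. intros n.
    eapply Rle_trans; [apply re_le_Cmod|apply B]. }
  destruct (choice (fun k l => is_ulim U (fun n => Im (x n k)) l)) as [yi Hi].
  { intros k. apply (ultra_limit U _ K HU). apply UT. intros n.
    eapply Rle_trans; [apply im_le_Cmod|apply B]. }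
  set (y := fun k => (yr k, yi k) : C).
  assert (BY : forall m, rsum m (fun k => Cmod (y k) ^ 2) <= K ^ 2).
  { intros m. apply (is_ulim_le U (fun n => rsum m (fun k => Cmod (x n k) ^ 2)) (fun _ => K ^ 2)
      _ _ HU).
    - apply (is_ulim_rsum U m (fun k n => Cmod (x n k) ^ 2)); [exact HU|]. intros k.
      unfold is_ulim.
      assert (Q : is_ulim U (fun n => Re (x n k) * Re (x n k) + Im (x n k) * Im (x n k))
         (yr k * yr k + yi k * yi k)).
      { apply is_ulim_plus; [exact HU| |]; apply is_ulim_mult; auto. }
      intros eps He. refine (ultra_imp HU _ _ _ (Q eps He)).
      intros n. cbv beta. rewrite !Cmod2_alt. unfold y, Re, Im; simpl.
      rewrite !Rmult_1_r. auto.
    - apply is_ulim_const, HU.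
    - apply UT. intros n. apply SB. }
  destruct (l2_bound _ _ BY) as [Ly Ny].
  exists y. split; [exact Ly|]. split.
  - apply sq_le_sq; [exact K0|]. rewrite norm2_sq by exact Ly. exact Ny.
  - intros k. split; [apply Hr|apply Hi].
Qed.

Lemma is_ulim_ext {T : Type} U (u v : T -> R) l : ultra U -> (forall n, u n = v n) ->
  is_ulim U u l -> is_ulim U v l.
Proof.
  intros HU H Hl eps He. refine (ultra_imp HU _ _ _ (Hl eps He)).
  intros n. rewrite H. auto.
Qed.

Lemma Re_csum n f : Re (csum n f) = rsum n (fun i => Re (f i)).
Proof. induction n; simpl; [reflexivity|]. rewrite <- IHn. reflexivity. Qed.

(** The form on a truncation is a polynomial in finitely many coordinates. It is written with sums
    and products alone, hence the factor [-1], so that the rules for ultralimits apply term by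
    term. *)
Lemma form_trunc A N x : bounded_op A ->
  innerRe (A (trunc N x)) (trunc N x) =
  rsum N (fun j => rsum N (fun i =>
    (Re (x j) * Re (x i) + Im (x j) * Im (x i)) * Re (A (delta j) i)
    + (Re (x j) * Im (x i) + -1 * (Im (x j) * Re (x i))) * Im (A (delta j) i))).
Proof.
  intros HA. rewrite innerRe_ip. rewrite (trunc_vsum N x) at 1.
  rewrite op_vsum by auto.
  rewrite ip_vsum_l by auto.
  rewrite Re_csum. apply rsum_ext. intros j Hj.
  rewrite (ip_conj (trunc N x)), trunc_vsum, ip_vsum_l by auto.
  replace (x j * Cconj (csum N (fun i => x i * ip (delta i) (A (delta j)))))%C
    with (csum N (fun i => x j * Cconj (x i) * A (delta j) i)%C).
  2:{ clear Hj. induction N; simpl.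
      - unfold Cconj, RtoC, Cmult; simpl; f_equal; ring.
      - rewrite IHN, Cplus_conj, Cmult_conj, <- ip_conj, ip_delta. ring. }
  rewrite Re_csum. apply rsum_ext. intros i Hi.
  destruct (x j), (x i), (A (delta j) i). unfold Re, Im; simpl. ring.
Qed.

(** With [x = u + t], [t] the tail, the form changes by [2 Re <A u, t> + <A t, t>]. Both inner
    products see only the tail of a vector in the range of [A], so each is at most [eps / 3]. *)
Lemma form_trunc_close A eps : positive_op A -> tight A -> 0 < eps ->
  exists N, forall x, l2 x -> norm2 x <= 1 ->
    Rabs (innerRe (A x) x - innerRe (A (trunc N x)) (trunc N x)) <= eps.
Proof.
  intros HP HT He. pose proof HP as [HA _].
  destruct (HT (eps / 3) ltac:(lra)) as [N HN]. exists N. intros x Hx H1.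
  set (u := trunc N x). set (t := tail N x).
  assert (Hu : l2 u) by apply l2_trunc. assert (Ht : l2 t) by (apply l2_tail, Hx).
  assert (Nu : norm2 u <= 1) by (pose proof (norm2_trunc N x Hx); unfold u; lra).
  assert (Nt : norm2 t <= 1) by (pose proof (norm2_tail N x Hx); unfold t; lra).
  assert (T : forall z, l2 z -> norm2 z <= 1 -> Cmod (ip (A z) t) <= eps / 3).
  { intros z Hz Nz. unfold t. rewrite ip_tail.
    eapply Rle_trans; [apply cauchy_schwarz; auto|].
    pose proof (HN z Hz). pose proof (norm2_nonneg x). pose proof (norm2_nonneg z).
    pose proof (norm2_nonneg (tail N (A z))). nra. }
  rewrite (trunc_tail N x) at 1 2. fold u t. rewrite form_lin by assumption.
  rewrite Cmod_1. pose proof (T u Hu Nu) as T1. pose proof (T t Ht Nt) as T2.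
  replace (Cconj 1 * ip (A u) t)%C with (ip (A u) t).
  2:{ destruct (ip (A u) t). unfold Cconj, RtoC, Cmult; simpl. f_equal; ring. }
  rewrite (innerRe_ip (A t)).
  pose proof (re_le_Cmod (ip (A u) t)); pose proof (re_le_Cmod (ip (A t) t)).
  assert (R1 : Rabs (Re (ip (A u) t)) <= eps / 3) by lra.
  assert (R2 : Rabs (Re (ip (A t) t)) <= eps / 3) by lra.
  abs_lra.
Qed.

Lemma form_homog A m : positive_op A ->
  (forall y, l2 y -> norm2 y <= 1 -> innerRe (A y) y <= m) ->
  forall y, l2 y -> innerRe (A y) y <= m * nsq y.
Proof.
  intros HP H y Hy. pose proof HP as [HA _]. pose proof (norm2_nonneg y).
  destruct (Req_dec (norm2 y) 0) as [E|E].
  - rewrite (norm2_eq0 y Hy E), op_zero by assumption. rewrite innerRe_ip, ip_zero_l.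
    rewrite <- norm2_sq by apply l2_zero. rewrite norm2_zero. simpl. lra.
  - set (r := / norm2 y).
    assert (Hr : 0 < r) by (apply Rinv_pos; lra).
    set (z := vlin (RtoC r) y 0 y).
    assert (Hz : l2 z) by (apply l2_lin; assumption).
    assert (Ez : A z = vlin (RtoC r) (A y) 0 (A y)) by (apply op_lin; assumption).
    assert (B : innerRe (A z) z <= m).
    { apply H; [assumption|]. unfold z. eapply Rle_trans; [apply norm2_lin; assumption|].
      rewrite Cmod_0, Cmod_R, Rabs_pos_eq by lra. unfold r. right. field. exact E. }
    rewrite innerRe_ip, Ez in B. unfold z in B.
    rewrite ip_lin_l in B by auto.
    rewrite !ip_lin_r in B by auto.
    rewrite (ip_positive A y HP Hy) in B. unfold Re, RtoC, Cconj, Cplus, Cmult in B; simpl in B.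
    rewrite <- norm2_sq by assumption.
    set (q := innerRe (A y) y) in *.
    assert (Hq : r * r * q <= m) by lra.
    replace q with (r * r * q * norm2 y ^ 2) by (unfold r; field; exact E).
    apply Rmult_le_compat_r; [apply pow2_ge_0|exact Hq].
Qed.

(** The supremum [m] of the form on the unit ball is attained at a weak limit of a maximising
    sequence, and a maximiser is an eigenvector because [m] also bounds the norm of [A]. *)
Lemma top_eigenvector A : positive_op A -> tight A ->
  exists m x, 0 <= m /\ l2 x /\ nsq x = 1 /\ A x = (fun k => RtoC m * x k)%C /\
    forall y, l2 y -> innerRe (A y) y <= m * nsq y.
Proof.
  intros HP HT. pose proof HP as [HA _].
  set (E := fun r => exists y, l2 y /\ norm2 y <= 1 /\ r = innerRe (A y) y).
  destruct (completeness E) as [m [Hub Hlub]].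
  { exists (opnorm A). intros r [y [Hy [H1 ->]]].
    eapply Rle_trans; [apply Rle_abs|]. rewrite innerRe_ip.
    eapply Rle_trans; [apply re_le_Cmod|].
    eapply Rle_trans; [apply cauchy_schwarz; auto|].
    pose proof (opnorm_unit A y HA Hy H1). pose proof (norm2_nonneg y).
    pose proof (norm2_nonneg (A y)). nra. }
  { exists (innerRe (A vzero) vzero), vzero. split; [apply l2_zero|]. rewrite norm2_zero.
    split; [lra|reflexivity]. }
  assert (Hm : 0 <= m).
  { apply Rle_trans with (innerRe (A vzero) vzero); [apply HP, l2_zero|]. apply Hub.
    exists vzero. rewrite norm2_zero. split; [apply l2_zero|]. split; [lra|reflexivity]. }
  assert (Hq : forall y, l2 y -> innerRe (A y) y <= m * nsq y).
  { apply form_homog; [assumption|]. intros y Hy H1. apply Hub. exists y. auto. }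
  pose proof (positive_norm_bound A m HP Hm Hq) as HN.
  (* If [m = 0] then [A] vanishes on [l2], and a weak limit of unit vectors might be 0; any unit
     vector will do. *)
  destruct (Req_dec m 0) as [E0|E0].
  { exists 0, (delta 0). rewrite E0 in *. split; [lra|]. split; [apply l2_delta|]. split.
    - apply RtoC_inj. rewrite <- ip_self, (proj2 orthonormal_delta). reflexivity.
    - split; [|exact Hq].
      rewrite (norm2_eq0 (A (delta 0))); auto.
      + extensionality k'. unfold vzero. ring.
      + pose proof (HN _ (l2_delta 0)). pose proof (norm2_nonneg (A (delta 0))). lra. }
  destruct (choice (fun n y => l2 y /\ norm2 y <= 1 /\ m - / INR (S n) <= innerRe (A y) y))
    as [x Hx].
  { intros n. apply NNPP. intros Hn.
    assert (P : 0 < / INR (S n)) by (apply Rinv_pos, lt_0_INR; lia).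
    assert (m <= m - / INR (S n)); [|lra]. apply Hlub. intros r [y [Hy [H1 ->]]].
    apply Rnot_lt_le. intros Hl. apply Hn. exists y. split; [assumption|]. split; [assumption|lra]. }
  destruct ultra_nat as [U [HU HN0]].
  destruct (weak_limit U x 1 HU) as [y [Hy [Ny Hlim]]]; [apply Hx|apply Hx|].
  (* Coordinatewise limits preserve each truncated form, and tightness makes the truncation error
     uniform on the unit ball. The three thirds of [eps] are the truncation errors at [x n] and at
     [y] and the defect of the maximising sequence. *)
  assert (Qy : m <= innerRe (A y) y).
  { apply le_epsilon. intros eps He.
    destruct (form_trunc_close A (eps / 3) HP HT ltac:(lra)) as [N HC].
    assert (L : m - eps / 3 - eps / 3 <= innerRe (A (trunc N y)) (trunc N y)).
    { apply (is_ulim_le U (fun _ => m - eps / 3 - eps / 3)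
        (fun n => innerRe (A (trunc N (x n))) (trunc N (x n))) _ _ HU).
      - apply is_ulim_const, HU.
      - rewrite form_trunc by assumption.
        eapply is_ulim_ext; [exact HU|intros n; symmetry; apply form_trunc; assumption|].
        apply (is_ulim_rsum U N (fun j n => rsum N (fun i => _))); [exact HU|]. intros j.
        apply (is_ulim_rsum U N (fun i n => _)); [exact HU|]. intros i.
        destruct (Hlim i) as [Li1 Li2], (Hlim j) as [Lj1 Lj2].
        repeat first [apply (is_ulim_plus U); [exact HU| |]
          | apply is_ulim_mult; [exact HU| |] | assumption | apply is_ulim_const; exact HU].
      - destruct (INR_unbounded (3 / eps)) as [M HM].
        refine (ultra_imp HU _ _ _ (HN0 M)). intros n Hn. cbv beta.
        destruct (Hx n) as [Lx [Nx Qx]]. pose proof (HC _ Lx Nx) as D.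
        apply Rabs_le_between in D.
        assert (/ INR (S n) <= eps / 3).
        { apply Rmult_le_reg_r with (INR (S n)); [apply lt_0_INR; lia|].
          rewrite Rinv_l by (apply not_0_INR; lia).
          assert (3 / eps <= INR (S n)) by (apply le_INR in Hn; rewrite S_INR; lra).
          apply Rmult_le_compat_l with (r := eps / 3) in H; [|lra].
          replace (eps / 3 * (3 / eps)) with 1 in H by (field; lra). exact H. }
        lra. }
    pose proof (HC y Hy Ny) as D. abs_lra. }
  pose proof (Hq y Hy) as Q2. pose proof (norm2_nonneg y). pose proof (norm2_sq y Hy).
  (* [m <= <A y, y> <= m * nsq y] with [m > 0] shows that no norm is lost in the limit. *)
  assert (Ey : nsq y = 1) by nra.
  assert (Eq : innerRe (A y) y = m) by nra.
  exists m, y. split; [exact Hm|]. split; [exact Hy|]. split; [exact Ey|]. split; [|exact Hq].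
  set (d := vlin 1 (A y) (RtoC (- m)) y).
  assert (Hd : l2 d) by (apply l2_lin; auto).
  (* [|A y - m y|^2 = |A y|^2 - 2 m^2 + m^2], and [|A y| <= m]. *)
  assert (Zd : d = vzero).
  { apply nsq_zero; [exact Hd|]. apply Rle_antisym; [|apply nsq_nonneg, Hd].
    unfold d. rewrite nsq_lin by auto. rewrite Cmod_1, Cmod_R, pow2_abs.
    rewrite (ip_positive A y HP Hy), Eq, Ey.
    assert (nsq (A y) <= m ^ 2).
    { rewrite <- norm2_sq by auto. apply pow_incr. split; [apply norm2_nonneg|].
      pose proof (HN y Hy). assert (norm2 y = 1) by (unfold norm2; fold (nsq y); rewrite Ey; apply sqrt_1).
      nra. }
    unfold Re, RtoC, Cconj, Cmult; simpl. nra. }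
  extensionality k.
  apply (f_equal (fun f => f k)) in Zd. unfold d, vlin, vzero in Zd. cbv beta in Zd.
  rewrite RtoC_opp in Zd.
  replace (A y k) with ((1 * A y k + - m * y k) + m * y k)%C by ring. rewrite Zd. ring.
Qed.

(** * Deflation and the spectral expansion *)

Definition deflate (A : op) (m : R) (x : vec) : op :=
  fun y => vlin 1 (A y) (RtoC (- m)) (proj x y).

Lemma Cconj_R (r : R) : Cconj (RtoC r) = RtoC r.
Proof. unfold Cconj, RtoC; simpl. f_equal; ring. Qed.

Lemma ip_scal_l a x y : l2 x -> l2 y -> ip (fun k => a * x k)%C y = (a * ip x y)%C.
Proof.
  intros Hx Hy. replace (fun k => a * x k)%C with (vlin a x 0 x)
    by (extensionality k'; unfold vlin; ring).
  rewrite ip_lin_l by assumption. ring.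
Qed.

Lemma ip_scal_r a x y : l2 x -> l2 y -> ip y (fun k => a * x k)%C = (Cconj a * ip y x)%C.
Proof. intros Hx Hy. rewrite ip_conj, ip_scal_l, Cmult_conj, <- ip_conj by assumption. reflexivity. Qed.

Lemma ip_deflate A m x y : bounded_op A -> l2 x -> l2 y ->
  ip (deflate A m x y) y = (ip (A y) y - RtoC (m * Cmod (ip y x) ^ 2))%C.
Proof.
  intros HA Hx Hy. unfold deflate.
  rewrite ip_lin_l by auto using bounded_proj. unfold proj. rewrite ip_scal_l by assumption.
  rewrite (ip_conj y x), Cmod2_alt. destruct (ip y x) as [p q], (ip (A y) y) as [r s].
  unfold Cminus, Copp, RtoC, Re, Im, Cconj, Cplus, Cmult; simpl. f_equal; ring.
Qed.

Lemma bounded_deflate A m x : bounded_op A -> l2 x -> bounded_op (deflate A m x).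
Proof. intros HA Hx. apply bounded_lin_op; auto using bounded_proj. Qed.

Lemma innerRe_deflate A m x y : bounded_op A -> l2 x -> l2 y ->
  innerRe (deflate A m x y) y = innerRe (A y) y - m * Cmod (ip y x) ^ 2.
Proof.
  intros HA Hx Hy. rewrite !innerRe_ip, ip_deflate by assumption.
  destruct (ip (A y) y). unfold Re; simpl. ring.
Qed.

(** Cauchy-Schwarz for the form of [A] at [y] and at the eigenvector [x] reads
    [m^2 |<y, x>|^2 <= m <A y, y>]. *)
Lemma positive_deflate A m x : positive_op A -> 0 <= m -> l2 x -> nsq x = 1 ->
  A x = (fun k => RtoC m * x k)%C -> positive_op (deflate A m x).
Proof.
  intros HP Hm Hx N1 E. pose proof HP as [HA _].
  split; [apply bounded_deflate; assumption|]. intros y Hy. split.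
  - change (Im (ip (deflate A m x y) y) = 0). rewrite ip_deflate, ip_positive by assumption.
    unfold Im; simpl. ring.
  - rewrite innerRe_deflate by assumption.
    pose proof (form_cauchy_schwarz A y x HP Hy Hx) as CS.
    rewrite positive_symmetric in CS by assumption. rewrite E in CS.
    rewrite (innerRe_ip (fun k => (RtoC m * x k)%C)) in CS.
    rewrite ip_scal_r, ip_scal_l, ip_self, N1, Cconj_R in CS by assumption.
    rewrite Cmod_mult, Cmod_R, Rpow_mult_distr, pow2_abs in CS.
    replace (Re (m * 1)%C) with m in CS by (unfold Re; simpl; ring).
    pose proof (proj2 (proj2 HP y Hy)).
    destruct (Req_dec m 0) as [Z|Z]; [rewrite Z; lra|].
    assert (0 <= m * (innerRe (A y) y - m * Cmod (ip y x) ^ 2)) by nra.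
    apply Rnot_lt_le. intros Hl. nra.
Qed.

Lemma tight_deflate A m x : bounded_op A -> tight A -> l2 x -> tight (deflate A m x).
Proof.
  intros HA HT Hx. apply (tight_lin 1 A (RtoC (- m)) (proj x)); auto using bounded_proj.
  apply (tight_proj (fun y => y)); [apply bounded_id|exact Hx].
Qed.

Lemma deflate_self A m x : l2 x -> nsq x = 1 -> A x = (fun k => RtoC m * x k)%C ->
  deflate A m x x = vzero.
Proof.
  intros Hx N1 E. extensionality k. unfold deflate, vlin, proj.
  rewrite E, ip_self, N1. unfold vzero. rewrite RtoC_opp. ring.
Qed.

Definition is_top (A : op) (p : R * vec) : Prop :=
  0 <= fst p /\ l2 (snd p) /\ nsq (snd p) = 1 /\
  A (snd p) = (fun k => RtoC (fst p) * snd p k)%C /\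
  forall y, l2 y -> innerRe (A y) y <= fst p * nsq y.

(** Choosing by [epsilon] keeps [deflated] a plain recursion on operators; [top_spec] says where the
    choice is meaningful. *)
Definition top (A : op) : R * vec := epsilon (inhabits (0, vzero)) (is_top A).

Fixpoint deflated (A : op) (k : nat) : op :=
  match k with
  | O => A
  | S k => deflate (deflated A k) (fst (top (deflated A k))) (snd (top (deflated A k)))
  end.

Lemma top_spec A : positive_op A -> tight A -> is_top A (top A).
Proof.
  intros HP HT. unfold top. apply epsilon_spec.
  destruct (top_eigenvector A HP HT) as [m [x H]]. exists (m, x). exact H.
Qed.

Lemma deflated_spec A k : positive_op A -> tight A ->
  positive_op (deflated A k) /\ tight (deflated A k).
Proof.
  intros HP HT. induction k as [|k [IP IT]]; [auto|]. simpl.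
  destruct (top_spec _ IP IT) as [H0 [H1 [H2 [H3 H4]]]]. split.
  - apply positive_deflate; assumption.
  - apply tight_deflate; try assumption. apply IP.
Qed.

Lemma orthogonal_vector n v : (forall i, (i < n)%nat -> l2 (v i)) ->
  exists x, l2 x /\ x <> vzero /\ forall i, (i < n)%nat -> ip x (v i) = RtoC 0.
Proof.
  intros Hv.
  destruct (homogeneous_system n (fun i j => ip (delta j) (v i))) as [c [[j [Hj Hc]] Hs]].
  exists (vsum (S n) c delta). split; [apply l2_vsum; auto|]. split.
  - intros E. apply Hc. rewrite <- (orthonormal_coef delta (S n) c j orthonormal_delta) by lia.
    rewrite E. apply ip_zero_l.
  - intros i Hi. rewrite ip_vsum_l by auto. rewrite <- (Hs i Hi).
    apply csum_ext. intros; ring.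
Qed.

(** Injectivity keeps every eigenvalue positive, so the sequence never degenerates. The last clause
    bounds the remainder of the expansion by [lam k]: this identifies the singular values and, once
    they tend to 0, makes [e] complete. *)
Lemma spectral_sequence A : positive_op A -> tight A ->
  (forall x, l2 x -> A x = vzero -> x = vzero) ->
  exists (e : nat -> vec) (lam : nat -> R), orthonormal e /\
    (forall k, A (e k) = (fun j => RtoC (lam k) * e k j)%C) /\
    (forall k, 0 < lam k) /\ (forall k, lam (S k) <= lam k) /\
    forall k x, l2 x ->
      norm2 (vlin 1 (A x) (-1) (vsum k (fun i => RtoC (lam i) * ip x (e i))%C e)) <= lam k * norm2 x.
Proof.
  intros HP HT HI.
  set (B := deflated A). set (lam := fun k => fst (top (B k))). set (e := fun k => snd (top (B k))).
  assert (HB : forall k, positive_op (B k)) by (intros; apply deflated_spec; assumption).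
  assert (HtB : forall k, tight (B k)) by (intros; apply deflated_spec; assumption).
  assert (L0 : forall k, 0 <= lam k) by (intros; apply top_spec; auto).
  assert (Le : forall k, l2 (e k)) by (intros; apply top_spec; auto).
  assert (Ne : forall k, nsq (e k) = 1) by (intros; apply top_spec; auto).
  assert (Ee : forall k, B k (e k) = (fun j => RtoC (lam k) * e k j)%C)
    by (intros; apply (top_spec (B k)); auto).
  assert (Qe : forall k y, l2 y -> innerRe (B k y) y <= lam k * nsq y)
    by (intros; apply top_spec; auto).
  assert (BS : forall k, B (S k) = deflate (B k) (lam k) (e k)) by reflexivity.
  assert (EB : forall k x, B k x =
    vlin 1 (A x) (-1) (vsum k (fun i => RtoC (lam i) * ip x (e i))%C e)).
  { induction k; intros x.
    - extensionality j. unfold vlin, vsum; simpl. unfold B; simpl. ring.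
    - rewrite BS, vsum_S. unfold deflate. rewrite IHk.
      extensionality j. unfold vlin, proj. rewrite RtoC_opp. ring. }
  assert (NB : forall k x, l2 x -> norm2 (B k x) <= lam k * norm2 x).
  { intros k. apply positive_norm_bound; auto. }
  (* If [lam k = 0], then [A] equals its expansion of length [k] and kills a nonzero vector
     orthogonal to [e i] for all [i < k]. *)
  assert (Lpos : forall k, 0 < lam k).
  { intros k. destruct (L0 k) as [H|H]; [exact H|exfalso].
    destruct (orthogonal_vector k e) as [x [Hx [Hnz Ho]]]; [auto|].
    apply Hnz, HI; [assumption|]. pose proof HP as [HA _].
    apply norm2_eq0; [apply op_l2; assumption|].
    pose proof (NB k x Hx) as P. rewrite <- H in P.
    rewrite EB in P.
    replace (vlin 1 (A x) (-1) (vsum k (fun i => RtoC (lam i) * ip x (e i))%C e)) with (A x) in P.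
    - pose proof (norm2_nonneg (A x)). lra.
    - extensionality j. unfold vlin, vsum.
      rewrite csum_zero; [ring|]. intros i Hi. rewrite Ho by assumption. ring. }
  (* By symmetry of [B k], [lam k <e k, e i> = <e k, B k (e i)> = 0]. *)
  assert (Ort : forall k i, B k (e i) = vzero -> ip (e k) (e i) = RtoC 0).
  { intros k i HZ.
    pose proof (positive_symmetric (B k) (e k) (e i) (HB k) (Le k) (Le i)) as S0.
    rewrite HZ, ip_zero_r, Ee, ip_scal_l in S0 by auto.
    assert (RtoC (lam k) <> RtoC 0).
    { intros F. apply RtoC_inj in F. specialize (Lpos k). lra. }
    replace (ip (e k) (e i)) with (/ lam k * (lam k * ip (e k) (e i)))%C by (field; assumption).
    rewrite S0. ring. }
  (* If [e i] is in the kernel of [B k], then [e k] is orthogonal to it by [Ort], so subtracting the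
     projection on [e k] leaves [e i] in the kernel. *)
  assert (ZB : forall k i, (i < k)%nat -> B k (e i) = vzero).
  { induction k as [|k IHk]; [intros; lia|]. intros i Hi. rewrite BS.
    destruct (Nat.eq_dec i k) as [->|Hik]; [apply deflate_self; auto|].
    unfold deflate. rewrite IHk by lia.
    assert (H : ip (e i) (e k) = RtoC 0).
    { rewrite ip_conj, Ort by (apply IHk; lia). apply Cconj_R. }
    extensionality j. unfold vlin, proj, vzero. rewrite H. ring. }
  assert (Z : forall k i, (i < k)%nat -> ip (e k) (e i) = RtoC 0) by auto.
  assert (Ho : orthonormal e).
  { split; [exact Le|]. intros i j. destruct Nat.eq_dec as [->|Hij].
    - rewrite ip_self, Ne. reflexivity.
    - destruct (lt_dec i j) as [H|H].
      + rewrite ip_conj, (Z j i H). apply Cconj_R.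
      + apply Z. lia. }
  exists e, lam. split; [exact Ho|]. split; [|split; [exact Lpos|split]].
  - intros k. pose proof (EB k (e k)) as E1. rewrite Ee in E1.
    extensionality j. apply (f_equal (fun f => f j)) in E1. cbv beta in E1.
    rewrite E1. unfold vlin, vsum. rewrite csum_zero; [ring|].
    intros i Hi. rewrite (Z k i Hi). ring.
  - intros k. pose proof (Qe k (e (S k)) (Le _)) as P. rewrite Ne, Rmult_1_r in P.
    apply Rle_trans with (innerRe (B (S k) (e (S k))) (e (S k))).
    + rewrite Ee, innerRe_ip, ip_scal_l, ip_self, Ne by auto. unfold Re; simpl. lra.
    + rewrite BS, innerRe_deflate by (auto; apply HB).
      pose proof (Csq_nonneg (ip (e (S k)) (e k))). specialize (L0 k). nra.
  - intros k x Hx. rewrite <- EB. apply NB, Hx.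
Qed.

(** * Orthonormal bases and diagonalisation *)

Lemma Cmod_neg1 : Cmod (RtoC (-1)) = 1.
Proof. rewrite Cmod_R, Rabs_left; lra. Qed.

Lemma bessel e y n : orthonormal e -> l2 y ->
  rsum n (fun k => Cmod (ip y (e k)) ^ 2) <= nsq y.
Proof.
  intros He Hy. assert (Hl : forall i, l2 (e i)) by apply He.
  set (c := fun k => ip y (e k)). set (s := vsum n c e).
  assert (Hs : l2 s) by (apply l2_vsum; auto).
  pose proof (nsq_nonneg _ (l2_lin 1 y (-1) s Hy Hs)) as P.
  rewrite nsq_lin in P by assumption. unfold s in P at 2. rewrite nsq_vsum in P by assumption.
  rewrite (ip_conj s y) in P. unfold s in P. rewrite ip_vsum_l in P by auto.
  rewrite (csum_ext _ _ (fun i => RtoC (Cmod (c i) ^ 2))) in P.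
  2:{ intros i Hi. rewrite (ip_conj y (e i)). fold (c i). rewrite Cmod2_conj. reflexivity. }
  assert (E : Re (1 * Cconj (-1) * Cconj (csum n (fun i => RtoC (Cmod (c i) ^ 2))))%C
    = - rsum n (fun i => Cmod (c i) ^ 2)).
  { transitivity (- Re (csum n (fun i => RtoC (Cmod (c i) ^ 2)))).
    - destruct (csum n _) as [p q]. unfold Re; simpl. ring.
    - rewrite Re_csum. reflexivity. }
  rewrite E, Cmod_1, Cmod_neg1 in P.
  fold (c). change (rsum n (fun k => Cmod (c k) ^ 2) <= nsq y). lra.
Qed.

Lemma ip_trunc_r N x v : l2 x -> ip x (trunc N v) = csum N (fun i => x i * Cconj (v i))%C.
Proof.
  intros Hx. rewrite trunc_vsum, ip_conj, ip_vsum_l by auto.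
  induction N; simpl; [apply Cconj_R|]. rewrite Cplus_conj, IHN, Cmult_conj, <- ip_conj, ip_delta.
  ring.
Qed.

Lemma ulim_of_approx {T : Type} U (u : T -> R) l : ultra U ->
  (forall eps, 0 < eps -> exists (v : T -> R) l', is_ulim U v l' /\ Rabs (l - l') <= eps /\
     forall n, Rabs (u n - v n) <= eps) -> is_ulim U u l.
Proof.
  intros HU H eps He. destruct (H (eps / 4) ltac:(lra)) as [v [l' [Hv [Hl Hu]]]].
  refine (ultra_imp HU _ _ _ (Hv (eps / 4) ltac:(lra))). intros n Hn. cbv beta in *.
  specialize (Hu n). abs_lra.
Qed.

(** For a bounded sequence coordinatewise convergence is weak convergence: the tail of [v] is
    negligible uniformly on the ball of radius [K]. *)
Lemma ulim_Re_ip U (x : nat -> vec) y v K : ultra U -> (forall n, l2 (x n)) ->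
  (forall n, norm2 (x n) <= K) -> l2 y -> norm2 y <= K -> l2 v ->
  (forall k, is_ulim U (fun n => Re (x n k)) (Re (y k)) /\
             is_ulim U (fun n => Im (x n k)) (Im (y k))) ->
  is_ulim U (fun n => Re (ip (x n) v)) (Re (ip y v)).
Proof.
  intros HU Hx HK Hy NK Hv Hlim.
  assert (K0 : 0 <= K) by (pose proof (norm2_nonneg y); lra).
  assert (T : forall eps, 0 < eps -> exists N, forall z, l2 z -> norm2 z <= K ->
    Cmod (ip z v - ip z (trunc N v))%C <= eps).
  { intros eps He. destruct (tail_small v (eps / (K + 1)) Hv) as [N HN].
    { apply Rdiv_lt_0_compat; lra. }
    exists N. intros z Hz Nz. rewrite (trunc_tail N v) at 1.
    rewrite ip_lin_r by auto.
    replace (Cconj 1 * ip z (trunc N v) + Cconj 1 * ip z (tail N v) - ip z (trunc N v))%C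
      with (ip z (tail N v)) by (rewrite Cconj_R; ring).
    eapply Rle_trans; [apply cauchy_schwarz; auto|].
    specialize (HN N (le_n _)). pose proof (norm2_nonneg z). pose proof (norm2_nonneg (tail N v)).
    apply Rle_trans with (K * (eps / (K + 1))).
    - apply Rmult_le_compat; assumption.
    - apply Rmult_le_reg_r with (K + 1); [lra|].
      replace (K * (eps / (K + 1)) * (K + 1)) with (K * eps) by (field; lra). nra. }
  apply ulim_of_approx; auto. intros eps He. destruct (T eps He) as [N HN].
  exists (fun n => Re (ip (x n) (trunc N v))), (Re (ip y (trunc N v))). split; [|split].
  - rewrite ip_trunc_r, Re_csum by assumption.
    apply (is_ulim_ext U (fun n => rsum N (fun i => Re (x n i) * Re (v i) + Im (x n i) * Im (v i))));
      [exact HU| |].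
    { intros n. rewrite ip_trunc_r, Re_csum by auto. apply rsum_ext. intros. unfold Re, Im; simpl. ring. }
    apply (is_ulim_rsum U N (fun i n => Re (x n i) * Re (v i) + Im (x n i) * Im (v i)));
      [exact HU|]. intros i.
    replace (Re (y i * Cconj (v i))%C) with (Re (y i) * Re (v i) + Im (y i) * Im (v i))
      by (unfold Re, Im; simpl; ring).
    destruct (Hlim i). apply is_ulim_plus; [exact HU| |]; apply is_ulim_mult; auto using is_ulim_const.
  - eapply Rle_trans; [|apply (HN y Hy NK)]. apply (re_le_Cmod (ip y v - ip y (trunc N v))%C).
  - intros n. eapply Rle_trans; [|apply (HN (x n) (Hx n) (HK n))].
    apply (re_le_Cmod (ip (x n) v - ip (x n) (trunc N v))%C).
Qed.

(** [s] is a weak limit of the partial sums. Its norm is at most that of [c] because balls are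
    weakly closed, and at least that of [c] by Bessel's inequality. *)
Lemma riesz_fischer e c : orthonormal e -> l2 c ->
  exists s, l2 s /\ (forall k, ip s (e k) = c k) /\ nsq s = nsq c.
Proof.
  intros He Hc. assert (Hl : forall i, l2 (e i)) by apply He.
  set (x := fun n => vsum n c e).
  assert (Hx : forall n, l2 (x n)) by (intros; apply l2_vsum; auto).
  assert (NX : forall n, norm2 (x n) <= norm2 c).
  { intros n. apply sq_le_sq; [apply norm2_nonneg|]. rewrite !norm2_sq by auto.
    unfold x. rewrite nsq_vsum by assumption. apply l2_partial, Hc. }
  destruct ultra_nat as [U [HU HN0]].
  destruct (weak_limit U x (norm2 c) HU Hx NX) as [y [Hy [Ny Hlim]]].
  assert (W : forall v l, l2 v -> (exists N, forall n, (N <= n)%nat -> ip (x n) v = l) ->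
    Re (ip y v) = Re l).
  { intros v l Hv [N HN].
    apply (is_ulim_unique U (fun n => Re (ip (x n) v)) _ _ HU);
      [apply (ulim_Re_ip U x y v (norm2 c)); assumption|].
    intros eps Hep. refine (ultra_imp HU _ _ _ (HN0 N)). intros n Hn. cbv beta.
    rewrite HN, Rminus_diag, Rabs_R0 by assumption. exact Hep. }
  assert (Co : forall k n, (S k <= n)%nat -> ip (x n) (e k) = c k)
    by (intros; apply orthonormal_coef; auto).
  assert (Ey : forall k, ip y (e k) = c k).
  { intros k. pose proof (W (e k) (c k) (Hl k) (ex_intro _ _ (Co k))) as W1.
    (* [W] compares real parts; pairing with [i] times [e k] exposes the imaginary part of the
       coefficient. *)
    pose proof (W (fun j => Ci * e k j)%C (Cconj Ci * c k)%C) as W2.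
    rewrite ip_scal_r in W2 by auto. specialize (W2 (l2_scal _ _ (Hl k))).
    destruct (ip y (e k)), (c k) eqn:E. unfold Re in *; simpl in *. f_equal; [exact W1|].
    rewrite !Rmult_0_l, !Rminus_0_l in W2.
    enough (- (-(1) * r0) = - (-(1) * r2)) by lra. apply W2.
    exists (S k). intros n Hn. rewrite ip_scal_r, Co, E by auto. reflexivity. }
  exists y. split; [exact Hy|]. split; [exact Ey|]. apply Rle_antisym.
  - rewrite <- !norm2_sq by assumption. apply pow_incr. split; [apply norm2_nonneg|exact Ny].
  - apply (l2_bound c). intros n. eapply Rle_trans; [|apply (bessel e y n He Hy)].
    right. apply rsum_ext. intros k _. rewrite Ey. reflexivity.
Qed.

(** Isometry comes from [riesz_fischer]: the vector it builds from the coefficients of [x] has their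
    norm, and completeness identifies this vector with [x]. *)
Lemma unitary_of_basis e : orthonormal e ->
  (forall x, l2 x -> (forall k, ip x (e k) = RtoC 0) -> x = vzero) ->
  unitary (fun x k => ip x (e k)).
Proof.
  intros He HC. assert (Hl : forall i, l2 (e i)) by apply He.
  set (W := fun x k => ip x (e k)).
  assert (LW : forall x, l2 x -> l2 (W x)).
  { intros x Hx. apply (l2_bound _ (nsq x)). intros n. apply bessel; assumption. }
  assert (NW : forall x, l2 x -> norm2 (W x) = norm2 x).
  { intros x Hx. destruct (riesz_fischer e (W x) He (LW x Hx)) as [s [Hs [Es Ns]]].
    assert (D : vlin 1 x (-1) s = vzero).
    { apply HC; [apply l2_lin; assumption|]. intros k. rewrite ip_lin_l by auto.
      rewrite Es. unfold W. ring. }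
    assert (x = s).
    { extensionality k. apply (f_equal (fun f => f k)) in D.
      unfold vlin, vzero in D. cbv beta in D.
      replace (x k) with (1 * x k + -1 * s k + s k)%C by ring. rewrite D. ring. }
    unfold norm2. fold (nsq x). fold (nsq (W x)). rewrite <- Ns, H. reflexivity. }
  split; [|split; [exact NW|]].
  - split; [|split].
    + intros x y a b Hx Hy. extensionality k. unfold W.
      apply (ip_lin_l a x b y); auto.
    + exact LW.
    + exists 1. intros x Hx. rewrite NW by assumption. lra.
  - intros y Hy. destruct (riesz_fischer e y He Hy) as [s [Hs [Es _]]].
    exists s. split; [exact Hs|]. apply functional_extensionality; exact Es.
Qed.

(** The unitary sends a vector to its coefficients in the eigenbasis. The truncated expansion is an
    optimal approximant, so the eigenvalues are the singular values in the same order. *)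
Lemma trace_diagonalize tau A : is_trace tau -> L1inf A -> positive_op A ->
  (forall x, l2 x -> A x = vzero -> x = vzero) ->
  tau A = tau (diag (fun n => mu n A)).
Proof.
  intros [_ [_ HU]] HL HP HI. pose proof HP as [HA _]. pose proof HL as [HCp _].
  destruct (spectral_sequence A HP (tight_compact A HCp) HI) as [e [lam [He [Hee [Hpos [Hdec Hb]]]]]].
  assert (Hl : forall i, l2 (e i)) by apply He.
  pose proof (decr_le lam Hdec) as Hmono.
  assert (Hmu : forall n, mu n A = lam n).
  { intros n. apply Rle_antisym.
    - set (F := fun x => vsum n (fun i => RtoC (lam i) * ip x (e i))%C e).
      assert (BF : bounded_op F).
      { split; [|split].
        - intros x y a b Hx Hy. extensionality k. unfold F, vsum.
          rewrite <- !csum_scal, <- csum_plus. apply csum_ext. intros i Hi.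
          change (fun k0 => (a * x k0 + b * y k0)%C) with (vlin a x b y).
          rewrite ip_lin_l by auto. ring.
        - intros x Hx. apply l2_vsum; auto.
        - exists (opnorm A + lam n). intros x Hx.
          replace (F x) with (vlin 1 (A x) (-1)
            (vlin 1 (A x) (-1) (vsum n (fun i => RtoC (lam i) * ip x (e i))%C e))).
          2:{ extensionality k. unfold F, vlin. ring. }
          eapply Rle_trans; [apply norm2_lin; auto|].
          rewrite Cmod_1, Cmod_neg1. specialize (Hb n x Hx). pose proof (opnorm_bound A x HA Hx). lra. }
      apply Rle_trans with (opnorm (opsub A F)).
      + apply (mu_glb n A HA); [exact BF|]. exists e. split; [auto|].
        intros x Hx. exists (fun i => RtoC (lam i) * ip x (e i))%C. reflexivity.
      + apply opnorm_le. intros x Hx H1. rewrite opsub_lin. unfold F.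
        eapply Rle_trans; [apply Hb, Hx|]. pose proof (Hpos n). nra.
    - apply mu_ge_eigen with e; auto. left; apply Hpos. }
  symmetry. apply (HU A _ (fun x k => ip x (e k))); [exact HL| |].
  (* A vector orthogonal to every [e k] satisfies [|A x| <= mu n A |x|] for all [n], so [A x = 0]
     and injectivity applies. *)
  - apply unitary_of_basis; [exact He|]. intros x Hx Hz. apply HI; [exact Hx|].
    apply norm2_eq0; [apply op_l2; assumption|].
    apply Rle_antisym; [|apply norm2_nonneg].
    apply (is_lim_seq_le (fun _ => norm2 (A x)) (fun n => mu n A * norm2 x) (norm2 (A x)) 0).
    + intros n. rewrite Hmu. specialize (Hb n x Hx).
      replace (vlin 1 (A x) (-1) (vsum n (fun i => RtoC (lam i) * ip x (e i))%C e)) with (A x) in Hb;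
        [exact Hb|].
      extensionality j. unfold vlin, vsum.
      rewrite csum_zero; [ring|]. intros i Hi. rewrite Hz. ring.
    + apply is_lim_seq_const.
    + replace (Finite 0) with (Rbar_mult 0 (norm2 x)) by (simpl; f_equal; ring).
      apply is_lim_seq_scal_r. apply HCp.
  - intros x Hx. extensionality k. unfold diag.
    rewrite Hmu, (positive_symmetric A x (e k)), Hee, ip_scal_r, Cconj_R by auto. reflexivity.
Qed.

(** * Traces of diagonal operators *)

(** The bound concerns the terms in their given order and not the decreasing rearrangement; in this
    form it is stable under linear combinations and under permutations inside dyadic blocks. *)
Definition weak_l1 (z : nat -> R) : Prop := exists c, forall k, Rabs (z k) <= c / INR (S k).

Lemma INR_S_pos k : 0 < INR (S k).
Proof. apply lt_0_INR; lia. Qed.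

Lemma weak_l1_const z c : (forall k, Rabs (z k) <= c / INR (S k)) -> 0 <= c.
Proof.
  intros H. specialize (H 0%nat). simpl in H. pose proof (Rabs_pos (z 0%nat)). lra.
Qed.

Lemma div_INR_decr c n k : 0 <= c -> (n <= k)%nat -> c / INR (S k) <= c / INR (S n).
Proof.
  intros Hc H. apply Rmult_le_compat_l; [exact Hc|].
  apply Rinv_le_contravar; [apply INR_S_pos|apply le_INR; lia].
Qed.

Lemma weak_le_const z c : (forall k, Rabs (z k) <= c / INR (S k)) -> forall k, Rabs (z k) <= c.
Proof.
  intros Hc k. pose proof (weak_l1_const z c Hc) as c0. eapply Rle_trans; [apply Hc|].
  eapply Rle_trans; [apply (div_INR_decr c 0); [exact c0|lia]|]. simpl. lra.
Qed.

Lemma is_lim_div_INR c : is_lim_seq (fun n => c / INR (S n)) 0.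
Proof.
  replace (Finite 0) with (Rbar_mult c 0) by (simpl; f_equal; ring).
  apply is_lim_seq_scal_l. apply (is_lim_seq_incr_1 (fun n => / INR n)).
  replace (Finite 0) with (Rbar_inv p_infty) by reflexivity.
  apply is_lim_seq_inv; [apply is_lim_seq_INR|easy].
Qed.

Lemma L1inf_intro A c : bounded_op A -> (forall n, mu n A <= c / INR (S n)) -> L1inf A.
Proof.
  intros HA H. split; [split; [exact HA|]|].
  - apply (is_lim_seq_le_le (fun _ => 0) _ (fun n => c / INR (S n)));
      [|apply is_lim_seq_const|apply is_lim_div_INR].
    intros n. split; [apply mu_nonneg, HA|apply H].
  - exists c. intros n. specialize (H n). pose proof (INR_S_pos n).
    apply Rmult_le_compat_l with (r := INR (S n)) in H; [|lra].
    replace (INR (S n) * (c / INR (S n))) with c in H by (field; lra). exact H.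
Qed.

Lemma L1inf_diag z : weak_l1 z -> L1inf (diag z).
Proof.
  intros [c Hc]. pose proof (weak_l1_const z c Hc) as c0.
  pose proof (weak_le_const z c Hc) as B.
  apply L1inf_intro with c; [eapply bounded_diag, B|]. intros n.
  apply mu_diag_le with c; [exact B|]. intros k Hk. eapply Rle_trans; [apply Hc|].
  apply div_INR_decr; assumption.
Qed.

Lemma positive_diag z M : (forall k, Rabs (z k) <= M) -> (forall k, 0 <= z k) -> positive_op (diag z).
Proof.
  intros HM H0. pose proof (bounded_diag z M HM) as HB.
  split; [exact HB|]. intros x Hx. split.
  - unfold innerIm. rewrite (Series_ext _ (fun n => 0 * 0)); [rewrite Series_scal_l; ring|].
    intros n. unfold diag, Im; simpl. ring.
  - apply series_nonneg; [|apply (ip_ex Re); auto using re_le_Cmod].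
    intros k. specialize (H0 k). unfold diag. destruct (x k) as [a b]. unfold Re; simpl.
    ring_simplify. pose proof (pow2_ge_0 a); pose proof (pow2_ge_0 b). nra.
Qed.

Lemma weak_l1_bounded z : weak_l1 z -> exists M, forall k, Rabs (z k) <= M.
Proof. intros [c Hc]. exists c. apply weak_le_const, Hc. Qed.

Lemma weak_l1_lin a z b w : weak_l1 z -> weak_l1 w -> weak_l1 (fun k => a * z k + b * w k).
Proof.
  intros [c Hc] [d Hd]. exists (Rabs a * c + Rabs b * d). intros k.
  eapply Rle_trans; [apply Rabs_triang|]. rewrite !Rabs_mult.
  replace ((Rabs a * c + Rabs b * d) / INR (S k))
    with (Rabs a * (c / INR (S k)) + Rabs b * (d / INR (S k)))
    by (field; pose proof (INR_S_pos k); lra).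
  pose proof (Rabs_pos a); pose proof (Rabs_pos b). specialize (Hc k); specialize (Hd k). nra.
Qed.

Lemma weak_l1_rsum M (z : nat -> nat -> R) : (forall j, (j < M)%nat -> weak_l1 (z j)) ->
  weak_l1 (fun k => rsum M (fun j => z j k)).
Proof.
  induction M; intros H; simpl.
  - exists 0. intros k. rewrite Rabs_R0. unfold Rdiv. lra.
  - destruct (weak_l1_lin 1 _ 1 _ (IHM (fun j Hj => H j (Nat.lt_lt_succ_r _ _ Hj)))
      (H M (Nat.lt_succ_diag_r _))) as [c Hc].
    exists c. intros k. specialize (Hc k). rewrite !Rmult_1_l in Hc. exact Hc.
Qed.

Lemma weak_l1_scal a z : weak_l1 z -> weak_l1 (fun k => a * z k).
Proof.
  intros [c Hc]. exists (Rabs a * c). intros k. rewrite Rabs_mult.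
  unfold Rdiv. rewrite Rmult_assoc. apply Rmult_le_compat_l; [apply Rabs_pos|apply Hc].
Qed.

(** Real-valued, so that order arguments apply; by [dtrace_real] no information is lost for a
    positive trace. *)
Definition dtrace (tau : op -> C) (z : nat -> R) : R := Re (tau (diag z)).

Lemma tau_diag_lin tau a z b w : is_trace tau -> weak_l1 z -> weak_l1 w ->
  tau (diag (fun k => a * z k + b * w k)) = (RtoC a * tau (diag z) + RtoC b * tau (diag w))%C.
Proof.
  intros [HA [HS _]] Hz Hw.
  assert (D : forall a z, weak_l1 z -> tau (diag (fun k => a * z k)) = (RtoC a * tau (diag z))%C).
  { intros a' z' Hz'. rewrite <- HS by (apply L1inf_diag, Hz'). f_equal.
    extensionality x; extensionality k.
    unfold diag, opscale. rewrite RtoC_mult. ring. }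
  rewrite <- !D by assumption. rewrite <- HA by (apply L1inf_diag, weak_l1_scal; assumption). f_equal.
  extensionality x; extensionality k.
  unfold diag, opadd. rewrite RtoC_plus. ring.
Qed.

Lemma dtrace_lin tau a z b w : is_trace tau -> weak_l1 z -> weak_l1 w ->
  dtrace tau (fun k => a * z k + b * w k) = a * dtrace tau z + b * dtrace tau w.
Proof.
  intros HT Hz Hw. unfold dtrace. rewrite tau_diag_lin by assumption.
  destruct (tau (diag z)), (tau (diag w)). unfold Re; simpl. ring.
Qed.

Lemma dtrace_nonneg tau z : trace_positive tau -> weak_l1 z -> (forall k, 0 <= z k) ->
  0 <= dtrace tau z.
Proof.
  intros HP Hz H0. destruct (weak_l1_bounded z Hz) as [M HM].
  apply HP; [apply L1inf_diag, Hz|apply (positive_diag z M); assumption].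
Qed.

(** Adding [c / (k + 1)] makes [z] nonnegative, and a positive trace is real on the sum and on the
    sequence added. *)
Lemma dtrace_real tau z : is_trace tau -> trace_positive tau -> weak_l1 z ->
  tau (diag z) = RtoC (dtrace tau z).
Proof.
  intros HT HP Hz. assert (Hz' := Hz). destruct Hz' as [c Hc].
  set (g := fun k => c / INR (S k)).
  pose proof (weak_l1_const z c Hc) as c0.
  assert (Hg0 : forall k, 0 <= g k).
  { intros k. unfold g. apply Rmult_le_pos; [exact c0|]. left. apply Rinv_pos, INR_S_pos. }
  assert (Hg : weak_l1 g).
  { exists c. intros k. rewrite Rabs_pos_eq by apply Hg0. right; reflexivity. }
  assert (R0 : forall w, weak_l1 w -> (forall k, 0 <= w k) -> Im (tau (diag w)) = 0).
  { intros w Hw H0. destruct (weak_l1_bounded w Hw) as [M HM].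
    apply HP; [apply L1inf_diag, Hw|apply (positive_diag w M); assumption]. }
  pose proof (R0 _ (weak_l1_lin 1 z 1 g Hz Hg)) as I1. rewrite tau_diag_lin in I1 by assumption.
  assert (I2 := R0 g Hg Hg0).
  assert (I3 : Im (tau (diag z)) = 0).
  { assert (I4 : Im (RtoC 1 * tau (diag z) + RtoC 1 * tau (diag g))%C = 0).
    { apply I1. intros k. specialize (Hc k). apply Rabs_le_between in Hc. unfold g. lra. }
    destruct (tau (diag z)), (tau (diag g)). unfold Im in *; simpl in *. lra. }
  unfold dtrace. destruct (tau (diag z)). unfold Re, Im, RtoC in *; simpl in *. congruence.
Qed.

Lemma dtrace_mono tau z w : is_trace tau -> trace_positive tau -> weak_l1 z -> weak_l1 w ->
  (forall k, z k <= w k) -> dtrace tau z <= dtrace tau w.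
Proof.
  intros HT HP Hz Hw H.
  pose proof (dtrace_nonneg tau _ HP (weak_l1_lin 1 w (-1) z Hw Hz)) as P.
  rewrite dtrace_lin in P by assumption.
  enough (0 <= 1 * dtrace tau w + -1 * dtrace tau z) by lra. apply P.
  intros k. specialize (H k). lra.
Qed.

(** * Permutations of the basis *)

(** Sums over lists, since a rearranged sum is compared with the original one through [NoDup] and
    [incl]. *)
Definition list_sum (f : nat -> R) (l : list nat) : R := fold_right (fun k s => f k + s) 0 l.

Lemma list_sum_app f l l' : list_sum f (l ++ l') = list_sum f l + list_sum f l'.
Proof. induction l; simpl; [ring|rewrite IHl; ring]. Qed.

Lemma list_sum_le f l l' : (forall k, 0 <= f k) -> NoDup l -> incl l l' ->
  list_sum f l <= list_sum f l'.
Proof.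
  intros Hf. revert l'. induction l as [|a l IH]; intros l' ND IN.
  - simpl. clear IN. induction l'; simpl; [lra|]. specialize (Hf a). lra.
  - inversion ND as [|? ? Ha ND']; subst.
    destruct (in_split a l') as [u [v E]]; [apply IN; left; reflexivity|]. subst.
    specialize (IH (u ++ v) ND').
    assert (incl l (u ++ v)).
    { intros k Hk. specialize (IN k (or_intror Hk)). rewrite in_app_iff in *. simpl in IN.
      destruct IN as [?|[->|?]]; [auto|contradiction|auto]. }
    specialize (IH H). rewrite !list_sum_app in *. simpl. lra.
Qed.

Lemma rsum_list n f : rsum n f = list_sum f (seq 0 n).
Proof.
  induction n; [reflexivity|]. rewrite seq_S, list_sum_app. simpl. rewrite IHn. ring.
Qed.

Lemma list_sum_map f p l : list_sum f (map p l) = list_sum (fun k => f (p k)) l.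
Proof. induction l; simpl; [reflexivity|rewrite IHl; reflexivity]. Qed.

Lemma rsum_injective f p n : (forall k, 0 <= f k) -> (forall i j, p i = p j -> i = j) ->
  exists N, rsum n (fun k => f (p k)) <= rsum N f.
Proof.
  intros Hf Hp. exists (S (list_max (map p (seq 0 n)))).
  rewrite !rsum_list, <- list_sum_map. apply list_sum_le; [exact Hf| |].
  - apply NoDup_map_NoDup_ForallPairs; [|apply seq_NoDup]. intros i j _ _. apply Hp.
  - intros k Hk. apply in_seq. split; [lia|].
    assert (list_max (map p (seq 0 n)) <= list_max (map p (seq 0 n)))%nat as Hm by lia.
    rewrite list_max_le, Forall_forall in Hm. specialize (Hm k Hk). lia.
Qed.

Lemma l2_injective x p : l2 x -> (forall i j, p i = p j -> i = j) ->
  l2 (fun k => x (p k)) /\ nsq (fun k => x (p k)) <= nsq x.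
Proof.
  intros Hx Hp. apply l2_bound. intros n.
  destruct (rsum_injective (fun k => Cmod (x k) ^ 2) p n) as [N HN]; [auto|exact Hp|].
  eapply Rle_trans; [exact HN|apply l2_partial, Hx].
Qed.

(** A permutation of coordinates is unitary: neither [p] nor its inverse [q] increases the norm, and
    [q] gives surjectivity. *)
Lemma dtrace_permute tau z p q : is_trace tau -> weak_l1 z ->
  (forall k, p (q k) = k) -> (forall k, q (p k) = k) ->
  dtrace tau (fun k => z (p k)) = dtrace tau z.
Proof.
  intros [_ [_ HU]] Hz Hpq Hqp. unfold dtrace. f_equal.
  assert (Ip : forall i j, p i = p j -> i = j).
  { intros i j H. rewrite <- (Hqp i), <- (Hqp j), H. reflexivity. }
  assert (Iq : forall i j, q i = q j -> i = j).
  { intros i j H. rewrite <- (Hpq i), <- (Hpq j), H. reflexivity. }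
  assert (Nm : forall x, l2 x -> norm2 (fun k => x (p k)) = norm2 x).
  { intros x Hx. destruct (l2_injective x p Hx Ip) as [L1 N1].
    destruct (l2_injective _ q L1 Iq) as [_ N2].
    replace (fun k => x (p (q k))) with x in N2
      by (extensionality k'; rewrite Hpq; reflexivity).
    unfold norm2. f_equal. apply Rle_antisym; assumption. }
  apply (HU _ _ (fun x k => x (p k))); [apply L1inf_diag, Hz| |reflexivity].
  split; [|split].
  - split; [reflexivity|]. split.
    + intros x Hx. apply l2_injective; assumption.
    + exists 1. intros x Hx. rewrite Nm by exact Hx. lra.
  - exact Nm.
  - intros y Hy. exists (fun k => y (q k)). split; [apply l2_injective; assumption|].
    extensionality k. rewrite Hqp. reflexivity.
Qed.

(** * Dyadic block averages *)

Definition blk (k : nat) : nat := Nat.log2 (S k).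

Lemma blk_spec k : (2 ^ blk k <= S k < 2 * 2 ^ blk k)%nat.
Proof. pose proof (Nat.log2_spec (S k) ltac:(lia)). simpl in H. unfold blk. lia. Qed.

Lemma blk_unique n p : (p < 2 ^ n)%nat -> blk (2 ^ n - 1 + p) = n.
Proof.
  intros Hp. unfold blk. assert (2 ^ n <> 0)%nat by (apply Nat.pow_nonzero; lia).
  apply Nat.log2_unique; [lia|]. simpl. lia.
Qed.

(** Rotates block [n] cyclically by [s n] places: [N - 1] is the first index of the block of [k],
    and [S k - N] the position of [k] in it. *)
Definition shift (s : nat -> nat) (k : nat) : nat :=
  let N := (2 ^ blk k)%nat in (N - 1 + (S k - N + s (blk k)) mod N)%nat.

Lemma blk_shift s k : blk (shift s k) = blk k.
Proof.
  unfold shift. apply blk_unique. apply Nat.mod_upper_bound, Nat.pow_nonzero; lia.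
Qed.

Lemma shift_inverse s s' k : (forall n, (s n + s' n) mod 2 ^ n = 0)%nat ->
  shift s' (shift s k) = k.
Proof.
  intros H. unfold shift at 1. rewrite blk_shift. unfold shift.
  set (N := (2 ^ blk k)%nat). set (p := (S k - N)%nat).
  pose proof (blk_spec k) as B. fold N in B.
  assert (N <> 0)%nat by (apply Nat.pow_nonzero; lia).
  replace (S (N - 1 + (p + s (blk k)) mod N) - N)%nat with ((p + s (blk k)) mod N)%nat by lia.
  rewrite Nat.Div0.add_mod_idemp_l, <- Nat.add_assoc, <- Nat.Div0.add_mod_idemp_r, H.
  rewrite Nat.add_0_r, Nat.mod_small by (unfold p; lia). unfold p; lia.
Qed.

Lemma INR_two_pow n : INR (2 ^ n) = 2 ^ n.
Proof. rewrite pow_INR. simpl. f_equal. Qed.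

Lemma two_pow_pos n : 0 < 2 ^ n.
Proof. apply pow_lt; lra. Qed.

Lemma weak_l1_blk z c : (forall k, Rabs (z k) <= c / 2 ^ blk k) -> weak_l1 z.
Proof.
  intros H. exists (2 * c). intros k. eapply Rle_trans; [apply H|].
  assert (c0 : 0 <= c).
  { specialize (H 0%nat). cbn in H. pose proof (Rabs_pos (z 0%nat)). lra. }
  pose proof (blk_spec k) as [_ B]. apply Nat.lt_le_incl, le_INR in B.
  rewrite mult_INR, INR_two_pow in B. simpl (INR 2) in B. pose proof (two_pow_pos (blk k)).
  pose proof (INR_S_pos k).
  apply Rmult_le_reg_r with (INR (S k) * 2 ^ blk k); [nra|].
  replace (c / 2 ^ blk k * (INR (S k) * 2 ^ blk k)) with (c * INR (S k)) by (field; lra).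
  replace (2 * c / INR (S k) * (INR (S k) * 2 ^ blk k)) with (c * (2 * 2 ^ blk k)) by (field; lra).
  apply Rmult_le_compat_l; lra.
Qed.

Lemma weak_le_blk z c : (forall k, Rabs (z k) <= c / INR (S k)) ->
  forall k, Rabs (z k) <= c / 2 ^ blk k.
Proof.
  intros H k. eapply Rle_trans; [apply H|].
  pose proof (weak_l1_const z c H). apply Rmult_le_compat_l; [assumption|].
  apply Rinv_le_contravar; [apply two_pow_pos|]. rewrite <- INR_two_pow. apply le_INR, blk_spec.
Qed.

Definition bavg (y : nat -> R) (k : nat) : R :=
  / 2 ^ blk k * rsum (2 ^ blk k) (fun p => y (2 ^ blk k - 1 + p)%nat).

(* Rotation of block [n] by [j] times [2^(n-m)]; the step is truncated to [0] in the blocks [n < m]. *)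
Definition cyc (m j : nat) : nat -> nat := shift (fun n => j * (2 ^ n / 2 ^ m))%nat.

(** A mean of [2 ^ m] unitary conjugates, the same number for all blocks; averaging every block over
    all its rotations would take unboundedly many. *)
Definition cavg (m : nat) (y : nat -> R) (k : nat) : R :=
  / 2 ^ m * rsum (2 ^ m) (fun j => y (cyc m j k)).

Lemma cyc_inverse m j k : (j <= 2 ^ m)%nat -> cyc m (2 ^ m - j) (cyc m j k) = k.
Proof.
  intros Hj. apply shift_inverse. intros n.
  rewrite <- Nat.mul_add_distr_r. replace (j + (2 ^ m - j))%nat with (2 ^ m)%nat by lia.
  destruct (le_lt_dec m n) as [H|H].
  - replace (2 ^ n)%nat with (2 ^ (n - m) * 2 ^ m)%nat
      by (rewrite <- Nat.pow_add_r; f_equal; lia).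
    rewrite Nat.div_mul by (apply Nat.pow_nonzero; lia).
    rewrite Nat.mul_comm. apply Nat.Div0.mod_same.
  - rewrite Nat.div_small by (apply Nat.pow_lt_mono_r; lia).
    rewrite Nat.mul_0_r. apply Nat.Div0.mod_0_l.
Qed.

Lemma rsum_rotate M a g : (a < M)%nat -> rsum M (fun j => g ((a + j) mod M)%nat) = rsum M g.
Proof.
  intros Ha. replace (rsum M (fun j => g ((a + j) mod M)%nat))
    with (rsum ((M - a) + a) (fun j => g ((a + j) mod M)%nat)) by (f_equal; lia).
  rewrite rsum_add. replace (rsum M g) with (rsum (a + (M - a)) g) by (f_equal; lia).
  rewrite rsum_add. rewrite Rplus_comm. f_equal; apply rsum_ext; intros j Hj; f_equal.
  - replace (a + (M - a + j))%nat with (j + 1 * M)%nat by lia.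
    rewrite Nat.Div0.mod_add. apply Nat.mod_small. lia.
  - apply Nat.mod_small. lia.
Qed.

Lemma rsum_grid M L f : rsum (M * L) f = rsum M (fun j => rsum L (fun r => f (j * L + r)%nat)).
Proof.
  induction M; [reflexivity|]. simpl rsum. rewrite <- IHM.
  simpl Nat.mul. rewrite Nat.add_comm. apply rsum_add.
Qed.

Lemma rsum_telescope M (g : nat -> R) : rsum M g - rsum M (fun j => g (S j)) = g 0%nat - g M.
Proof. induction M; simpl; [ring|]. lra. Qed.

(** Cut the block into [M = 2^m] runs of length [L]. By monotonicity both sums over runs lie between
    [lo] and [hi], the sums of [y'] over the right and the left end points. Their difference
    telescopes to at most the first entry of the block, hence to [c / 2^n], and dividing by [M]
    gives the bound. *)
Lemma cavg_close m y c : (forall k, 0 <= y k) -> (forall k, y (S k) <= y k) ->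
  (forall k, y k <= c / INR (S k)) ->
  forall k, (m <= blk k)%nat -> Rabs (cavg m y k - bavg y k) <= c / 2 ^ m * / 2 ^ blk k.
Proof.
  intros H0 Hd Hc k Hk.
  pose proof (decr_le y Hd) as D.
  set (n := blk k) in *. set (M := (2 ^ m)%nat). set (L := (2 ^ (n - m))%nat).
  assert (M0 : M <> 0%nat) by (apply Nat.pow_nonzero; lia).
  assert (L0 : L <> 0%nat) by (apply Nat.pow_nonzero; lia).
  assert (EN : (2 ^ n = M * L)%nat).
  { unfold M, L. rewrite <- Nat.pow_add_r. f_equal. lia. }
  assert (EL : (2 ^ n / 2 ^ m = L)%nat).
  { rewrite EN. fold M. rewrite Nat.mul_comm, Nat.div_mul by exact M0. reflexivity. }
  set (y' := fun p => y (2 ^ n - 1 + p)%nat).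
  assert (D' : forall j i, (i <= j)%nat -> y' j <= y' i) by (intros; apply D; lia).
  set (p := (S k - 2 ^ n)%nat).
  assert (Hp : (p < M * L)%nat) by (unfold p; pose proof (blk_spec k); fold n in H; lia).
  set (a := (p / L)%nat). set (r := (p mod L)%nat).
  assert (Hr : (r < L)%nat) by (apply Nat.mod_upper_bound, L0).
  assert (Ep : p = (a * L + r)%nat) by (pose proof (Nat.div_mod_eq p L); unfold a, r; lia).
  assert (Ha : (a < M)%nat) by (apply Nat.Div0.div_lt_upper_bound; lia).
  set (lo := rsum M (fun j => y' (S j * L)%nat)). set (hi := rsum M (fun j => y' (j * L)%nat)).
  assert (HL : hi - lo <= c / 2 ^ n).
  { unfold hi, lo. rewrite (rsum_telescope M (fun j => y' (j * L)%nat)).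
    assert (0 <= y' (M * L)%nat) by apply H0.
    assert (y' (0 * L)%nat <= c / 2 ^ n); [|lra].
    unfold y'. eapply Rle_trans; [apply Hc|]. right. f_equal.
    rewrite <- INR_two_pow. f_equal. pose proof (Nat.pow_nonzero 2 n). lia. }
  (* With [p = a L + r], the rotations move position [p] to [((a + j) mod M) L + r], which visits
     every run once at the same offset [r]. *)
  assert (EC : cavg m y k = / INR M * rsum M (fun j => y' (j * L + r)%nat)).
  { unfold cavg. f_equal; [unfold M; rewrite INR_two_pow; reflexivity|].
    fold M. rewrite <- (rsum_rotate M a (fun j => y' (j * L + r)%nat) Ha).
    apply rsum_ext. intros j Hj. unfold y', cyc, shift. fold n. rewrite EL. fold p.
    f_equal. f_equal. rewrite EN, Ep.
    replace (a * L + r + j * L)%nat with (r + (a + j) * L)%nat by ring.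
    pose proof (Nat.div_mod_eq (a + j) M) as E.
    replace (r + (a + j) * L)%nat with ((a + j) mod M * L + r + ((a + j) / M) * (M * L))%nat by nia.
    rewrite Nat.Div0.mod_add. apply Nat.mod_small.
    pose proof (Nat.mod_upper_bound (a + j) M M0). nia. }
  assert (EB : bavg y k = / INR M * (/ INR L * rsum M (fun j => rsum L (fun q => y' (j * L + q)%nat)))).
  { unfold bavg. fold n. fold y'. rewrite EN, rsum_grid.
    rewrite <- INR_two_pow, EN, mult_INR. field. split; apply not_0_INR; assumption. }
  assert (PM : 0 < INR M) by (apply lt_0_INR; lia).
  assert (PL : 0 < INR L) by (apply lt_0_INR; lia).
  assert (B1 : lo <= rsum M (fun j => y' (j * L + r)%nat) <= hi).
  { split; apply rsum_le; intros j Hj; apply D'; lia. }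
  assert (B2 : lo <= / INR L * rsum M (fun j => rsum L (fun q => y' (j * L + q)%nat)) <= hi).
  { rewrite <- rsum_scal. split; apply rsum_le; intros j Hj;
    apply Rmult_le_reg_l with (INR L); try assumption;
    rewrite <- Rmult_assoc, Rinv_r, Rmult_1_l by lra; rewrite <- rsum_const; apply rsum_le;
    intros q Hq; apply D'; lia. }
  rewrite EC, EB, <- Rmult_minus_distr_l. apply Rabs_inv_mult_le; [exact PM|].
  replace (INR M * (c / 2 ^ m * / 2 ^ n)) with (c / 2 ^ n).
  2:{ unfold M. rewrite INR_two_pow. pose proof (two_pow_pos n); pose proof (two_pow_pos m). field; lra. }
  abs_lra.
Qed.

Lemma dtrace_rsum tau M (z : nat -> nat -> R) : is_trace tau ->
  (forall j, (j < M)%nat -> weak_l1 (z j)) ->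
  dtrace tau (fun k => rsum M (fun j => z j k)) = rsum M (fun j => dtrace tau (z j)).
Proof.
  intros HT. induction M; intros H; simpl.
  - pose proof (weak_l1_rsum 0 z ltac:(intros; lia)) as W. simpl in W.
    pose proof (dtrace_lin tau 0 (fun _ => 0) 0 (fun _ => 0) HT W W) as E.
    cbv beta in E. rewrite Rmult_0_l, Rplus_0_l in E. rewrite E. ring.
  - rewrite <- IHM by auto.
    rewrite <- (Rmult_1_l (dtrace tau (fun k => rsum M _))), <- (Rmult_1_l (dtrace tau (z M))).
    rewrite <- dtrace_lin by (auto using weak_l1_rsum). f_equal.
    extensionality k'; ring.
Qed.

Lemma weak_l1_cyc y m j : weak_l1 y -> weak_l1 (fun k => y (cyc m j k)).
Proof.
  intros [c Hc]. apply weak_l1_blk with c. intros k.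
  rewrite <- (blk_shift (fun n => j * (2 ^ n / 2 ^ m))%nat k).
  apply (weak_le_blk y c Hc (cyc m j k)).
Qed.

Lemma dtrace_scal tau a z : is_trace tau -> weak_l1 z ->
  dtrace tau (fun k => a * z k) = a * dtrace tau z.
Proof.
  intros HT Hz. pose proof (dtrace_lin tau a z 0 z HT Hz Hz) as E.
  rewrite Rmult_0_l, Rplus_0_r in E. rewrite <- E. f_equal.
  extensionality k'; ring.
Qed.

Lemma weak_l1_cavg y m : weak_l1 y -> weak_l1 (cavg m y).
Proof.
  intros Hy. apply (weak_l1_scal (/ 2 ^ m) (fun k => rsum (2 ^ m) (fun j => y (cyc m j k)))).
  apply (weak_l1_rsum _ (fun j k => y (cyc m j k))). intros; apply weak_l1_cyc, Hy.
Qed.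

Lemma dtrace_cavg tau y m : is_trace tau -> weak_l1 y -> dtrace tau (cavg m y) = dtrace tau y.
Proof.
  intros HT Hy. unfold cavg.
  rewrite (dtrace_scal tau _ (fun k => rsum (2 ^ m) (fun j => y (cyc m j k)))) by
    (auto; apply (weak_l1_rsum _ (fun j k => y (cyc m j k))); intros; apply weak_l1_cyc, Hy).
  rewrite (dtrace_rsum tau _ (fun j k => y (cyc m j k))) by (auto using weak_l1_cyc).
  rewrite (rsum_ext _ _ (fun _ => dtrace tau y)).
  - rewrite rsum_const, INR_two_pow. pose proof (two_pow_pos m). field. lra.
  - intros j Hj. apply (dtrace_permute tau y (cyc m j) (cyc m (2 ^ m - j)) HT Hy).
    + intros k. replace j with (2 ^ m - (2 ^ m - j))%nat at 1 by lia. apply cyc_inverse. lia.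
    + intros k. apply cyc_inverse. lia.
Qed.

Lemma bavg_bound y c : (forall k, Rabs (y k) <= c / INR (S k)) ->
  forall k, Rabs (bavg y k) <= c / 2 ^ blk k.
Proof.
  intros Hc k. unfold bavg. pose proof (two_pow_pos (blk k)).
  apply Rabs_inv_mult_le; [assumption|]. eapply Rle_trans; [apply rsum_abs|]. rewrite <- INR_two_pow at 1. rewrite <- rsum_const.
  apply rsum_le. intros p Hp. eapply Rle_trans; [apply (weak_le_blk y c Hc)|].
  rewrite blk_unique by assumption. lra.
Qed.

(** By monotonicity of the trace the two sides differ by at most [c / 2^m] times a fixed trace, for
    every [m]. *)
Lemma dtrace_block_average tau y c : is_trace tau -> trace_positive tau ->
  (forall m, dtrace tau (fun k => if lt_dec (blk k) m then 1 else 0) = 0) ->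
  (forall k, 0 <= y k) -> (forall k, y (S k) <= y k) -> (forall k, y k <= c / INR (S k)) ->
  dtrace tau y = dtrace tau (bavg y).
Proof.
  intros HT HP Hfin H0 Hd Hc.
  assert (Hc' : forall k, Rabs (y k) <= c / INR (S k)) by (intros; rewrite Rabs_pos_eq; auto).
  assert (Wy : weak_l1 y) by (exists c; exact Hc').
  assert (Wb : weak_l1 (bavg y)) by (eapply weak_l1_blk, bavg_bound, Hc').
  assert (c0 := weak_l1_const y c Hc').
  set (g := fun k => / 2 ^ blk k).
  assert (Wg : weak_l1 g).
  { apply weak_l1_blk with 1. intros k. unfold g. rewrite Rabs_pos_eq.
    - unfold Rdiv. lra.
    - left. apply Rinv_pos, two_pow_pos. }
  assert (g0 : forall k, 0 < g k) by (intros; apply Rinv_pos, two_pow_pos).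
  assert (Wf : forall m, weak_l1 (fun k => if lt_dec (blk k) m then 1 else 0)).
  { intros m. apply weak_l1_blk with (2 ^ m). intros k. destruct lt_dec as [H|H].
    - rewrite Rabs_R1. apply Rmult_le_reg_r with (2 ^ blk k); [apply two_pow_pos|].
      unfold Rdiv. rewrite Rmult_assoc, Rinv_l by (pose proof (two_pow_pos (blk k)); lra).
      rewrite Rmult_1_l, Rmult_1_r. apply Rle_pow; [lra|lia].
    - rewrite Rabs_R0. left. apply Rdiv_lt_0_compat; apply two_pow_pos. }
  assert (K : forall m, Rabs (dtrace tau y - dtrace tau (bavg y)) <= c / 2 ^ m * dtrace tau g).
  { intros m. rewrite <- (dtrace_cavg tau y m HT Wy).
    assert (Wc : weak_l1 (cavg m y)) by (apply weak_l1_cavg, Wy).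
    (* In the blocks before [m] the rotations are trivial and no averaging happens, so there the
       crude bound [2 * c] is used; [Hfin] removes it from the trace. *)
    set (h := fun k => c / 2 ^ m * g k + 2 * c * (if lt_dec (blk k) m then 1 else 0)).
    assert (Wh : weak_l1 h) by (apply weak_l1_lin; auto).
    assert (Eh : dtrace tau h = c / 2 ^ m * dtrace tau g).
    { unfold h. rewrite dtrace_lin, Hfin by auto. ring. }
    assert (CB : forall k, Rabs (cavg m y k - bavg y k) <= h k).
    { intros k. unfold h. destruct (lt_dec (blk k) m) as [H|H].
      - assert (B1 : Rabs (cavg m y k) <= c).
        { unfold cavg. pose proof (two_pow_pos m).
          apply Rabs_inv_mult_le; [assumption|]. eapply Rle_trans; [apply rsum_abs|]. rewrite <- INR_two_pow. rewrite <- rsum_const.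
          apply rsum_le. intros p Hp. apply (weak_le_const y c Hc'). }
        assert (B2 : Rabs (bavg y k) <= c).
        { eapply Rle_trans; [apply (bavg_bound y c Hc')|].
          apply Rmult_le_reg_r with (2 ^ blk k); [apply two_pow_pos|].
          unfold Rdiv. rewrite Rmult_assoc, Rinv_l by (pose proof (two_pow_pos (blk k)); lra).
          pose proof (pow_R1_Rle 2 (blk k) ltac:(lra)). nra. }
        assert (0 <= c / 2 ^ m * g k).
        { apply Rmult_le_pos; [|left; apply g0]. apply Rmult_le_pos; [exact c0|].
          left. apply Rinv_pos, two_pow_pos. }
        abs_lra.
      - eapply Rle_trans; [apply (cavg_close m y c); auto; lia|]. unfold g. lra. }
    rewrite <- Eh.
    assert (P : forall z w, weak_l1 z -> weak_l1 w -> (forall k, z k <= 1 * w k + 1 * h k) ->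
      dtrace tau z <= 1 * dtrace tau w + 1 * dtrace tau h).
    { intros z w Hz Hw H. rewrite <- dtrace_lin by assumption.
      apply dtrace_mono; auto using weak_l1_lin. }
    pose proof (P (cavg m y) (bavg y) Wc Wb ltac:(intros k; specialize (CB k); abs_lra)).
    pose proof (P (bavg y) (cavg m y) Wb Wc ltac:(intros k; specialize (CB k); abs_lra)).
    abs_lra. }
  apply (eq_of_close _ _ _ K).
  apply is_lim_seq_ext with (fun m => (c * dtrace tau g) * (/ 2) ^ m).
  - intros m. rewrite pow_inv. field. pose proof (two_pow_pos m). lra.
  - replace (Finite 0) with (Rbar_mult (c * dtrace tau g) 0) by (simpl; f_equal; ring).
    apply is_lim_seq_scal_l, is_lim_seq_geom. rewrite Rabs_pos_eq; lra.
Qed.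

(** * Asymptotics of the logarithmic Hardy operator *)

Definition stepf (b : nat -> R) (t : R) : R := b (Z.to_nat (Int_part t)).
Definition psum (b : nat -> R) (t : R) : R := RInt (stepf b) 0 t.
(* [avg_mu A] is convertible to [lavg (fun n => mu n A)]. *)
Definition lavg (b : nat -> R) (t : R) : R := / ln (1 + t) * psum b t.
Definition bsum (b : nat -> R) (n : nat) : R :=
  / ln 2 * rsum (2 ^ n) (fun p => b (2 ^ n - 1 + p)%nat).

Lemma ln2_pos : 0 < ln 2.
Proof. rewrite <- ln_1. apply ln_increasing; lra. Qed.

Lemma Int_part_nat n t : INR n <= t < INR n + 1 -> Z.to_nat (Int_part t) = n.
Proof.
  intros H. rewrite <- (Int_part_spec t (Z.of_nat n)); [apply Nat2Z.id|].
  rewrite <- INR_IZR_INZ. lra.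
Qed.

Lemma floor_nat t : 0 <= t -> INR (Z.to_nat (Int_part t)) <= t < INR (Z.to_nat (Int_part t)) + 1.
Proof.
  intros Ht. destruct (base_Int_part t) as [H1 H2].
  assert (0 <= Int_part t)%Z.
  { apply Z.lt_succ_r. apply lt_IZR. rewrite succ_IZR. lra. }
  rewrite INR_IZR_INZ, Z2Nat.id by assumption. lra.
Qed.

Lemma is_RInt_stepf_unit b n u v : INR n <= u -> u <= v -> v <= INR n + 1 ->
  is_RInt (stepf b) u v ((v - u) * b n).
Proof.
  intros H1 H2 H3. apply is_RInt_ext with (fun _ => b n); [|apply (is_RInt_const u v (b n))].
  intros x Hx. rewrite Rmin_left, Rmax_right in Hx by assumption.
  unfold stepf. rewrite (Int_part_nat n); [reflexivity|lra].
Qed.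

Lemma is_RInt_stepf_nat b n : is_RInt (stepf b) 0 (INR n) (rsum n b).
Proof.
  induction n.
  - simpl. apply (is_RInt_point (stepf b) 0).
  - simpl rsum. apply (is_RInt_Chasles (stepf b) 0 (INR n) (INR (S n)) (rsum n b) (b n) IHn).
    replace (b n) with ((INR (S n) - INR n) * b n) by (rewrite S_INR; ring).
    apply is_RInt_stepf_unit; rewrite ?S_INR; lra.
Qed.

Lemma psum_nat b n : psum b (INR n) = rsum n b.
Proof. apply is_RInt_unique, is_RInt_stepf_nat. Qed.

Lemma ex_RInt_stepf0 b t : 0 <= t -> ex_RInt (stepf b) 0 t.
Proof.
  intros Ht. pose proof (floor_nat t Ht) as F. set (n := Z.to_nat (Int_part t)) in *.
  apply ex_RInt_Chasles with (INR n).
  - eexists; apply is_RInt_stepf_nat.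
  - eexists; apply (is_RInt_stepf_unit b n); lra.
Qed.

Lemma ex_RInt_stepf b s t : 0 <= s -> 0 <= t -> ex_RInt (stepf b) s t.
Proof.
  intros Hs Ht. apply ex_RInt_Chasles with 0; [apply ex_RInt_swap|]; apply ex_RInt_stepf0; assumption.
Qed.

Lemma psum_diff b s t : 0 <= s -> 0 <= t -> psum b t - psum b s = RInt (stepf b) s t.
Proof.
  intros Hs Ht. unfold psum.
  rewrite <- (RInt_Chasles (stepf b) 0 s t) by auto using ex_RInt_stepf, Rle_refl.
  unfold plus; simpl. ring.
Qed.

Section Growth.
Variables (b : nat -> R) (c : R).
Hypothesis b0 : forall k, 0 <= b k.
Hypothesis bc : forall k, b k <= c / INR (S k).

Lemma growth_const : 0 <= c.
Proof. specialize (b0 0%nat). specialize (bc 0%nat). simpl in bc. lra. Qed.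

Lemma stepf_nonneg t : 0 <= stepf b t.
Proof. apply b0. Qed.

(** On [[n, n + 1)] one has [1 + t < n + 2 <= 2 (n + 1)], whence the factor 2. *)
Lemma stepf_le t : 0 <= t -> stepf b t <= 2 * c / (1 + t).
Proof.
  intros Ht. pose proof (floor_nat t Ht) as F. unfold stepf.
  set (n := Z.to_nat (Int_part t)) in *. eapply Rle_trans; [apply bc|].
  pose proof growth_const. pose proof (INR_S_pos n). rewrite S_INR in *.
  apply Rmult_le_reg_r with ((INR n + 1) * (1 + t)); [nra|].
  replace (c / (INR n + 1) * ((INR n + 1) * (1 + t))) with (c * (1 + t)) by (field; lra).
  replace (2 * c / (1 + t) * ((INR n + 1) * (1 + t))) with (c * (2 * (INR n + 1))) by (field; lra).
  apply Rmult_le_compat_l; [assumption|]. pose proof (pos_INR n). lra.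
Qed.

Lemma psum_mono s t : 0 <= s -> s <= t -> psum b s <= psum b t.
Proof.
  intros Hs Ht. assert (0 <= psum b t - psum b s); [|lra].
  rewrite psum_diff by lra. apply RInt_ge_0; [exact Ht|apply ex_RInt_stepf; lra|].
  intros. apply stepf_nonneg.
Qed.

Lemma psum_log_bound s t : 0 <= s -> s <= t -> psum b t - psum b s <= 2 * c * (ln (1 + t) - ln (1 + s)).
Proof.
  intros Hs Ht. rewrite psum_diff by lra.
  assert (HI : is_RInt (fun x => 2 * c / (1 + x)) s t (2 * c * (ln (1 + t) - ln (1 + s)))).
  { replace (2 * c * (ln (1 + t) - ln (1 + s)))
      with (minus (2 * c * ln (1 + t)) (2 * c * ln (1 + s)))
      by (unfold minus, plus, opp; simpl; ring).
    apply (is_RInt_derive (fun x => 2 * c * ln (1 + x))).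
    - intros x Hx. rewrite Rmin_left in Hx by exact Ht.
      auto_derive; [lra|]. field. lra.
    - intros x Hx. rewrite Rmin_left in Hx by exact Ht.
      apply (ex_derive_continuous (fun x => 2 * c / (1 + x))). auto_derive. lra. }
  rewrite <- (is_RInt_unique _ _ _ _ HI).
  apply RInt_le; [exact Ht|apply ex_RInt_stepf; lra|eexists; exact HI|].
  intros x Hx. apply stepf_le. lra.
Qed.

Lemma psum_0 : psum b 0 = 0.
Proof. apply (psum_nat b 0). Qed.

Lemma psum_nonneg t : 0 <= t -> 0 <= psum b t.
Proof. intros Ht. rewrite <- psum_0. apply psum_mono; lra. Qed.

(** Provides the continuity of [psum], from which the integrals against [ds/s] exist. *)
Lemma psum_lipschitz s t : 0 <= s -> 0 <= t -> Rabs (psum b t - psum b s) <= 2 * c * Rabs (t - s).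
Proof.
  assert (W : forall s t, 0 <= s -> s <= t -> Rabs (psum b t - psum b s) <= 2 * c * Rabs (t - s)).
  { intros u v Hu Hv. rewrite !Rabs_pos_eq by (pose proof (psum_mono u v Hu Hv); lra).
    eapply Rle_trans; [apply psum_log_bound; assumption|].
    pose proof growth_const. apply Rmult_le_compat_l; [lra|].
    rewrite <- ln_div by lra.
    pose proof (exp_ineq1_le (ln ((1 + v) / (1 + u)))) as E.
    rewrite exp_ln in E by (apply Rdiv_lt_0_compat; lra).
    assert ((1 + v) / (1 + u) <= 1 + (v - u)); [|lra].
    apply Rmult_le_reg_r with (1 + u); [lra|]. unfold Rdiv.
    rewrite Rmult_assoc, Rinv_l by lra. nra. }
  intros Hs Ht. destruct (Rle_dec s t) as [H|H]; [auto|].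
  rewrite Rabs_minus_sym, (Rabs_minus_sym t s). apply W; lra.
Qed.

Lemma continuous_psum z : 0 < z -> continuous (psum b) z.
Proof.
  intros Hz. apply filterlim_locally. intros eps.
  pose proof growth_const as c0. pose proof (cond_pos eps) as He.
  assert (Hd : 0 < Rmin z (eps / (2 * c + 1))).
  { apply Rmin_glb_lt; [exact Hz|]. apply Rdiv_lt_0_compat; lra. }
  exists (mkposreal _ Hd). intros y Hy. unfold ball in *; simpl in *.
  unfold AbsRing_ball, abs, minus, plus, opp in *; simpl in *.
  assert (H1 : Rabs (y + - z) < z) by (eapply Rlt_le_trans; [exact Hy|apply Rmin_l]).
  assert (H2 : Rabs (y + - z) < eps / (2 * c + 1)) by (eapply Rlt_le_trans; [exact Hy|apply Rmin_r]).
  apply Rabs_lt_between in H1.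
  eapply Rle_lt_trans; [apply (psum_lipschitz z y); lra|].
  apply Rle_lt_trans with ((2 * c) * (eps / (2 * c + 1))).
  - apply Rmult_le_compat_l; [lra|]. left; exact H2.
  - apply Rmult_lt_reg_r with (2 * c + 1); [lra|].
    replace (2 * c * (eps / (2 * c + 1)) * (2 * c + 1)) with (2 * c * eps) by (field; lra). nra.
Qed.

Lemma ln_1p_pos t : 0 < t -> 0 < ln (1 + t).
Proof. intros Ht. rewrite <- ln_1. apply ln_increasing; lra. Qed.

Lemma lavg_bound t : 0 < t -> 0 <= lavg b t <= 2 * c.
Proof.
  intros Ht. pose proof (ln_1p_pos t Ht) as L. pose proof (psum_nonneg t ltac:(lra)) as P.
  pose proof (psum_log_bound 0 t ltac:(lra) ltac:(lra)) as Q.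
  rewrite psum_0, Rplus_0_r, ln_1 in Q. unfold lavg. split.
  - apply Rmult_le_pos; [left; apply Rinv_pos, L|exact P].
  - apply Rmult_le_reg_l with (ln (1 + t)); [exact L|].
    rewrite <- Rmult_assoc, Rinv_r by lra. lra.
Qed.

Lemma continuous_lavg_div z : 0 < z -> continuous (fun s => lavg b s / s) z.
Proof.
  intros Hz. pose proof (ln_1p_pos z Hz).
  apply continuous_ext with (fun s => mult (psum b s) (/ ln (1 + s) * / s)).
  { intros s. unfold lavg, mult, Rdiv; simpl. ring. }
  apply (continuous_mult (K := R_AbsRing)); [apply continuous_psum, Hz|].
  apply (ex_derive_continuous (fun s => / ln (1 + s) * / s)). auto_derive.
  repeat split; lra.
Qed.

Lemma ex_RInt_lavg u v : 0 < u -> 0 < v -> ex_RInt (fun s => lavg b s / s) u v.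
Proof.
  intros Hu Hv. apply (ex_RInt_continuous (V := R_CompleteNormedModule)).
  intros z Hz. apply continuous_lavg_div.
  eapply Rlt_le_trans; [|apply Hz]. apply Rmin_glb_lt; assumption.
Qed.

Lemma is_RInt_const_div a u v : 0 < u -> u <= v ->
  is_RInt (fun s => a / s) u v (a * (ln v - ln u)).
Proof.
  intros Hu Hv.
  replace (a * (ln v - ln u)) with (minus (a * ln v) (a * ln u))
    by (unfold minus, plus, opp; simpl; ring).
  apply (is_RInt_derive (fun x => a * ln x)).
  - intros x Hx. rewrite Rmin_left in Hx by exact Hv. auto_derive; [lra|]. field. lra.
  - intros x Hx. rewrite Rmin_left in Hx by exact Hv.
    apply (ex_derive_continuous (fun x => a / x)). auto_derive. lra.
Qed.

Lemma RInt_lavg_close u v a k : 0 < u -> u <= v ->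
  (forall s, u < s < v -> Rabs (lavg b s - a) <= k) ->
  Rabs (RInt (fun s => lavg b s / s) u v - a * (ln v - ln u)) <= k * (ln v - ln u).
Proof.
  intros Hu Hv H.
  pose proof (is_RInt_const_div (a - k) u v Hu Hv) as I1.
  pose proof (is_RInt_const_div (a + k) u v Hu Hv) as I2.
  assert (B1 : RInt (fun s => (a - k) / s) u v <= RInt (fun s => lavg b s / s) u v).
  { apply RInt_le; [exact Hv|eexists; exact I1|apply ex_RInt_lavg; lra|].
    intros s Hs. specialize (H s Hs). apply Rabs_le_between in H.
    apply Rmult_le_compat_r; [left; apply Rinv_pos|]; lra. }
  assert (B2 : RInt (fun s => lavg b s / s) u v <= RInt (fun s => (a + k) / s) u v).
  { apply RInt_le; [exact Hv|apply ex_RInt_lavg; lra|eexists; exact I2|].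
    intros s Hs. specialize (H s Hs). apply Rabs_le_between in H.
    apply Rmult_le_compat_r; [left; apply Rinv_pos|]; lra. }
  rewrite (is_RInt_unique _ _ _ _ I1) in B1. rewrite (is_RInt_unique _ _ _ _ I2) in B2.
  abs_lra.
Qed.

Lemma rsum_blocks n f :
  rsum (2 ^ n - 1) f = rsum n (fun i => rsum (2 ^ i) (fun p => f (2 ^ i - 1 + p)%nat)).
Proof.
  induction n; [reflexivity|]. simpl rsum. rewrite <- IHn, <- rsum_add. f_equal.
  pose proof (Nat.pow_nonzero 2 n). simpl. lia.
Qed.

Lemma rsum_bsum n : rsum n (bsum b) = / ln 2 * rsum (2 ^ n - 1) b.
Proof. rewrite rsum_blocks. unfold bsum. apply rsum_scal. Qed.

Lemma bsum_bound n : 0 <= bsum b n <= c / ln 2.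
Proof.
  pose proof ln2_pos as L. unfold bsum. split.
  - apply Rmult_le_pos; [left; apply Rinv_pos, L|]. apply rsum_nonneg. auto.
  - unfold Rdiv. rewrite Rmult_comm. apply Rmult_le_compat_r; [left; apply Rinv_pos, L|].
    apply Rle_trans with (rsum (2 ^ n) (fun _ => c / 2 ^ n)).
    + apply rsum_le. intros p Hp. eapply Rle_trans; [apply bc|].
      rewrite <- INR_two_pow. pose proof (Nat.pow_nonzero 2 n).
      replace (2 ^ n)%nat with (S (2 ^ n - 1)) at 2 by lia.
      apply div_INR_decr; [apply growth_const|lia].
    + rewrite rsum_const, INR_two_pow. right. field. pose proof (two_pow_pos n). lra.
Qed.

Lemma Ces_rsum (x : nat -> R) n : Ces x n = rsum (S n) x / INR (S n).
Proof. unfold Ces. rewrite sum_n_rsum. reflexivity. Qed.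

Lemma Ces_abs_bound (x : nat -> R) M : (forall k, Rabs (x k) <= M) -> forall n, Rabs (Ces x n) <= M.
Proof.
  intros H n. rewrite Ces_rsum. pose proof (INR_S_pos n) as P.
  unfold Rdiv. rewrite Rmult_comm. apply Rabs_inv_mult_le; [exact P|].
  eapply Rle_trans; [apply rsum_abs|]. rewrite <- rsum_const.
  apply rsum_le. auto.
Qed.

Lemma ln_pow2 n : ln (2 ^ n) = INR n * ln 2.
Proof. apply ln_pow. lra. Qed.

Lemma ln_le_dyadic j x : 0 < x -> x <= 4 * 2 ^ j -> ln x <= (INR j + 2) * ln 2.
Proof.
  intros H0 H. replace ((INR j + 2) * ln 2) with (ln (2 ^ (j + 2))).
  - apply ln_le; [exact H0|]. rewrite pow_add. lra.
  - rewrite ln_pow2, plus_INR. simpl. ring.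
Qed.

(** The logarithm varies by at most [2 ln 2] on this range. The upper limit is [4 * 2^j] because
    [1 + s] may exceed [2^(j+1)] when [s] is at the end of [[2^j, 2^(j+1)]]. *)
Lemma psum_dyadic_close j s t : 0 <= s -> 0 <= t ->
  2 ^ j <= 1 + s <= 4 * 2 ^ j -> 2 ^ j <= 1 + t <= 4 * 2 ^ j ->
  Rabs (psum b t - psum b s) <= 4 * c * ln 2.
Proof.
  assert (W : forall s t, 0 <= s -> s <= t -> 2 ^ j <= 1 + s -> 1 + t <= 4 * 2 ^ j ->
    Rabs (psum b t - psum b s) <= 4 * c * ln 2).
  { intros u v Hu Hv H1 H2. pose proof (psum_mono u v Hu Hv).
    rewrite Rabs_pos_eq by lra. eapply Rle_trans; [apply psum_log_bound; assumption|].
    pose proof (two_pow_pos j) as P.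
    assert (L1 : INR j * ln 2 <= ln (1 + u)) by (rewrite <- ln_pow2; apply ln_le; lra).
    pose proof (ln_le_dyadic j (1 + v) ltac:(lra) H2) as L2.
    pose proof growth_const. nra. }
  intros Hs Ht [H1 H2] [H3 H4]. destruct (Rle_dec s t) as [H|H]; [apply W; assumption|].
  rewrite Rabs_minus_sym. apply W; lra.
Qed.

(** Between [s] and [2^(j+1) - 1] the integral moves by at most [4 c ln 2 <= 4 c], and replacing
    [(j + 1) ln 2] by [ln (1 + s)] costs at most [c]. *)
Lemma lavg_close j s : 2 ^ j <= s <= 2 ^ S j ->
  Rabs (lavg b s - Ces (bsum b) j) <= 10 * c / ln 2 / INR (S j).
Proof.
  intros [H1 H2]. simpl in H2.
  pose proof ln2_pos as L2. pose proof growth_const as c0.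
  pose proof (pow_R1_Rle 2 j ltac:(lra)) as P1.
  set (C0 := Ces (bsum b) j).
  (* At [2^(j+1) - 1] the blocks up to [j] are complete, so the integral is exactly [(j + 1) ln 2]
     times the Cesaro mean. *)
  assert (EC : psum b (INR (2 ^ S j - 1)) = C0 * (INR (S j) * ln 2)).
  { rewrite psum_nat. unfold C0. rewrite Ces_rsum, rsum_bsum. field.
    pose proof (INR_S_pos j). split; lra. }
  assert (BC : Rabs C0 <= c / ln 2).
  { apply Ces_abs_bound. intros k. rewrite Rabs_pos_eq; apply bsum_bound. }
  assert (EI : INR (2 ^ S j - 1) = 2 * 2 ^ j - 1).
  { pose proof (Nat.pow_nonzero 2 (S j)). rewrite minus_INR by lia. rewrite INR_two_pow. simpl. ring. }
  assert (D1 : Rabs (psum b s - psum b (INR (2 ^ S j - 1))) <= 4 * c * ln 2).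
  { apply (psum_dyadic_close j); rewrite ?EI; lra. }
  assert (LL : INR j * ln 2 <= ln (1 + s)) by (rewrite <- ln_pow2; apply ln_le; lra).
  assert (LL2 : ln 2 <= ln (1 + s)) by (apply ln_le; lra).
  pose proof (ln_le_dyadic j (1 + s) ltac:(lra) ltac:(lra)) as LU.
  pose proof (INR_S_pos j) as PS. rewrite S_INR in *.
  assert (D2 : Rabs ((INR j + 1) * ln 2 - ln (1 + s)) <= ln 2) by (abs_lra).
  assert (D3 : Rabs (psum b s - C0 * ln (1 + s)) <= 5 * c).
  { replace (psum b s - C0 * ln (1 + s)) with
      ((psum b s - psum b (INR (2 ^ S j - 1))) + C0 * ((INR j + 1) * ln 2 - ln (1 + s)))
      by (rewrite EC; ring).
    eapply Rle_trans; [apply Rabs_triang|]. rewrite Rabs_mult.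
    assert (Rabs C0 * Rabs ((INR j + 1) * ln 2 - ln (1 + s)) <= c).
    { replace c with (c / ln 2 * ln 2) by (field; lra).
      apply Rmult_le_compat; auto using Rabs_pos. }
    assert (ln 2 <= 1).
    { pose proof (exp_ineq1_le (ln 2)) as E. rewrite exp_ln in E by lra. lra. }
    nra. }
  assert (LP : 0 < ln (1 + s)) by lra.
  replace (lavg b s - C0) with (/ ln (1 + s) * (psum b s - C0 * ln (1 + s)))
    by (unfold lavg; field; lra).
  apply Rabs_inv_mult_le; [exact LP|]. eapply Rle_trans; [exact D3|].
  (* [ln (1 + s)] is at least [j ln 2] and at least [ln 2], hence at least their average; this
     doubles [5 c] to [10 c]. *)
  apply Rle_trans with (((INR j + 1) / 2 * ln 2) * (10 * c / ln 2 / (INR j + 1))).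
  - right. field. lra.
  - apply Rmult_le_compat_r; [|lra].
    apply Rmult_le_pos; [apply Rmult_le_pos; [lra|]|]; left; apply Rinv_pos; lra.
Qed.

Definition harm (n : nat) : R := / INR (S n).

(** Each interval [[2^j, 2^(j+1)]] has mass [ln 2] for [ds/s], so the integral becomes a sum. The
    errors [10 c / (j + 1)] add up to a harmonic sum, which is negligible after division by
    [ln t]. *)
Lemma RInt_lavg_dyadic n :
  Rabs (RInt (fun s => lavg b s / s) 1 (2 ^ n) - ln 2 * rsum n (Ces (bsum b)))
  <= 10 * c * rsum n harm.
Proof.
  pose proof ln2_pos as L2.
  induction n.
  - simpl. rewrite RInt_point. unfold zero; simpl. rewrite Rmult_0_r, Rminus_0_r, Rabs_R0. lra.
  - pose proof (two_pow_pos n) as P.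
    rewrite <- (RInt_Chasles (fun s => lavg b s / s) 1 (2 ^ n) (2 ^ S n))
      by (apply ex_RInt_lavg; try lra; apply two_pow_pos).
    pose proof (RInt_lavg_close (2 ^ n) (2 ^ S n) (Ces (bsum b) n) (10 * c / ln 2 / INR (S n))
      P ltac:(simpl; lra) (fun s Hs => lavg_close n s ltac:(lra))) as D.
    rewrite !ln_pow2, S_INR in D.
    replace ((INR n + 1) * ln 2 - INR n * ln 2) with (ln 2) in D by ring.
    replace (10 * c / ln 2 / (INR n + 1) * ln 2) with (10 * c * harm n) in D
      by (unfold harm; rewrite S_INR; field; pose proof (pos_INR n); lra).
    simpl rsum. unfold plus; simpl (_ + _).
    apply Rabs_le_between in D. apply Rabs_le_between in IHn. apply Rabs_le_between.
    unfold plus; simpl. simpl in D. lra.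
Qed.

(** Up to the errors of the dyadic intervals, the integral minus [Y ln t] equals
    [(C0 - Y) (ln t - (n + 1) ln 2)]. Each of the two products is at most [c], whence the term
    [2 c]. *)
Lemma Mop_lavg_close n t : (1 <= n)%nat -> 2 ^ n <= t <= 2 ^ S n ->
  Rabs (Mop (lavg b) t - Ces (Ces (bsum b)) n)
  <= 2 * (10 * c / ln 2 * Ces harm n + 2 * c / ln 2 / INR (S n)).
Proof.
  intros Hn [H1 H2].
  pose proof ln2_pos as L2. pose proof growth_const as c0.
  pose proof (two_pow_pos n) as P.
  assert (P1 : 2 <= 2 ^ n).
  { replace 2 with (2 ^ 1) at 1 by ring. apply Rle_pow; [lra|lia]. }
  unfold Mop. destruct (Rlt_dec 1 t) as [_|F]; [|lra].
  set (I := RInt (fun s => lavg b s / s) 1 t).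
  set (C0 := Ces (bsum b) n). set (Y := Ces (Ces (bsum b)) n).
  assert (BX : forall k, Rabs (bsum b k) <= c / ln 2).
  { intros k. rewrite Rabs_pos_eq; apply bsum_bound. }
  assert (BC : Rabs C0 <= c / ln 2) by (apply Ces_abs_bound, BX).
  assert (BY : Rabs Y <= c / ln 2) by (apply Ces_abs_bound; intros; apply Ces_abs_bound, BX).
  assert (LL : INR n * ln 2 <= ln t) by (rewrite <- ln_pow2; apply ln_le; lra).
  assert (LU : ln t <= (INR n + 1) * ln 2).
  { rewrite <- S_INR, <- ln_pow2. apply ln_le; lra. }
  pose proof (RInt_lavg_dyadic n) as D1.
  pose proof (RInt_lavg_close (2 ^ n) t C0 (10 * c / ln 2 / INR (S n)) P H1
    (fun s Hs => lavg_close n s ltac:(lra))) as D2.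
  rewrite ln_pow2 in D2.
  assert (EI : I = RInt (fun s => lavg b s / s) 1 (2 ^ n) + RInt (fun s => lavg b s / s) (2 ^ n) t).
  { unfold I. rewrite <- (RInt_Chasles (fun s => lavg b s / s) 1 (2 ^ n) t);
      [reflexivity| |]; apply ex_RInt_lavg; lra. }
  assert (EY : rsum n (Ces (bsum b)) + C0 = INR (S n) * Y).
  { unfold Y. rewrite (Ces_rsum (Ces (bsum b))). simpl rsum. fold C0. field.
    apply not_0_INR; lia. }
  assert (N1 : 1 <= INR n) by (replace 1 with (INR 1) by reflexivity; apply le_INR, Hn).
  rewrite S_INR in *.
  assert (D : forall z, Rabs z <= c / ln 2 -> Rabs (z * (ln t - (INR n + 1) * ln 2)) <= c).
  { intros z Hz. rewrite Rabs_mult. replace c with (c / ln 2 * ln 2) by (field; lra).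
    apply Rmult_le_compat; auto using Rabs_pos. abs_lra. }
  pose proof (D C0 BC) as D3. pose proof (D Y BY) as D4.
  assert (D5 : 10 * c / ln 2 / (INR n + 1) * (ln t - INR n * ln 2) <= 10 * c * harm n).
  { unfold harm. rewrite S_INR. apply Rle_trans with (10 * c / ln 2 / (INR n + 1) * ln 2).
    - apply Rmult_le_compat_l; [|lra].
      apply Rmult_le_pos; [apply Rmult_le_pos; [lra|]|]; left; apply Rinv_pos; lra.
    - right. field. lra. }
  set (H := rsum n harm + harm n).
  assert (D6 : Rabs (I - Y * ln t) <= 10 * c * H + 2 * c).
  { unfold H. apply Rabs_le_between in D1. apply Rabs_le_between in D2.
    apply Rabs_le_between in D3. apply Rabs_le_between in D4. apply Rabs_le_between.
    assert (E2 : ln 2 * rsum n (Ces (bsum b)) = ln 2 * ((INR n + 1) * Y - C0)) by (rewrite <- EY; ring).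
    rewrite E2 in D1. rewrite EI. lra. }
  assert (EH : Ces harm n = H / (INR n + 1)).
  { rewrite Ces_rsum, S_INR. reflexivity. }
  rewrite EH.
  assert (H0 : 0 <= H).
  { unfold H. assert (Hh : forall k, 0 <= harm k) by (intros; left; apply Rinv_pos, INR_S_pos).
    pose proof (rsum_nonneg n harm (fun k _ => Hh k)). pose proof (Hh n). lra. }
  assert (LP : 0 < ln t) by nra.
  replace (/ ln t * I - Y) with (/ ln t * (I - Y * ln t)) by (field; lra).
  apply Rabs_inv_mult_le; [exact LP|]. eapply Rle_trans; [exact D6|].
  (* For [n >= 1], [ln t >= n ln 2 >= (n + 1) / 2 * ln 2]; this is the origin of the leading factor
     2. *)
  apply Rle_trans with (((INR n + 1) / 2 * ln 2) *
    (2 * (10 * c / ln 2 * (H / (INR n + 1)) + 2 * c / ln 2 / (INR n + 1)))).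
  - right. field. lra.
  - apply Rmult_le_compat_r; [|nra].
    replace (2 * (10 * c / ln 2 * (H / (INR n + 1)) + 2 * c / ln 2 / (INR n + 1)))
      with ((20 * (c * H) + 4 * c) * / (ln 2 * (INR n + 1))) by (field; lra).
    apply Rmult_le_pos; [nra|]. left. apply Rinv_pos. nra.
Qed.

End Growth.

Lemma Ces_lim (x : nat -> R) (l : R) : is_lim_seq x l -> is_lim_seq (Ces x) l.
Proof.
  intros H. apply is_lim_seq_Reals in H. apply Cesaro_1 in H.
  apply is_lim_seq_Reals in H. apply is_lim_seq_incr_1 in H.
  eapply is_lim_seq_ext; [|exact H]. intros n. simpl pred.
  unfold Ces. rewrite sum_n_Reals. reflexivity.
Qed.

Lemma is_lim_seq_lin (x y : nat -> R) (a b lx ly : R) : is_lim_seq x lx -> is_lim_seq y ly ->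
  is_lim_seq (fun n => a * x n + b * y n) (a * lx + b * ly).
Proof.
  intros Hx Hy. apply is_lim_seq_plus'.
  - exact (is_lim_seq_scal_l x a lx Hx).
  - exact (is_lim_seq_scal_l y b ly Hy).
Qed.

Lemma Mop_lavg_asymptotic b c : (forall k, 0 <= b k) -> (forall k, b k <= c / INR (S k)) ->
  exists err : nat -> R, is_lim_seq err 0 /\
    forall n t, (1 <= n)%nat -> 2 ^ n <= t <= 2 ^ S n ->
      Rabs (Mop (lavg b) t - Ces (Ces (bsum b)) n) <= err n.
Proof.
  intros b0 bc. eexists. split; [|intros n t; apply (Mop_lavg_close b c b0 bc)].
  assert (Lh : is_lim_seq harm 0).
  { eapply is_lim_seq_ext; [|apply (is_lim_div_INR 1)]. intros n. unfold harm, Rdiv. ring. }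
  pose proof (is_lim_seq_lin _ _ (10 * c / ln 2) 1 _ _ (Ces_lim _ _ Lh)
    (is_lim_div_INR (2 * c / ln 2))) as L.
  pose proof (is_lim_seq_lin _ _ 2 0 _ _ L L) as L'.
  replace (2 * (10 * c / ln 2 * 0 + 1 * 0) + 0 * (10 * c / ln 2 * 0 + 1 * 0)) with 0 in L' by ring.
  eapply is_lim_seq_ext; [|exact L']. intros n. cbv beta. ring.
Qed.

(** * Logarithmic sums under shifts of the index *)

(** The map [k - k / p] repeats a value each time [k + 1] reaches a multiple [p (j + 1)]. The
    surplus term [b (k - j)] has [k - j + 1 >= (p - 1) (j + 1)], so the surplus is a harmonic sum
    with the factor [c / (p - 1)]. *)
Lemma rsum_compress p N (b : nat -> R) c : (2 <= p)%nat -> (forall k, b k <= c / INR (S k)) ->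
  0 <= c ->
  rsum N (fun k => b (k - k / p)%nat)
  <= rsum (N - N / p) b + c / INR (p - 1) * rsum (N / p) harm.
Proof.
  intros Hp bc c0. induction N.
  - simpl. rewrite Nat.Div0.div_0_l. simpl. lra.
  - pose proof (Nat.Div0.div_le_mono N (S N) p ltac:(lia)) as M1.
    assert (D : N = (p * (N / p) + N mod p)%nat) by apply Nat.div_mod_eq.
    assert (D' : S N = (p * (S N / p) + S N mod p)%nat) by apply Nat.div_mod_eq.
    pose proof (Nat.mod_upper_bound N p ltac:(lia)).
    pose proof (Nat.mod_upper_bound (S N) p ltac:(lia)).
    set (j := (N / p)%nat) in *. set (j' := (S N / p)%nat) in *.
    assert (j <= N)%nat by nia.
    destruct (Nat.eq_dec j' j) as [E|E].
    + rewrite E. replace (S N - j)%nat with (S (N - j)) by lia. simpl rsum. fold j. lra.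
    + assert (j' = S j) by nia.
      rewrite H2. replace (S N - S j)%nat with (N - j)%nat by lia. simpl rsum. fold j.
      assert (b (N - j)%nat <= c / INR (p - 1) * harm j); [|lra].
      eapply Rle_trans; [apply bc|]. unfold harm.
      assert (EN : (S N = p * S j)%nat) by nia.
      assert ((p - 1) * S j <= S (N - j))%nat by nia.
      apply le_INR in H3. rewrite mult_INR in H3.
      pose proof (INR_S_pos j). pose proof (lt_0_INR (p - 1) ltac:(lia)).
      unfold Rdiv. rewrite Rmult_assoc, <- Rinv_mult.
      apply Rmult_le_compat_l; [exact c0|]. apply Rinv_le_contravar; [nra|exact H3].
Qed.

Lemma rsum_harm_mono n m : (n <= m)%nat -> rsum n harm <= rsum m harm.
Proof. apply rsum_mono. intros. left. apply Rinv_pos, INR_S_pos. Qed.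

Lemma rsum_harm_dyadic n : rsum (2 ^ n - 1) harm <= INR n.
Proof.
  rewrite rsum_blocks. rewrite <- (Rmult_1_r (INR n)), <- rsum_const. apply rsum_le. intros i Hi.
  apply Rle_trans with (rsum (2 ^ i) (fun _ => / 2 ^ i)).
  - apply rsum_le. intros p Hp. unfold harm. apply Rinv_le_contravar; [apply two_pow_pos|].
    rewrite <- INR_two_pow. apply le_INR. pose proof (Nat.pow_nonzero 2 i). lia.
  - rewrite rsum_const, INR_two_pow. right. field. pose proof (two_pow_pos i). lra.
Qed.

(** The hypothesis is used at [k = (k - k / p) + k / p]: most of the index goes to [b], and the
    share [k / p] makes the perturbation at most [d p / (k + 1)]. Over [2^n - 1] terms both losses
    are multiples of a harmonic sum, which is at most [n]. *)
Lemma rsum_fan_compare p n (a b : nat -> R) c d : (2 <= p)%nat ->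
  (forall k, 0 <= b k) -> (forall k, b k <= c / INR (S k)) -> 0 <= d ->
  (forall k m, a (k + m)%nat <= b k + d / INR (S m)) ->
  rsum (2 ^ n - 1) a <= rsum (2 ^ n - 1) b + (c / INR (p - 1) + d * INR p) * INR n.
Proof.
  intros Hp b0 bc d0 H. set (N := (2 ^ n - 1)%nat).
  assert (c0 : 0 <= c) by (specialize (b0 0%nat); specialize (bc 0%nat); simpl in bc; lra).
  pose proof (lt_0_INR (p - 1) ltac:(lia)) as Pp1. pose proof (lt_0_INR p ltac:(lia)) as Pp.
  assert (HN := rsum_harm_dyadic n). fold N in HN.
  apply Rle_trans with (rsum N (fun k => b (k - k / p)%nat + d * INR p * harm k)).
  - apply rsum_le. intros k Hk.
    assert (E : (k = p * (k / p) + k mod p)%nat) by apply Nat.div_mod_eq.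
    pose proof (Nat.mod_upper_bound k p ltac:(lia)).
    replace (a k) with (a ((k - k / p) + k / p)%nat) by (f_equal; nia).
    eapply Rle_trans; [apply H|]. apply Rplus_le_compat_l. unfold harm, Rdiv.
    rewrite Rmult_assoc. apply Rmult_le_compat_l; [exact d0|].
    assert (S k <= p * S (k / p))%nat by nia.
    apply le_INR in H1. rewrite mult_INR in H1.
    pose proof (INR_S_pos k). pose proof (INR_S_pos (k / p)).
    apply Rmult_le_reg_r with (INR (S k) * INR (S (k / p))); [nra|].
    replace (/ INR (S (k / p)) * (INR (S k) * INR (S (k / p)))) with (INR (S k)) by (field; lra).
    replace (INR p * / INR (S k) * (INR (S k) * INR (S (k / p))))
      with (INR p * INR (S (k / p))) by (field; lra). exact H1.
  - rewrite rsum_plus, rsum_scal.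
    pose proof (rsum_compress p N b c Hp bc c0) as C1.
    pose proof (rsum_mono (N - N / p) N b b0 ltac:(lia)) as C2.
    pose proof (rsum_harm_mono (N / p) N) as C3.
    assert (N / p <= N)%nat by (apply Nat.Div0.div_le_upper_bound; nia).
    specialize (C3 H0).
    assert (0 <= c / INR (p - 1)) by (apply Rmult_le_pos; [exact c0|left; apply Rinv_pos, Pp1]).
    assert (0 <= d * INR p) by nra.
    assert (c / INR (p - 1) * rsum (N / p) harm <= c / INR (p - 1) * INR n)
      by (apply Rmult_le_compat_l; lra).
    assert (d * INR p * rsum N harm <= d * INR p * INR n) by (apply Rmult_le_compat_l; lra).
    lra.
Qed.

(** * Measurability and null sets *)

Definition Rreal : reals.Real.type := Rstruct.RbaseSymbolsImpl_R__canonical__reals_Real.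
Local Notation borelSR := (lebesgue_stieltjes_measure.Real_sort__canonical__measurable_structure_SemiRingOfSets Rreal).
Local Notation borelSigma := (lebesgue_stieltjes_measure.Real_sort__canonical__measurable_structure_SigmaRing Rreal).
Local Notation borelM := (lebesgue_stieltjes_measure.Real_sort__canonical__measurable_structure_Measurable Rreal).
Local Notation RrealField := (reals.Real.Exports.reals_Real__to__Num_RealField Rreal).

Definition borel (A : R -> Prop) : Prop :=
  @measurable_structure.measurable _
    borelSR A.

Lemma set_ext (T : Type) (A B : T -> Prop) : (forall t, A t <-> B t) -> A = B.
Proof.
  intros H. extensionality t. apply propositional_extensionality, H.
Qed.

Lemma borel_inter A B : borel A -> borel B -> borel (fun t => A t /\ B t).
Proof.
  exact (@measurable_structure.measurableI _
    borelSR A B).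
Qed.

Lemma borel_bigcup (F : nat -> R -> Prop) :
  (forall i, borel (F i)) -> borel (fun t => exists i, F i t).
Proof.
  intros H.
  replace (fun t => exists i, F i t) with (classical_sets.bigcup classical_sets.setT F).
  - apply (@measurable_structure.bigcup_measurable _
      borelSigma F).
    intros i _. apply H.
  - apply set_ext. intros t. split.
    + intros [i _ Hi]. exists i. exact Hi.
    + intros [i Hi]. exists i; [exact I|exact Hi].
Qed.

Lemma leR_le (s t : R) : is_true (@preorder.Order.le orderedzmod.ring_display
  Rstruct.RbaseSymbolsImpl_R__canonical__Order_Preorder s t) <-> s <= t.
Proof.
  destruct (@Rstruct.RleP s t) as [K|K]; split; intros H; try assumption; try reflexivity.
  - discriminate.
  - contradiction.
Qed.

Lemma ltR_lt (s t : R) : is_true (@preorder.Order.lt orderedzmod.ring_display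
  Rstruct.RbaseSymbolsImpl_R__canonical__Order_Preorder s t) <-> s < t.
Proof.
  destruct (@Rstruct.RltP s t) as [K|K]; split; intros H; try assumption; try reflexivity.
  - discriminate.
  - contradiction.
Qed.

Lemma borel_interval (A : R -> Prop) :
  (forall x y z, A x -> A y -> x <= z <= y -> A z) -> borel A.
Proof.
  intros H. apply (@measurable_realfun.is_interval_measurable Rreal A).
  intros x y Hx Hy z Hz. apply Bool.andb_true_iff in Hz. destruct Hz as [H1 H2].
  apply (H x y z Hx Hy). split; apply leR_le; assumption.
Qed.

Lemma borel_full : borel (fun _ => True).
Proof. apply borel_interval. auto. Qed.

Definition borel_fun (g : R -> R) : Prop := forall Y, borel Y -> borel (fun t => Y (g t)).

Lemma borel_fun_iff g : borel_fun g <->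
  @measurable_function.measurable_fun _ _
    borelSigma
    borelSigma
    classical_sets.setT g.
Proof.
  split.
  - intros H _ Y HY. exact (borel_inter (fun _ => True) _ borel_full (H Y HY)).
  - intros H Y HY. specialize (H borel_full Y HY).
    replace (fun t => Y (g t))
      with (classical_sets.setI classical_sets.setT (classical_sets.preimage g Y)); [exact H|].
    apply set_ext. intros t. split; [intros [_ K]; exact K|intros K; split; [exact I|exact K]].
Qed.

Lemma borel_fun_mono g : (forall s t, s <= t -> g s <= g t) -> borel_fun g.
Proof.
  intros H. apply borel_fun_iff.
  apply (@measurable_realfun.nondecreasing_measurable Rreal); [exact borel_full|].
  intros s t Hst. apply leR_le, H, leR_le, Hst.
Qed.

Lemma borel_fun_mult g h : borel_fun g -> borel_fun h -> borel_fun (fun t => g t * h t).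
Proof.
  intros Hg Hh. apply borel_fun_iff.
  exact (@measurable_realfun.measurable_funM _
    borelM
    Rreal classical_sets.setT g h (proj1 (borel_fun_iff g) Hg) (proj1 (borel_fun_iff h) Hh)).
Qed.

Lemma borel_fun_const c : borel_fun (fun _ => c).
Proof. apply borel_fun_mono. intros; lra. Qed.

Definition lebesgueR :=
  lebesgue_measure.lebesgue_measure_lebesgue_measure__canonical__measure_function_Content Rreal.

Lemma lnull_empty (A : R -> Prop) : (forall t, ~ A t) -> lnull A.
Proof.
  intros H. replace A with (fun _ : R => False).
  - exact (@measure_negligible.negligible_set0 _ _ RrealField lebesgueR).
  - apply set_ext. intros t. split; [contradiction|apply H].
Qed.

Lemma lnull_sub (A B : R -> Prop) : (forall t, A t -> B t) -> lnull B -> lnull A.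
Proof.
  intros H HB.
  exact (@measure_negligible.negligibleS _ _ RrealField lebesgueR B A H HB).
Qed.

Lemma lnull_union (A B : R -> Prop) : lnull A -> lnull B -> lnull (fun t => A t \/ B t).
Proof.
  intros HA HB.
  exact (@measure_negligible.negligibleU _
    (@measurable_structure.measurable_structure_g_sigma_algebraType__canonical__measurable_structure_RingOfSets
       (lebesgue_stieltjes_measure.lebesgue_stieltjes_measure_ocitv_type__canonical__classical_sets_Pointed Rreal) _)
    RrealField lebesgueR A B HA HB).
Qed.

Lemma Linf_intro f M : (forall Y, borel Y -> borel (fun t => 0 < t /\ Y (f t))) ->
  (forall t, 0 < t -> Rabs (f t) <= M) -> Linf f.
Proof.
  intros H HM. split.
  - intros _ Y HY. exact (H Y HY).
  - exists M. apply lnull_empty. intros t [Ht1 Ht2]. specialize (HM t Ht1). lra.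
Qed.

Lemma Linf_lin a f b g : Linf f -> Linf g -> Linf (fun t => a * f t + b * g t).
Proof.
  intros [Mf [K HK]] [Mg [L HL]]. split.
  - apply (@measurable_realfun.measurable_funD _
      borelM
      Rreal posR (fun t => a * f t) (fun t => b * g t)).
    + apply (@measurable_realfun.measurable_funM _
        borelM
        Rreal posR (fun _ => a) f); [apply measurable_function.measurable_cst|exact Mf].
    + apply (@measurable_realfun.measurable_funM _
        borelM
        Rreal posR (fun _ => b) g); [apply measurable_function.measurable_cst|exact Mg].
  - exists (Rabs a * K + Rabs b * L).
    apply (lnull_sub _ (fun t => (0 < t /\ K < Rabs (f t)) \/ (0 < t /\ L < Rabs (g t))));
      [|apply lnull_union; assumption].
    intros t [Ht1 Ht2]. apply NNPP. intros HN.
    apply (Rlt_not_le _ _ Ht2). eapply Rle_trans; [apply Rabs_triang|]. rewrite !Rabs_mult.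
    pose proof (Rabs_pos a); pose proof (Rabs_pos b).
    assert (Rabs (f t) <= K) by (apply Rnot_lt_le; intros F; apply HN; auto).
    assert (Rabs (g t) <= L) by (apply Rnot_lt_le; intros F; apply HN; auto). nra.
Qed.

Lemma not_lnull_interval a b : a < b -> ~ lnull (fun t => a <= t <= b).
Proof.
  intros Hab HN.
  set (i := interval.Interval (interval.BSide true a) (interval.BSide false b)
    : interval.interval (reals.Real.sort Rreal)).
  set (S0 := fun t : R => is_true (@ssrbool.in_mem R t (@ssrbool.mem R
    (@interval.itvPredType orderedzmod.ring_display
       (reals.Real.Exports.reals_Real__to__Order_POrder Rreal)) i))).
  assert (Hi : forall t : R, S0 t -> a <= t <= b).
  { intros t Ht. unfold S0 in Ht.
    pose proof (@interval.in_itv orderedzmod.ring_display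
      (reals.Real.Exports.reals_Real__to__Order_POrder Rreal) t i) as E.
    assert (Ht' := eq_trans (eq_sym E) Ht). simpl in Ht'.
    apply Bool.andb_true_iff in Ht'. destruct Ht' as [H1 H2].
    split; apply leR_le; assumption. }
  assert (N0 : lnull S0) by (apply (lnull_sub _ _ Hi HN)).
  assert (Z0 := @measure_negligible.measure_negligible _ _
    RrealField lebesgueR S0
    (@lebesgue_stieltjes_measure.measurable_itv Rreal i) N0).
  assert (V := @lebesgue_measure.lebesgue_measure_itv Rreal i).
  assert (W := eq_trans (eq_sym Z0) V).
  clear - W Hab.
  assert (E : is_true (@preorder.Order.lt constructive_ereal.ereal_display
           (@constructive_ereal.constructive_ereal_extended__canonical__Order_Preorder
              (reals.Real.Exports.reals_Real__to__Num_NumDomain Rreal))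
           (constructive_ereal.EFin a) (constructive_ereal.EFin b)))
    by exact (proj2 (ltR_lt a b) Hab).
  unfold is_true in E. simpl in W.
  rewrite E in W.
  assert (Q : constructive_ereal.EFin 0 = constructive_ereal.EFin (b - a)) by exact W.
  injection Q. lra.
Qed.

(** The conull subsets of the interval generate a proper filter because an interval of positive
    length is not null. *)
Lemma ultra_interval a b : a < b ->
  exists V, ultra V /\ forall N : R -> Prop, lnull N -> V (fun t => a <= t <= b /\ ~ N t).
Proof.
  intros Hab.
  destruct (ultra_exists R (fun P => exists N, lnull N /\ forall t, a <= t <= b -> ~ N t -> P t))
    as [V [HV HF]].
  - exists (fun _ => False). split; [apply lnull_empty; auto|auto].
  - intros P Q [N [HN H1]] [N' [HN' H2]]. exists (fun t => N t \/ N' t).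
    split; [apply lnull_union; assumption|]. intros t Ht H. split; [apply H1|apply H2]; tauto.
  - intros P Q H [N [HN H1]]. exists N. auto.
  - intros P [N [HN H1]]. apply NNPP. intros HE. apply (not_lnull_interval a b Hab).
    apply lnull_sub with N; [|exact HN]. intros t Ht. apply NNPP. intros Hnt.
    apply HE. exists t. apply H1; assumption.
  - exists V. split; [exact HV|]. intros N HN. apply HF. exists N. auto.
Qed.

(** Each [g i] is Borel on the whole line and agrees with [f] on its piece only, so a function with
    a singularity can be handled by extending it differently on each piece. *)
Lemma borel_pieces f (E : nat -> R -> Prop) (g : nat -> R -> R) :
  (forall i, borel (E i)) -> (forall i, borel_fun (g i)) ->
  (forall t, 0 < t <-> exists i, E i t) -> (forall i t, E i t -> f t = g i t) ->
  forall Y, borel Y -> borel (fun t => 0 < t /\ Y (f t)).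
Proof.
  intros HE Hg HU Hf Y HY.
  replace (fun t => 0 < t /\ Y (f t)) with (fun t => exists i, E i t /\ Y (g i t)).
  - apply borel_bigcup. intros i. apply borel_inter; [apply HE|apply Hg, HY].
  - apply set_ext. intros t. split.
    + intros [i [H1 H2]]. split; [apply HU; exists i; exact H1|]. rewrite (Hf i t H1). exact H2.
    + intros [H1 H2]. apply HU in H1. destruct H1 as [i Hi]. exists i.
      split; [exact Hi|]. rewrite <- (Hf i t Hi). exact H2.
Qed.

Lemma Linf_stepf z : bounded_seq z -> Linf (stepf z).
Proof.
  intros [M HM]. apply Linf_intro with M; [|intros; apply HM].
  apply borel_pieces with (fun i t => 0 < t /\ INR i <= t < INR i + 1) (fun i _ => z i).
  - intros i. apply borel_interval. intros; lra.
  - intros i. apply borel_fun_const.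
  - intros t. split.
    + intros Ht. exists (Z.to_nat (Int_part t)). split; [exact Ht|apply floor_nat; lra].
    + intros [i [Hi _]]. exact Hi.
  - intros i t [_ Ht]. unfold stepf. rewrite (Int_part_nat i t Ht). reflexivity.
Qed.

(** Measurability comes from monotonicity: the integral from 1 is nondecreasing since [lavg b >= 0],
    and [1 / ln] is nonincreasing. The pieces [t > 1 + 1 / (n + 1)] avoid the pole at 1, and [Rmax]
    extends both factors monotonically to the line. *)
Lemma Linf_Mop_lavg b c : (forall k, 0 <= b k) -> (forall k, b k <= c / INR (S k)) ->
  Linf (Mop (lavg b)).
Proof.
  intros b0 bc. pose proof (growth_const b c b0 bc) as c0.
  apply Linf_intro with (2 * c).
  - set (G := fun t => RInt (fun s => lavg b s / s) 1 (Rmax 1 t)).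
    set (L := fun n t => / ln (Rmax (1 + / INR (S n)) t)).
    assert (P : forall n, 0 < / INR (S n)) by (intros; apply Rinv_pos, INR_S_pos).
    apply borel_pieces with
      (fun i t => match i with O => 0 < t <= 1 | S n => 1 + / INR (S n) < t end)
      (fun i t => match i with O => 0 | S n => L n t * G t end).
    + intros [|n]; apply borel_interval; intros; lra.
    + intros [|n]; [apply borel_fun_const|]. apply borel_fun_mult.
      * intros Y HY.
        (* [borel_fun_mono] concerns nondecreasing functions; the two signs carry it over to the
           nonincreasing [L n]. *)
        assert (H : borel_fun (fun t => -1 * (-1 * L n t))).
        { apply borel_fun_mult; [apply borel_fun_const|]. apply borel_fun_mono. intros s t Hst.
          unfold L. assert (/ ln (Rmax (1 + / INR (S n)) t) <= / ln (Rmax (1 + / INR (S n)) s)); [|lra].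
          pose proof (Rmax_l (1 + / INR (S n)) s). specialize (P n).
          apply Rinv_le_contravar.
          - rewrite <- ln_1. apply ln_increasing; lra.
          - apply ln_le; [lra|]. apply Rle_max_compat_l, Hst. }
        specialize (H Y HY). replace (fun t => Y (L n t)) with (fun t => Y (-1 * (-1 * L n t)));
          [exact H|]. extensionality t. f_equal. ring.
      * apply borel_fun_mono. intros s t Hst. unfold G.
        pose proof (Rmax_l 1 s). pose proof (Rle_max_compat_l s t 1 Hst).
        rewrite <- (RInt_Chasles (fun s => lavg b s / s) 1 (Rmax 1 s) (Rmax 1 t))
          by (apply (ex_RInt_lavg b c); auto; lra).
        assert (0 <= RInt (fun s => lavg b s / s) (Rmax 1 s) (Rmax 1 t)).
        { apply RInt_ge_0; [assumption|apply (ex_RInt_lavg b c); auto; lra|].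
          intros x Hx. apply Rmult_le_pos; [apply (lavg_bound b c); auto; lra|].
          left. apply Rinv_pos. lra. }
        unfold plus; simpl. lra.
    + intros t. split.
      * intros Ht. destruct (Rle_dec t 1) as [H|H]; [exists 0%nat; lra|].
        destruct (INR_unbounded (/ (t - 1))) as [n Hn]. exists (S n).
        assert (I1 : 0 < / (t - 1)) by (apply Rinv_pos; lra).
        assert (/ INR (S n) < t - 1); [|lra].
        rewrite <- (Rinv_inv (t - 1)). apply Rinv_lt_contravar.
        -- apply Rmult_lt_0_compat; [exact I1|apply INR_S_pos].
        -- rewrite S_INR. lra.
      * intros [[|n] Hn]; [lra|]. specialize (P n). lra.
    + intros [|n] t Ht; unfold Mop.
      * destruct Rlt_dec; [lra|reflexivity].
      * specialize (P n). destruct Rlt_dec; [|lra]. unfold L, G.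
        rewrite !Rmax_right by lra. reflexivity.
  - intros t Ht. unfold Mop. destruct Rlt_dec as [H|H]; [|rewrite Rabs_R0; lra].
    assert (LP : 0 < ln t) by (rewrite <- ln_1; apply ln_increasing; lra).
    (* [lavg b] takes values in [[0, 2 c]], the interval of centre [c] and radius [c]. *)
    pose proof (RInt_lavg_close b c b0 bc 1 t c c ltac:(lra) ltac:(lra)) as D.
    rewrite ln_1, Rminus_0_r in D.
    assert (D' := D ltac:(intros s Hs; pose proof (lavg_bound b c b0 bc s ltac:(lra));
      abs_lra)).
    apply Rabs_le_between in D'.
    apply Rabs_inv_mult_le; [exact LP|]. abs_lra.
Qed.

(** * Extended limits *)

Lemma bounded_seq_lin a x b y : bounded_seq x -> bounded_seq y ->
  bounded_seq (fun n => a * x n + b * y n).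
Proof.
  intros [M HM] [N HN]. exists (Rabs a * M + Rabs b * N). intros n.
  eapply Rle_trans; [apply Rabs_triang|]. rewrite !Rabs_mult.
  pose proof (Rabs_pos a); pose proof (Rabs_pos b). specialize (HM n); specialize (HN n). nra.
Qed.

Lemma bounded_seq_scal a x : bounded_seq x -> bounded_seq (fun n => a * x n).
Proof.
  intros [M HM]. exists (Rabs a * M). intros n. rewrite Rabs_mult.
  apply Rmult_le_compat_l; [apply Rabs_pos|apply HM].
Qed.

Lemma ext_lin theta a x b y : ext_limit_seq theta -> bounded_seq x -> bounded_seq y ->
  theta (fun n => a * x n + b * y n) = a * theta x + b * theta y.
Proof.
  intros [HA [HS _]] Hx Hy.
  rewrite (HA (fun n => a * x n) (fun n => b * y n)) by auto using bounded_seq_scal.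
  rewrite !HS by assumption. reflexivity.
Qed.

Lemma ext_const theta c : ext_limit_seq theta -> theta (fun _ => c) = c.
Proof. intros [_ [_ [_ H]]]. apply H, is_lim_seq_const. Qed.

Lemma bounded_seq_const c : bounded_seq (fun _ => c).
Proof. exists (Rabs c). intros; lra. Qed.

Lemma ext_close theta x y eps : ext_limit_seq theta -> bounded_seq x -> bounded_seq y ->
  (forall n, Rabs (x n - y n) <= eps) -> Rabs (theta x - theta y) <= eps.
Proof.
  intros HT Hx Hy H. pose proof (bounded_seq_const eps) as He.
  pose proof (bounded_seq_lin 1 x (-1) y Hx Hy) as Hd.
  pose proof HT as [_ [_ [HP _]]].
  pose proof (HP _ (bounded_seq_lin 1 _ 1 _ He Hd)) as P1.
  pose proof (HP _ (bounded_seq_lin 1 _ (-1) _ He Hd)) as P2.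
  rewrite ext_lin, ext_lin, ext_const in P1, P2 by assumption.
  apply Rabs_le_between. split.
  - enough (0 <= 1 * eps + 1 * (1 * theta x + -1 * theta y)) by lra. apply P1.
    intros n. specialize (H n). abs_lra.
  - enough (0 <= 1 * eps + -1 * (1 * theta x + -1 * theta y)) by lra. apply P2.
    intros n. specialize (H n). abs_lra.
Qed.

Lemma ext_asymptotic theta x y err : ext_limit_seq theta -> bounded_seq x -> bounded_seq y ->
  is_lim_seq err 0 -> (forall n, (1 <= n)%nat -> Rabs (x n - y n) <= err n) -> theta x = theta y.
Proof.
  intros HT Hx Hy He H.
  assert (L : is_lim_seq (fun n => 1 * x n + -1 * y n) 0).
  { apply is_lim_seq_abs_0.
    apply (is_lim_seq_le_le_loc (fun _ => 0) _ err); [|apply is_lim_seq_const|exact He].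
    exists 1%nat. intros n Hn. split; [apply Rabs_pos|].
    replace (1 * x n + -1 * y n) with (x n - y n) by ring. apply H, Hn. }
  pose proof HT as [_ [_ [_ HL]]]. apply HL in L. rewrite ext_lin in L by assumption. lra.
Qed.

Lemma bounded_Ces x : bounded_seq x -> bounded_seq (Ces x).
Proof. intros [M HM]. exists M. apply Ces_abs_bound, HM. Qed.

Lemma Ces_lin a x b y n : Ces (fun k => a * x k + b * y k) n = a * Ces x n + b * Ces y n.
Proof. rewrite !Ces_rsum, rsum_plus, !rsum_scal. unfold Rdiv. ring. Qed.

Lemma Ces2_lin a x b y : Ces (Ces (fun k => a * x k + b * y k)) =
  fun n => a * Ces (Ces x) n + b * Ces (Ces y) n.
Proof.
  extensionality n. rewrite <- Ces_lin. f_equal.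
  extensionality k. apply Ces_lin.
Qed.

Lemma bounded_bsum b c : (forall k, 0 <= b k) -> (forall k, b k <= c / INR (S k)) ->
  bounded_seq (bsum b).
Proof.
  intros b0 bc. exists (c / ln 2). intros n. pose proof (bsum_bound b c b0 bc n).
  rewrite Rabs_pos_eq; lra.
Qed.

Lemma Dseq_bsum b : Dseq (bsum b) = bavg b.
Proof.
  extensionality k. unfold Dseq, bsum, bavg, blk.
  pose proof ln2_pos. pose proof (two_pow_pos (Nat.log2 (S k))). field. lra.
Qed.

Lemma bsum_Dseq x : bsum (Dseq x) = x.
Proof.
  extensionality n. unfold bsum.
  rewrite (rsum_ext _ _ (fun _ => ln 2 * x n / 2 ^ n)).
  - rewrite rsum_const, INR_two_pow. pose proof ln2_pos. pose proof (two_pow_pos n). field. lra.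
  - intros p Hp. unfold Dseq. fold (blk (2 ^ n - 1 + p)). rewrite blk_unique by assumption.
    reflexivity.
Qed.

Lemma weak_l1_Dseq x : bounded_seq x -> weak_l1 (Dseq x).
Proof.
  intros [M HM]. apply weak_l1_blk with (ln 2 * M). intros k. unfold Dseq, Rdiv. fold (blk k).
  pose proof ln2_pos. pose proof (Rinv_pos _ (two_pow_pos (blk k))).
  rewrite !Rabs_mult, (Rabs_pos_eq (ln 2)), (Rabs_pos_eq (/ _)) by lra.
  apply Rmult_le_compat_r; [lra|]. apply Rmult_le_compat_l; [lra|apply HM].
Qed.

Lemma tau_Dseq_lin tau a x b y : is_trace tau -> bounded_seq x -> bounded_seq y ->
  tau (diag (Dseq (fun n => a * x n + b * y n))) =
  (RtoC a * tau (diag (Dseq x)) + RtoC b * tau (diag (Dseq y)))%C.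
Proof.
  intros HT Hx Hy. rewrite <- tau_diag_lin by auto using weak_l1_Dseq. f_equal. f_equal.
  extensionality k. unfold Dseq, Rdiv. ring.
Qed.

(** * From Connes-Dixmier traces to double Cesaro means *)

(* This makes [Dseq x] its own sequence of singular values; an affine change of variable brings
   any bounded sequence into the range [1, 2]. *)
Lemma Dseq_decr x k : (forall n, 1 <= x n <= 2) -> Dseq x (S k) <= Dseq x k.
Proof.
  intros H. unfold Dseq. pose proof ln2_pos as L.
  destruct (Nat.log2_succ_or (S k)) as [E|E]; rewrite E; [|lra].
  set (n := Nat.log2 (S k)). pose proof (two_pow_pos n).
  pose proof (H n); pose proof (H (S n)). simpl pow.
  replace (ln 2 * x (S n) / (2 * 2 ^ n)) with (ln 2 * (x (S n) / 2) / 2 ^ n) by (field; lra).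
  apply Rmult_le_compat_r; [left; apply Rinv_pos; assumption|].
  apply Rmult_le_compat_l; lra.
Qed.

(** Going through the integer part of [t] makes this a [stepf], hence measurable; on [(0, 1)] the
    value is [y 0] because [Nat.log2 0 = 0]. *)
Definition dyadic_step (y : nat -> R) : R -> R := stepf (fun k => y (Nat.log2 k)).

Lemma dyadic_step_eq y t n : 2 ^ n <= t < 2 ^ S n -> dyadic_step y t = y n.
Proof.
  intros [H1 H2]. unfold dyadic_step, stepf. f_equal.
  pose proof (two_pow_pos n). pose proof (floor_nat t ltac:(lra)) as [F1 F2].
  set (m := Z.to_nat (Int_part t)) in *.
  apply Nat.log2_unique; [lia|]. split.
  - apply Nat.lt_succ_r, INR_lt. rewrite INR_two_pow, S_INR. lra.
  - apply INR_lt. rewrite INR_two_pow. lra.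
Qed.

Lemma dyadic_cover t : 1 <= t -> exists n, 2 ^ n <= t < 2 ^ S n.
Proof.
  intros Ht. pose proof (floor_nat t ltac:(lra)) as [F1 F2].
  set (m := Z.to_nat (Int_part t)) in *.
  assert (Hm : (0 < m)%nat) by (apply INR_lt; simpl; lra || (simpl; lra)).
  pose proof (Nat.log2_spec m Hm) as [G1 G2]. exists (Nat.log2 m). split.
  - apply le_INR in G1. rewrite INR_two_pow in G1. lra.
  - apply le_INR in G2. rewrite S_INR, INR_two_pow in G2. lra.
Qed.

Lemma is_lim_dyadic f (u : nat -> R) l : is_lim_seq u 0 ->
  (forall n t, (1 <= n)%nat -> 2 ^ n <= t < 2 ^ S n -> Rabs (f t - l) <= u n) ->
  is_lim f p_infty l.
Proof.
  intros Hu Hf. apply is_lim_spec. intros eps. apply is_lim_seq_spec in Hu.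
  destruct (Hu eps) as [N HN]. exists (2 ^ (S N)). intros t Ht.
  pose proof (pow_R1_Rle 2 (S N) ltac:(lra)).
  destruct (dyadic_cover t ltac:(lra)) as [n Hn].
  assert (S N <= n)%nat.
  { apply Nat.lt_succ_r. apply INR_lt. apply Rmult_lt_reg_r with (ln 2); [apply ln2_pos|].
    rewrite <- !ln_pow2. apply ln_increasing; [apply two_pow_pos|lra]. }
  eapply Rle_lt_trans; [apply (Hf n t); [lia|exact Hn]|].
  specialize (HN n ltac:(lia)). rewrite Rminus_0_r in HN. pose proof (Rle_abs (u n)). lra.
Qed.

Lemma bounded_of_lim y (l : R) : is_lim_seq y l -> bounded_seq y.
Proof.
  intros H. apply is_lim_seq_Reals in H.
  destruct (maj_by_pos y (exist _ l H)) as [M [_ HM]]. exists M. exact HM.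
Qed.

Lemma Linf_dyadic_step y : bounded_seq y -> Linf (dyadic_step y).
Proof. intros [M HM]. apply Linf_stepf. exists M. auto. Qed.

Lemma ext_limit_dyadic gamma : ext_limit_fun gamma ->
  ext_limit_seq (fun y => gamma (dyadic_step y)).
Proof.
  intros [HA [HS [HP HL]]]. split; [|split; [|split]].
  - intros x y Hx Hy. apply (HA (dyadic_step x) (dyadic_step y)); apply Linf_dyadic_step; assumption.
  - intros c x Hx. apply (HS c (dyadic_step x)), Linf_dyadic_step, Hx.
  - intros x Hx H0. apply HP; [apply Linf_dyadic_step, Hx|].
    apply lnull_empty. intros t [_ Ht]. unfold dyadic_step, stepf in Ht.
    specialize (H0 (Nat.log2 (Z.to_nat (Int_part t)))). lra.
  - intros x l Hx. apply HL; [apply Linf_dyadic_step; eapply bounded_of_lim, Hx|].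
    apply is_lim_dyadic with (fun n => Rabs (x n - l)).
    + apply (proj1 (is_lim_seq_abs_0 (fun n => x n - l))). replace 0 with (l - l) by ring.
      apply is_lim_seq_minus'; [exact Hx|apply is_lim_seq_const].
    + intros n t _ Ht. rewrite (dyadic_step_eq x t n Ht). lra.
Qed.

(** The two functions differ by one that tends to 0 at infinity. Additivity of [gamma] holds on
    [Linf], so both must be known to be measurable. *)
Lemma gamma_Mop_lavg gamma b c : ext_limit_fun gamma ->
  (forall k, 0 <= b k) -> (forall k, b k <= c / INR (S k)) ->
  gamma (Mop (lavg b)) = gamma (dyadic_step (Ces (Ces (bsum b)))).
Proof.
  intros HG b0 bc. pose proof HG as [HA [HS [_ HL]]].
  set (y := Ces (Ces (bsum b))).
  assert (Hy : bounded_seq y) by (apply bounded_Ces, bounded_Ces, (bounded_bsum b c); assumption).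
  pose proof (Linf_dyadic_step y Hy) as L1. pose proof (Linf_Mop_lavg b c b0 bc) as L2.
  pose proof (Linf_lin 1 _ (-1) _ L2 L1) as L3.
  destruct (Mop_lavg_asymptotic b c b0 bc) as [err [He Hc]].
  assert (Z0 : gamma (fun t => 1 * Mop (lavg b) t + -1 * dyadic_step y t) = 0).
  { apply HL; [exact L3|]. apply is_lim_dyadic with err; [exact He|].
    intros n t Hn Ht. rewrite (dyadic_step_eq y t n Ht).
    replace (1 * Mop (lavg b) t + -1 * y n - 0) with (Mop (lavg b) t - y n) by ring.
    apply Hc; [exact Hn|lra]. }
  replace (Mop (lavg b)) with
    (fun t => (1 * Mop (lavg b) t + -1 * dyadic_step y t) + dyadic_step y t)
    by (extensionality k'; ring).
  rewrite HA, Z0 by assumption. ring.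
Qed.

Lemma double_cesaro_of_connes_dixmier tau : is_trace tau -> connes_dixmier tau ->
  exists theta, ext_limit_seq theta /\
    forall x, bounded_seq x -> tau (diag (Dseq x)) = RtoC (theta (Ces (Ces x))).
Proof.
  intros HT [gamma [HG Hg]]. set (theta := fun y => gamma (dyadic_step y)).
  assert (Hth : ext_limit_seq theta) by (apply ext_limit_dyadic, HG).
  exists theta. split; [exact Hth|].
  (* For such [x] the singular values of [diag (Dseq x)] are [Dseq x] itself, and [bsum] recovers
     [x] from them. *)
  assert (K : forall x, (forall n, 1 <= x n <= 2) -> tau (diag (Dseq x)) = RtoC (theta (Ces (Ces x)))).
  { intros x Hx. assert (Bx : bounded_seq x).
    { exists 2. intros n. specialize (Hx n). abs_lra. }
    pose proof (weak_l1_Dseq x Bx) as W. destruct W as [c Hc].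
    assert (D0 : forall k, 0 <= Dseq x k).
    { intros k. unfold Dseq, Rdiv. pose proof ln2_pos.
      pose proof (Rinv_pos _ (two_pow_pos (Nat.log2 (S k)))).
      specialize (Hx (Nat.log2 (S k))). apply Rmult_le_pos; [apply Rmult_le_pos|]; lra. }
    assert (Dc : forall k, Dseq x k <= c / INR (S k)).
    { intros k. eapply Rle_trans; [apply Rle_abs|apply Hc]. }
    assert (Em : (fun n => mu n (diag (Dseq x))) = Dseq x).
    { extensionality n. apply mu_diag; [exact D0|].
      intros k. apply Dseq_decr, Hx. }
    destruct (weak_l1_bounded _ (weak_l1_Dseq x Bx)) as [M HM].
    rewrite Hg; [|apply L1inf_diag, weak_l1_Dseq, Bx|apply (positive_diag _ M); assumption].
    change (avg_mu (diag (Dseq x))) with (lavg (fun n => mu n (diag (Dseq x)))).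
    rewrite Em, (gamma_Mop_lavg gamma _ c HG D0 Dc), bsum_Dseq. reflexivity. }
  intros x Hx. assert (Hx' := Hx). destruct Hx' as [M HM].
  set (N := Rabs M + 1). assert (HN : 0 < N) by (unfold N; pose proof (Rabs_pos M); lra).
  assert (BN : forall n, Rabs (x n) <= N).
  { intros n. specialize (HM n). unfold N. pose proof (Rle_abs M). lra. }
  (* [|x n| <= N] puts [x'] in [[1, 2]], and [x = 2 N x' - 3 N]; the constant 1 lies in the same
     range, so [K] covers both terms. *)
  set (x' := fun n => 3 / 2 + x n / (2 * N)).
  assert (H' : forall n, 1 <= x' n <= 2).
  { intros n. specialize (BN n). apply Rabs_le_between in BN. unfold x'.
    assert (- / 2 <= x n / (2 * N) <= / 2); [|lra].
    split; apply Rmult_le_reg_r with (2 * N); try lra; unfold Rdiv;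
    rewrite Rmult_assoc, Rinv_l by lra; lra. }
  assert (Bx' : bounded_seq x').
  { exists 2. intros n. specialize (H' n). abs_lra. }
  set (one := fun _ : nat => 1).
  assert (B1 : bounded_seq one) by apply bounded_seq_const.
  replace x with (fun n => (2 * N) * x' n + (- 3 * N) * one n).
  2:{ extensionality n. unfold x', one. field. lra. }
  rewrite tau_Dseq_lin, Ces2_lin, ext_lin by auto using bounded_Ces.
  rewrite (K x' H'), (K one) by (intros; unfold one; lra).
  rewrite RtoC_plus, !RtoC_mult. reflexivity.
Qed.

(** * From double Cesaro means to Connes-Dixmier traces *)

Lemma L1inf_bound A : L1inf A -> exists c, 0 <= c /\ forall n, mu n A <= c / INR (S n).
Proof.
  intros [[HA _] [c Hc]]. exists c. split.
  - specialize (Hc 0%nat). simpl in Hc. pose proof (mu_nonneg 0 A HA). lra.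
  - intros n. specialize (Hc n). pose proof (INR_S_pos n).
    apply Rmult_le_reg_l with (INR (S n)); [assumption|].
    replace (INR (S n) * (c / INR (S n))) with c by (field; lra). exact Hc.
Qed.

Lemma tau_injective tau theta A : is_trace tau -> trace_positive tau -> ext_limit_seq theta ->
  (forall x, bounded_seq x -> tau (diag (Dseq x)) = RtoC (theta (Ces (Ces x)))) ->
  L1inf A -> positive_op A -> (forall x, l2 x -> A x = vzero -> x = vzero) ->
  tau A = RtoC (theta (Ces (Ces (bsum (fun n => mu n A))))).
Proof.
  intros HT HP Hth HD HL Hpos HI. pose proof HL as [[HA _] _].
  destruct (L1inf_bound A HL) as [c [c0 Hc]].
  set (b := fun n => mu n A) in *.
  assert (b0 : forall k, 0 <= b k) by (intros; apply mu_nonneg, HA).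
  assert (bd : forall k, b (S k) <= b k) by (intros; apply mu_decr; [exact HA|lia]).
  assert (Wb : weak_l1 b).
  { exists c. intros k. rewrite Rabs_pos_eq by apply b0. apply Hc. }
  rewrite (trace_diagonalize tau A HT HL Hpos HI). fold b.
  rewrite (dtrace_real tau b HT HP Wb).
  rewrite (dtrace_block_average tau b c HT HP); [|clear b b0 bd Wb Hc|assumption..].
  - unfold dtrace. rewrite <- Dseq_bsum, HD; [reflexivity|].
    apply (bounded_bsum b c b0 Hc).
  (* The indicator of the first [m] blocks is [Dseq] of a finitely supported sequence, and the
     double Cesaro mean of the latter tends to 0. Thus the formula for [B] itself shows that the
     trace ignores these blocks. *)
  - intros m. set (x := fun n => if lt_dec n m then / ln 2 * 2 ^ n else 0).
    assert (Lx : is_lim_seq x 0).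
    { apply is_lim_seq_ext_loc with (fun _ => 0); [|apply is_lim_seq_const].
      exists m. intros n Hn. unfold x. destruct lt_dec; [lia|reflexivity]. }
    replace (fun k => if lt_dec (blk k) m then 1 else 0) with (Dseq x).
    + unfold dtrace. rewrite HD by (eapply bounded_of_lim, Lx).
      destruct Hth as [_ [_ [_ HLim]]]. rewrite (HLim _ 0); [reflexivity|].
      apply Ces_lim, Ces_lim, Lx.
    + extensionality k. unfold Dseq, x. fold (blk k).
      pose proof ln2_pos. pose proof (two_pow_pos (blk k)).
      destruct lt_dec; field; lra.
Qed.

Lemma Ces_bsum_close a b eps : (forall n, Rabs (rsum (2 ^ n - 1) a - rsum (2 ^ n - 1) b) <= eps * INR n) ->
  forall n, Rabs (Ces (bsum a) n - Ces (bsum b) n) <= eps / ln 2.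
Proof.
  intros H n. rewrite !Ces_rsum, !rsum_bsum. specialize (H (S n)).
  pose proof ln2_pos. pose proof (INR_S_pos n).
  set (sa := rsum (2 ^ S n - 1) a) in *. set (sb := rsum (2 ^ S n - 1) b) in *.
  replace (/ ln 2 * sa / INR (S n) - / ln 2 * sb / INR (S n))
    with (/ (ln 2 * INR (S n)) * (sa - sb)) by (field; lra).
  assert (P : 0 < ln 2 * INR (S n)) by nra.
  apply Rabs_inv_mult_le; [exact P|].
  replace (ln 2 * INR (S n) * (eps / ln 2)) with (eps * INR (S n)) by (field; lra). exact H.
Qed.

(** * Perturbation to an injective operator *)

(** Injective, positive, and of trace exactly 1 for a normalised trace, since its singular values
    are [1 / (n + 1)]. *)
Definition harmonic_op : op := diag harm.

Lemma harm_pos k : 0 < harm k.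
Proof. apply Rinv_pos, INR_S_pos. Qed.

Lemma harm_decr k : harm (S k) <= harm k.
Proof. unfold harm. apply Rinv_le_contravar; [apply INR_S_pos|apply le_INR; lia]. Qed.

Lemma harm_le1 k : harm k <= 1.
Proof.
  unfold harm. rewrite <- Rinv_1. apply Rinv_le_contravar; [lra|].
  rewrite S_INR. pose proof (pos_INR k). lra.
Qed.

Lemma weak_l1_harm : weak_l1 harm.
Proof.
  exists 1. intros k. rewrite Rabs_pos_eq by (left; apply harm_pos). unfold harm, Rdiv. lra.
Qed.

Lemma innerRe_diag_pos z x : (forall k, 0 < z k) -> (forall k, z k <= 1) -> l2 x ->
  innerRe (diag z x) x = 0 -> x = vzero.
Proof.
  intros Hz Hz1 Hx E.
  assert (HB : forall k, Rabs (z k) <= 1).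
  { intros k. rewrite Rabs_pos_eq by (left; apply Hz). apply Hz1. }
  assert (F : forall k, Re (diag z x k * Cconj (x k))%C = z k * Cmod (x k) ^ 2).
  { intros k. unfold diag. rewrite Cmod2_alt. destruct (x k). unfold Re, Im; simpl. ring. }
  extensionality j. unfold vzero. apply Cmod_eq_0.
  assert (P : rsum (S j) (fun k => Re (diag z x k * Cconj (x k))%C) <= 0).
  { rewrite <- E. apply rsum_le_series.
    - intros k. rewrite F. apply Rmult_le_pos; [left; apply Hz|apply pow2_ge_0].
    - apply (ip_ex Re); [apply re_le_Cmod| |exact Hx]. apply (op_l2 (diag z)); [apply (bounded_diag z 1 HB)|exact Hx]. }
  rewrite (rsum_ext _ _ _ (fun k _ => F k)) in P.
  change (rsum j (fun k => z k * Cmod (x k) ^ 2) + z j * Cmod (x j) ^ 2 <= 0) in P.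
  pose proof (rsum_nonneg j (fun k => z k * Cmod (x k) ^ 2)
    (fun k _ => Rmult_le_pos _ _ (Rlt_le _ _ (Hz k)) (pow2_ge_0 _))) as Q.
  cbv beta in P, Q. pose proof (Hz j) as Zj.
  destruct (Cmod_ge_0 (x j)) as [M|M]; [exfalso|auto].
  pose proof (Rmult_lt_0_compat _ _ Zj (pow_lt _ 2 M)). lra.
Qed.

(** Under the perturbation the trace moves by exactly [d] and the value of [theta] by at most
    [eps / ln 2]; both bounds tend to 0 with [n]. *)
Lemma tau_double_cesaro tau theta A : is_trace tau -> trace_positive tau -> trace_normalised tau ->
  ext_limit_seq theta ->
  (forall x, bounded_seq x -> tau (diag (Dseq x)) = RtoC (theta (Ces (Ces x)))) ->
  L1inf A -> positive_op A ->
  tau A = RtoC (theta (Ces (Ces (bsum (fun n => mu n A))))).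
Proof.
  intros HT HP HNm Hth HD HL Hpos. pose proof HL as [[HA _] _].
  destruct (L1inf_bound A HL) as [c [c0 Hc]].
  assert (BG : forall k, Rabs (harm k) <= 1).
  { intros k. rewrite Rabs_pos_eq by (left; apply harm_pos). apply harm_le1. }
  assert (LG : L1inf harmonic_op) by (apply L1inf_diag, weak_l1_harm).
  assert (PG : positive_op harmonic_op)
    by (apply (positive_diag harm 1); [exact BG|intros; left; apply harm_pos]).
  assert (HBG : bounded_op harmonic_op) by apply PG.
  assert (TG : tau harmonic_op = RtoC 1).
  { apply HNm; [exact LG|exact PG|]. intros n.
    apply (mu_diag harm n); [intros; left; apply harm_pos|apply harm_decr]. }
  set (b := fun n => mu n A) in *. set (v := theta (Ces (Ces (bsum b)))).
  assert (b0 : forall k, 0 <= b k) by (intros; apply mu_nonneg, HA).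
  assert (K : forall n, Rabs (Re (tau A) - v) <= (1 + (2 * c + 3) / ln 2) / INR (S n)).
  (* [rsum_fan_compare] costs multiples of [1 / (p - 1)] and of [d p]; with [d = 1 / p^2] both are
     [O(1 / n)]. The choice [p = n + 2] makes [p - 1 = n + 1]. *)
  { intros n. set (p := S (S n)). set (d := / (INR p * INR p)).
    pose proof (INR_S_pos n) as Pn. assert (Pp : 0 < INR p) by (apply INR_S_pos).
    assert (Ep : INR p = INR (S n) + 1) by (unfold p; rewrite (S_INR (S n)); ring).
    assert (Pn1 : 1 <= INR (S n)) by (rewrite S_INR; pose proof (pos_INR n); lra).
    assert (d0 : 0 < d) by (apply Rinv_pos; nra).
    assert (dp : d * INR p <= / INR (S n)).
    { unfold d. rewrite Rinv_mult. rewrite Rmult_assoc, Rinv_l, Rmult_1_r by lra.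
      apply Rinv_le_contravar; lra. }
    assert (d1 : d <= / INR (S n)) by nra.
    assert (i1 : / INR (S n) <= 1) by (apply harm_le1).
    set (A' := opadd A (opscale (RtoC d) harmonic_op)).
    assert (HA' : bounded_op A') by (apply bounded_opadd; auto).
    set (b' := fun n => mu n A').
    assert (b0' : forall k, 0 <= b' k) by (intros; apply mu_nonneg, HA').
    assert (ES : opscale (RtoC d) harmonic_op = diag (fun k => d * harm k)).
    { extensionality x; extensionality k.
      unfold opscale, harmonic_op, diag. rewrite RtoC_mult. ring. }
    assert (F1 : forall k m, b' (k + m)%nat <= b k + d / INR (S m)).
    { intros k m. unfold b', b, A'. eapply Rle_trans; [apply mu_opadd; auto|].
      apply Rplus_le_compat_l. rewrite ES. right.
      apply (mu_diag (fun k => d * harm k)).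
      - intros j. pose proof (harm_pos j). nra.
      - intros j. pose proof (harm_decr j). nra. }
    (* The reverse comparison: [A] is [A'] plus the diagonal operator with the opposite sign, whose
       singular values obey the same bound. *)
    assert (F2 : forall k m, b (k + m)%nat <= b' k + d / INR (S m)).
    { intros k m. unfold b', b.
      replace A with (opadd A' (diag (fun k => - d * harm k))) at 1.
      - assert (Bd : forall j, Rabs (- d * harm j) <= d / INR (S j)).
        { intros j. rewrite Rabs_mult, Rabs_Ropp, !Rabs_pos_eq by (left; auto using harm_pos).
          right; reflexivity. }
        assert (Bd' : forall j, Rabs (- d * harm j) <= d).
        { intros j. eapply Rle_trans; [apply Bd|]. pose proof (harm_le1 j). unfold harm in H.
          unfold Rdiv. nra. }
        eapply Rle_trans; [apply mu_opadd; [exact HA'|apply (bounded_diag _ d Bd')]|].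
        apply Rplus_le_compat_l. apply mu_diag_le with d; [exact Bd'|].
        intros j Hj. eapply Rle_trans; [apply Bd|]. apply div_INR_decr; [lra|exact Hj].
      - extensionality x; extensionality k0.
        unfold A', opadd, opscale, harmonic_op, diag. rewrite RtoC_mult, RtoC_opp. ring. }
    (* A bound independent of [n]: splitting the index in halves doubles the constants [c] and [d],
       and [d <= 1]. *)
    assert (bc' : forall k, b' k <= (2 * c + 2) / INR (S k)).
    { intros k. pose proof (Nat.div_mod_eq k 2). pose proof (Nat.mod_upper_bound k 2 ltac:(lia)).
      assert (G : forall m e, 0 <= e -> (S k <= 2 * S m)%nat -> e / INR (S m) <= 2 * e / INR (S k)).
      { intros m e He Hm. apply le_INR in Hm. rewrite mult_INR in Hm. simpl (INR 2) in Hm.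
        pose proof (INR_S_pos k); pose proof (INR_S_pos m).
        apply Rmult_le_reg_r with (INR (S k) * INR (S m)); [nra|].
        replace (e / INR (S m) * (INR (S k) * INR (S m))) with (e * INR (S k)) by (field; lra).
        replace (2 * e / INR (S k) * (INR (S k) * INR (S m))) with (e * (2 * INR (S m))) by (field; lra).
        apply Rmult_le_compat_l; lra. }
      replace k with (k / 2 + (k - k / 2))%nat at 1 by lia.
      eapply Rle_trans; [apply F1|].
      eapply Rle_trans; [apply Rplus_le_compat; [apply Hc|apply Rle_refl]|].
      eapply Rle_trans; [apply Rplus_le_compat; [apply (G (k / 2)%nat c c0); lia|
        apply (G (k - k / 2)%nat d ltac:(lra)); lia]|].
      pose proof (INR_S_pos k).
      replace (2 * c / INR (S k) + 2 * d / INR (S k)) with ((2 * c + 2 * d) / INR (S k)) by (field; lra).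
      apply Rmult_le_compat_r; [left; apply Rinv_pos; assumption|]. lra. }
    assert (LA' : L1inf A') by (apply L1inf_intro with (2 * c + 2); assumption).
    assert (IA' : forall x, innerRe (A' x) x = innerRe (A x) x + d * innerRe (harmonic_op x) x \/ ~ l2 x).
    { intros x. destruct (classic (l2 x)) as [Hx|Hx]; [left|right; exact Hx].
      unfold A'. rewrite opadd_lin, opscale_lin, !innerRe_ip.
      rewrite ip_lin_l by auto.
      rewrite ip_lin_l by auto.
      destruct (ip (A x) x), (ip (harmonic_op x) x). unfold Re; simpl. ring. }
    assert (PA' : positive_op A').
    { split; [exact HA'|]. intros x Hx. split.
      - change (Im (ip (A' x) x) = 0). unfold A'. rewrite opadd_lin, opscale_lin.
        rewrite ip_lin_l by auto. rewrite ip_lin_l by auto.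
        rewrite (ip_positive A x Hpos Hx), (ip_positive harmonic_op x PG Hx).
        unfold Im; simpl. ring.
      - destruct (IA' x) as [E|E]; [|contradiction]. rewrite E.
        pose proof (proj2 (proj2 Hpos x Hx)). pose proof (proj2 (proj2 PG x Hx)). nra. }
    assert (NA' : forall x, l2 x -> A' x = vzero -> x = vzero).
    { intros x Hx E. destruct (IA' x) as [E2|E2]; [|contradiction].
      rewrite E, (innerRe_ip vzero), ip_zero_l in E2. unfold Re in E2; simpl in E2.
      apply (innerRe_diag_pos harm x harm_pos harm_le1 Hx).
      pose proof (proj2 (proj2 Hpos x Hx)). pose proof (proj2 (proj2 PG x Hx)).
      fold harmonic_op. nra. }
    pose proof (tau_injective tau theta A' HT HP Hth HD LA' PA' NA') as E. fold b' in E.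
    assert (ET : Re (tau A') = Re (tau A) + d).
    { unfold A'. destruct HT as [HAd [HSc _]]. rewrite HAd, HSc, TG.
      - destruct (tau A). unfold Re; simpl. ring.
      - exact LG.
      - exact HL.
      - rewrite ES. apply L1inf_diag, weak_l1_scal, weak_l1_harm. }
    rewrite E in ET. change (Re (RtoC (theta (Ces (Ces (bsum b')))))) with (theta (Ces (Ces (bsum b')))) in ET.
    (* [2 c + 2] is the constant of [b'], and the remaining 1 pays for [d p <= 1 / (n + 1)]. *)
    set (eps := (2 * c + 3) / INR (S n)).
    assert (Hp1 : INR (p - 1) = INR (S n)) by (f_equal; unfold p; lia).
    assert (CE : forall k, Rabs (rsum (2 ^ k - 1) b' - rsum (2 ^ k - 1) b) <= eps * INR k).
    { intros k.
      pose proof (rsum_fan_compare p k b' b c d ltac:(unfold p; lia) b0 Hc ltac:(lra) F1) as R1.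
      pose proof (rsum_fan_compare p k b b' (2 * c + 2) d ltac:(unfold p; lia) b0' bc' ltac:(lra) F2) as R2.
      rewrite Hp1 in R1, R2. pose proof (pos_INR k) as Pk.
      assert (Q1 : (c / INR (S n) + d * INR p) * INR k <= eps * INR k).
      { apply Rmult_le_compat_r; [exact Pk|]. unfold eps, Rdiv.
        pose proof (Rinv_pos _ Pn). nra. }
      assert (Q2 : ((2 * c + 2) / INR (S n) + d * INR p) * INR k <= eps * INR k).
      { apply Rmult_le_compat_r; [exact Pk|]. unfold eps, Rdiv.
        pose proof (Rinv_pos _ Pn). nra. }
      abs_lra. }
    assert (BB : bounded_seq (bsum b)) by (apply (bounded_bsum b c); assumption).
    assert (BB' : bounded_seq (bsum b')) by (apply (bounded_bsum b' (2 * c + 2)); assumption).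
    assert (TC : Rabs (theta (Ces (Ces (bsum b'))) - v) <= eps / ln 2).
    { apply ext_close; auto using bounded_Ces. intros k.
      assert (G : Rabs (Ces (fun j => 1 * Ces (bsum b') j + -1 * Ces (bsum b) j) k) <= eps / ln 2).
      { apply Ces_abs_bound. intros j.
        replace (1 * Ces (bsum b') j + -1 * Ces (bsum b) j) with (Ces (bsum b') j - Ces (bsum b) j)
          by ring.
        apply Ces_bsum_close, CE. }
      rewrite Ces_lin in G.
      replace (Ces (Ces (bsum b')) k - Ces (Ces (bsum b)) k) with
        (1 * Ces (Ces (bsum b')) k + -1 * Ces (Ces (bsum b)) k) by ring. exact G. }
    replace ((1 + (2 * c + 3) / ln 2) / INR (S n)) with (/ INR (S n) + eps / ln 2)
      by (unfold eps; pose proof ln2_pos; field; lra).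
    abs_lra. }
  assert (Ev : Re (tau A) = v) by (apply (eq_of_close _ _ _ K), is_lim_div_INR).
  destruct (HP A HL Hpos) as [Im0 _].
  destruct (tau A) as [r s]. unfold Re, Im in *; simpl in *. subst r s. reflexivity.
Qed.

(** Positivity under inequalities that hold almost everywhere, and boundedness under an essential
    bound, both follow because each ultrafilter contains the complement in its block of every null
    set. *)
Lemma connes_dixmier_of_double_cesaro tau theta : is_trace tau -> trace_positive tau ->
  trace_normalised tau -> ext_limit_seq theta ->
  (forall x, bounded_seq x -> tau (diag (Dseq x)) = RtoC (theta (Ces (Ces x)))) ->
  connes_dixmier tau.
Proof.
  intros HT HP HNm Hth HD.
  destruct (choice (fun n V => ultra V /\
    forall N : R -> Prop, lnull N -> V (fun t => 2 ^ n <= t <= 2 ^ S n /\ ~ N t))) as [V HV].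
  { intros n. apply ultra_interval. simpl. pose proof (two_pow_pos n). lra. }
  assert (UV : forall n, ultra (V n)) by apply HV.
  assert (PV : forall n t, 2 ^ n <= t -> 0 < t) by (intros n t; pose proof (two_pow_pos n); lra).
  (* [epsilon] makes [vl n] a total function; for [f] in [Linf] the limit exists and [vl n f] is
     that limit. *)
  set (vl := fun n f => epsilon (inhabits 0) (fun l => is_ulim (V n) f l)).
  assert (Vbd : forall f, Linf f -> exists M, forall n, V n (fun t => Rabs (f t) <= M)).
  { intros f [_ [M HM]]. exists M. intros n. destruct (HV n) as [U1 U2].
    refine (ultra_imp U1 _ _ _ (U2 _ HM)). intros t [Ht Hn]. apply Rnot_lt_le. intros Hl.
    apply Hn. split; [apply (PV n); lra|exact Hl]. }
  assert (Vsp : forall f n, Linf f -> is_ulim (V n) f (vl n f)).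
  { intros f n Hf. unfold vl. apply epsilon_spec. destruct (Vbd f Hf) as [M HM].
    apply (ultra_limit (V n) f M (UV n) (HM n)). }
  assert (Vbs : forall f, Linf f -> bounded_seq (fun n => vl n f)).
  { intros f Hf. destruct (Vbd f Hf) as [M HM]. exists M. intros n.
    rewrite <- (Rminus_0_r (vl n f)). apply (is_ulim_close (V n) f); auto.
    refine (ultra_imp (UV n) _ _ _ (HM n)). intros t Ht. rewrite Rminus_0_r. exact Ht. }
  assert (Vcl : forall f n l e, Linf f -> (forall t, 2 ^ n <= t <= 2 ^ S n -> Rabs (f t - l) <= e) ->
    Rabs (vl n f - l) <= e).
  { intros f n l e Hf H. destruct (HV n) as [U1 U2]. apply (is_ulim_close (V n) f); auto.
    refine (ultra_imp U1 _ _ _ (U2 (fun _ => False) (lnull_empty _ (fun _ H => H)))).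
    intros t [Ht _]. apply H, Ht. }
  assert (Vlin : forall a f b g, Linf f -> Linf g ->
    (fun n => vl n (fun t => a * f t + b * g t)) = (fun n => a * vl n f + b * vl n g)).
  { intros a f b g Hf Hg. extensionality n.
    apply (is_ulim_unique (V n) (fun t => a * f t + b * g t) _ _ (UV n)).
    - apply Vsp, Linf_lin; assumption.
    - apply is_ulim_plus; [apply UV| |]; apply is_ulim_mult; auto using is_ulim_const. }
  exists (fun f => theta (fun n => vl n f)). split.
  - split; [|split; [|split]].
    + intros f g Hf Hg.
      replace (fun t => f t + g t) with (fun t => 1 * f t + 1 * g t)
        by (extensionality k'; ring).
      rewrite Vlin, ext_lin by auto. ring.
    + intros a f Hf.
      replace (fun t => a * f t) with (fun t => a * f t + 0 * f t)
        by (extensionality k'; ring).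
      rewrite Vlin, ext_lin by auto. ring.
    + intros f Hf Hn. destruct Hth as [_ [_ [HPos _]]]. apply HPos; [apply Vbs, Hf|].
      intros n. destruct (HV n) as [U1 U2].
      apply (is_ulim_le (V n) (fun _ => 0) f _ _ U1); [apply is_ulim_const, U1|apply Vsp, Hf|].
      refine (ultra_imp U1 _ _ _ (U2 _ Hn)). intros t [Ht Hnt]. apply Rnot_lt_le. intros Hl.
      apply Hnt. split; [apply (PV n); lra|exact Hl].
    + intros f l Hf Hl. destruct Hth as [_ [_ [_ HLim]]]. apply HLim.
      apply is_lim_seq_spec. intros eps. apply is_lim_spec in Hl.
      pose proof (cond_pos eps) as He.
      destruct (Hl (mkposreal (eps / 2) ltac:(lra))) as [M HM]. simpl in HM.
      destruct (INR_unbounded (Rabs M)) as [N HN]. exists N. intros n Hn.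
      apply Rle_lt_trans with (eps / 2); [|lra]. apply Vcl; [exact Hf|].
      intros t [Ht _]. left. apply HM.
      pose proof (Rle_abs M). apply le_INR in Hn.
      assert (INR n < 2 ^ n) by (rewrite <- INR_two_pow; apply lt_INR, Nat.pow_gt_lin_r; lia).
      lra.
  - intros A HL Hpos. rewrite (tau_double_cesaro tau theta A HT HP HNm Hth HD HL Hpos).
    destruct (L1inf_bound A HL) as [c [c0 Hc]].
    set (b := fun n => mu n A) in *.
    assert (b0 : forall k, 0 <= b k) by (intros; apply mu_nonneg, HL).
    change (Mop (avg_mu A)) with (Mop (lavg b)).
    pose proof (Linf_Mop_lavg b c b0 Hc) as LM.
    destruct (Mop_lavg_asymptotic b c b0 Hc) as [err [He Hcl]].
    f_equal. symmetry. apply ext_asymptotic with err; [exact Hth|apply Vbs, LM| |exact He|].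
    + apply bounded_Ces, bounded_Ces, (bounded_bsum b c b0 Hc).
    + intros n Hn. apply Vcl; [exact LM|]. intros t Ht. apply Hcl; assumption.
Qed.

Theorem theorem5p13 (tau : op -> C) :
  is_trace tau -> trace_positive tau -> trace_normalised tau ->
  (connes_dixmier tau <->
   exists theta : (nat -> R) -> R, ext_limit_seq theta /\
     forall x : nat -> R, bounded_seq x ->
       tau (diag (Dseq x)) = RtoC (theta (Ces (Ces x)))).
Proof.
  intros HT HP HN. split.
  - apply double_cesaro_of_connes_dixmier, HT.
  - intros [theta [Hth HD]]. eapply connes_dixmier_of_double_cesaro; eassumption.
Qed.
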